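(* For every $s\in\mathbb N$ and $\mu\in\mathcal P(\mathcal X)$, there exists a continuous functional $\Delta_\mu:\overline{\mathcal M_\mu}^{\ell^\infty(B^s)}\times\overline{\mathcal M_\mu}^{\ell^\infty(B^s)}\to\mathbb R$ such that for every family $(\mu_t^1,\mu_t^2)\in\mathcal P_\mu\times\mathcal P_\mu$, $t>0$, with $t^{-1}(\mu_t^i-\mu)\to\gamma^i$ in $\ell^\infty(B^s)$ as $t\downarrow0$ for $i=1,2$, we have $$\frac{\bar{\mathsf S}_{c,\varepsilon}(\mu_t^1,\mu_t^2)}{t^2/2}\to\Delta_\mu(\boldsymbol\gamma),\qquad\boldsymbol\gamma=(\gamma^1,\gamma^2),$$ as $t\downarrow 0$. The functional $\Delta_\mu$ is positively homogeneous of degree $2$, i.e. $\Delta_\mu(t\boldsymbol\gamma)=t^2\Delta_\mu(\boldsymbol\gamma)$ for all $t>0$.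
   Context: Fix $d\in\mathbb N$, $\varepsilon>0$, a smooth (infinitely differentiable) symmetric cost function $c:\mathbb R^d\times\mathbb R^d\to[0,\infty)$, and a bounded closed ball $\mathcal X\subset\mathbb R^d$. $\mathcal P(\mathcal X)$ is the set of Borel probability measures on $\mathcal X$. For $\mu^1,\mu^2\in\mathcal P(\mathcal X)$, $$\mathsf S_{c,\varepsilon}(\mu^1,\mu^2)=\inf_{\pi\in\Pi(\mu^1,\mu^2)}\int c\,d\pi+\varepsilon\,\mathsf D_{\mathsf{KL}}(\pi\|\mu^1\otimes\mu^2),$$ where $\Pi(\mu^1,\mu^2)$ is the set of couplings and $\mathsf D_{\mathsf{KL}}$ is the Kullback–Leibler divergence, and the Sinkhorn divergence is $$\bar{\mathsf S}_{c,\varepsilon}(\mu^1,\mu^2)=\mathsf S_{c,\varepsilon}(\mu^1,\mu^2)-\tfrac12\big(\mathsf S_{c,\varepsilon}(\mu^1,\mu^1)+\mathsf S_{c,\varepsilon}(\mu^2,\mu^2)\big).$$ $\mathcal C^s(\mathcal X)$ is the Banach space of functions on $\mathcal X$ having continuous derivatives of all orders $\le s$ on $\mathrm{int}(\mathcal X)$ that extend continuously to $\mathcal X$, with norm $\|f\|_{\mathcal C^s(\mathcal X)}=\sum_{j=0}^s\max_{|k|=j}\|D^kf\|_{\infty,\mathrm{int}(\mathcal X)}$; $B^s$ is its closed unit ball; $\ell^\infty(B^s)$ is the space of bounded real functions on $B^s$ with the sup-norm. A finite signed Borel measure $\gamma$ on $\mathcal X$ is identified with the element $f\mapsto\int f\,d\gamma$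 of $\ell^\infty(B^s)$. For $\eta\in\mathcal P(\mathcal X)$: $\mathcal P_\eta=\{\nu\in\mathcal P(\mathcal X):\mathrm{spt}(\nu)\subset\mathrm{spt}(\eta)\}$ and $\mathcal M_\eta=\{t(\nu-\eta):\nu\in\mathcal P_\eta,\ t>0\}$; $\overline{A}^{\ell^\infty(B^s)}$ is the closure of $A$ in $\ell^\infty(B^s)$. *)

(* Defs.v *)
From HB Require Import structures.
From mathcomp Require Import all_boot all_order all_algebra.
From mathcomp Require Import all_classical all_reals all_analysis.
From mathcomp Require Import measurable_realfun.

Set Implicit Arguments.
Unset Strict Implicit.
Unset Printing Implicit Defensive.
Import Order.TTheory GRing.Theory Num.Theory.
Import numFieldNormedType.Exports.

Local Open Scope classical_set_scope.
Local Open Scope ring_scope.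

(* The space of bounded real functions on [I], with the sup norm. *)
Section linf_type.
Context (R : realType) (I : Type).

Definition linf_pred : {pred I -> R} :=
  mem [set f : I -> R | [bounded f i | i in [set: I]]].

Record linf := Linf { linf_fun :> I -> R ; linf_funP : linf_fun \in linf_pred }.

HB.instance Definition _ := [isSub for linf_fun].
HB.instance Definition _ := [Choice of linf by <:].

Lemma linf_predP (f : I -> R) :
  f \in linf_pred <-> exists M, forall i, `|f i| <= M.
Proof.
rewrite inE /= /bounded_near; split.
  move=> [M [_ hM]]; exists (M + 1) => i.
  by apply: (hM (M + 1)) => //; rewrite ltrDl.
move=> [M hM]; exists M; split; first exact: num_real.
by move=> x Mx i _; exact: le_trans (hM i) (ltW Mx).
Qed.

Lemma linf_submod_closed : submod_closed linf_pred.
Proof.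
split; first by apply/linf_predP; exists 0 => i; rewrite normr0.
move=> k f g /linf_predP[M hM] /linf_predP[N hN]; apply/linf_predP.
exists (`|k| * M + N) => i; apply: le_trans (ler_normD _ _) _.
by apply: lerD => //; rewrite normrM ler_wpM2l.
Qed.

HB.instance Definition _ :=
  GRing.isSubmodClosed.Build R (I -> R) linf_pred linf_submod_closed.
HB.instance Definition _ := [SubChoice_isSubLmodule of linf by <:].

Definition linf_norm (f : linf) : R := sup (range (fun i => `|f i|)).

Lemma linf_norm_ub (f : linf) i : `|f i| <= linf_norm f.
Proof.
apply: ub_le_sup; last by exists i.
by have /linf_predP[M hM] := linf_funP f; exists M => _ [j _ <-].
Qed.

Lemma linf_norm_le (f : linf) M :
  0 <= M -> (forall i, `|f i| <= M) -> linf_norm f <= M.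
Proof.
move=> M0 hM; rewrite /linf_norm.
have [->|/set0P ne] := eqVneq (range (fun i => `|f i|)) set0.
  by rewrite sup0.
by apply: ge_sup => // _ [i _ <-].
Qed.

Lemma linf_norm_ge0 (f : linf) : 0 <= linf_norm f.
Proof.
rewrite /linf_norm.
have [->|/set0P[_ [i _ _]]] := eqVneq (range (fun i => `|f i|)) set0.
  by rewrite sup0.
exact: le_trans (normr_ge0 _) (linf_norm_ub f i).
Qed.

Lemma linf_normD (f g : linf) : linf_norm (f + g) <= linf_norm f + linf_norm g.
Proof.
apply: linf_norm_le => [|i]; first by rewrite addr_ge0 ?linf_norm_ge0.
by apply: le_trans (ler_normD _ _) _; rewrite lerD ?linf_norm_ub.
Qed.

Lemma linf_normZ (k : R) (f : linf) : linf_norm (k *: f) = `|k| * linf_norm f.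
Proof.
have le1 (l : R) (g : linf) : linf_norm (l *: g) <= `|l| * linf_norm g.
  apply: linf_norm_le => [|i]; first by rewrite mulr_ge0 ?linf_norm_ge0.
  by rewrite /= normrM ler_wpM2l ?linf_norm_ub.
apply/eqP; rewrite eq_le le1 /=; have [->|k0] := eqVneq k 0.
  by rewrite normr0 mul0r linf_norm_ge0.
rewrite -ler_pdivlMl ?normr_gt0// -normfV.
by apply: le_trans (le1 _ _); rewrite scalerA mulVf// scale1r.
Qed.

Lemma linf_norm0_eq0 (f : linf) : linf_norm f = 0 -> f = 0.
Proof.
move=> f0; apply/val_inj/funext => i /=; apply/eqP.
by rewrite -normr_le0 -f0 linf_norm_ub.
Qed.

HB.instance Definition _ :=
  Lmodule_isNormed.Build R linf linf_normD linf_normZ linf_norm0_eq0.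

End linf_type.

(* [R^d] with its topology and its Borel sigma-algebra. *)
Definition Rd (R : realType) (d : nat) := 'rV[R]_d.
HB.instance Definition _ (R : realType) (d : nat) :=
  NormedModule.copy (Rd R d) 'rV[R]_d.
HB.instance Definition _ (R : realType) (d : nat) :=
  Measurable.copy (Rd R d) (g_sigma_algebraType (@open 'rV[R]_d)).

Section euclidean_ball.
Context (R : realType) (d : nat).
Implicit Types (x y a : Rd R d).

(* The library norm on ['rV[R]_d] is the sup norm. *)
Definition enorm x : R := Num.sqrt (\sum_(i < d) x ord0 i ^+ 2).

Definition closed_eball a (r : R) : set (Rd R d) :=
  [set x | enorm (x - a) <= r].

Lemma enormZ (k : R) x : enorm (k *: x) = `|k| * enorm x.
Proof.
rewrite /enorm -sqrtr_sqr -sqrtrM ?sqr_ge0// mulr_sumr.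
by congr Num.sqrt; apply: eq_bigr => i _; rewrite mxE exprMn.
Qed.

Lemma continuous_enorm_sub a : continuous (fun x => enorm (x - a)).
Proof.
move=> x; rewrite /enorm; apply: continuous_comp; last exact: sqrt_continuous.
suff cf (i : 'I_d) : continuous (fun y : Rd R d => (y - a) ord0 i ^+ 2).
  have := @continuous_big R 'I_d +%R 0 predT add_continuous (Rd R d)
    (index_enum 'I_d) _ (fun i _ => cf i).
  exact.
move=> {}x.
apply: (@continuous_comp _ _ _ (fun y : Rd R d => (y - a) ord0 i)
  (fun z : R => z ^+ 2)); last exact: exprn_continuous.
apply: (@continuous_comp _ _ _ (fun y : Rd R d => y - a)
  (fun y : Rd R d => y ord0 i)); last exact: coord_continuous.
have h := @continuousB R (Rd R d) _ id (cst a) x (@cvg_id _ _).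
exact: h (@cst_continuous _ _ a x).
Qed.

Lemma closed_eball_closed a (r : R) : closed (closed_eball a r).
Proof.
rewrite -openC.
rewrite (_ : ~` _ = (fun x => enorm (x - a)) @^-1` [set t | r < t]).
  apply: open_comp; last exact: open_gt.
  by move=> x _; exact: continuous_enorm_sub.
by apply/seteqP; split=> x /=; rewrite ltNge => /negP.
Qed.

Lemma open_eball_interior a (r : R) :
  [set x | enorm (x - a) < r] `<=` (closed_eball a r)°.
Proof.
have op : open [set x | enorm (x - a) < r].
  apply: (@open_comp _ _ (fun x => enorm (x - a)) [set t | t < r]).
    by move=> z _; exact: continuous_enorm_sub.
  exact: open_lt.
move=> x xr; apply: filterS (open_nbhs_nbhs (conj op xr)) => y /= yr.
exact: ltW.
Qed.

Lemma closed_eball_closure a (r : R) : 0 < r ->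
  closed_eball a r `<=` closure (closed_eball a r)°.
Proof.
move=> r0 x xr U xU.
have cf : {for 0, continuous (fun t : R => x + t *: (a - x))}.
  apply: cvgD; first exact: cvg_cst.
  by apply: cvgZr_tmp; exact: cvg_id.
have : \forall t \near 0^'+, U (x + t *: (a - x)).
  apply: cvg_at_right_filter cf _ _.
  by rewrite scale0r addr0.
move=> Ut.
near (0:R)^'+ => t.
have t0 : 0 < t by near: t; exact: nbhs_right_gt.
have t1 : t < 1 by near: t; exact: nbhs_right_lt.
exists (x + t *: (a - x)); split; last by near: t.
apply: open_eball_interior => /=.
have -> : x + t *: (a - x) - a = (1 - t) *: (x - a).
  by rewrite -[a - x]opprB scalerN scalerBl scale1r addrAC.
rewrite enormZ gtr0_norm ?subr_gt0//.
apply: (@le_lt_trans _ _ ((1 - t) * r)).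
  by rewrite ler_wpM2l// subr_ge0 ltW.
by rewrite mulrBl mul1r gtrBl mulr_gt0.
Unshelve. all: by end_near. Qed.

Lemma measurable_open (U : set (Rd R d)) : open U -> measurable U.
Proof. exact: sub_sigma_algebra. Qed.

Lemma measurable_closed (F : set (Rd R d)) : closed F -> measurable F.
Proof.
move=> Fc; rewrite -[F]setCK; apply: measurableC; apply: measurable_open.
exact: closed_openC.
Qed.

Lemma within_continuous_measurable (F : set (Rd R d)) (f : Rd R d -> R) :
  closed F -> {within F, continuous f} -> measurable_fun F f.
Proof.
move=> Fc /continuousP cf mF.
apply: (measurability _ (RGenOpens.measurableE R)) => //.
move=> _ [_ [p [q ->] <-]].
have /open_subspaceP[V oV VF] := cf _ (@interval_open R (BRight p) (BLeft q) isT isT).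
by rewrite setIC -VF; apply: measurableI => //; exact: measurable_open.
Qed.

End euclidean_ball.

Section smooth_functions.
Context (R : realType).

(* Class C^n on the open set [U], for a finite-dimensional [V]: all iterated
   directional derivatives of order at most [n] exist and are continuous on
   [U]. *)
Fixpoint Cn_on (V : normedModType R) (U : set V) (n : nat) (f : V -> R) : Prop :=
  (forall x, U x -> {for x, continuous f}) /\
  if n is m.+1 then
    forall v : V, (forall x, U x -> derivable f x v) /\
                  Cn_on U m (fun x => 'D_v f x)
  else True.

Definition smooth (V : normedModType R) (f : V -> R) : Prop :=
  forall n, Cn_on [set: V] n f.

End smooth_functions.

Section Cs_space.
Context (R : realType) (d : nat).
Implicit Types (X : set (Rd R d)) (f : Rd R d -> R) (k : 'I_d -> nat).

Definition mderiv k f : Rd R d -> R :=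
  foldr (fun i g => iter (k i) (fun h x => 'D_(delta_mx ord0 i : Rd R d) h x) g)
    f (enum 'I_d).

(* A function on [X] is represented by its extension by zero to the whole
   space. *)
Definition Cs X (s : nat) f : Prop :=
  [/\ forall x, ~ X x -> f x = 0,
      Cn_on X° s f,
      {within X, continuous f} &
      forall k, (\sum_(i < d) k i <= s)%N ->
        exists g : Rd R d -> R, {within X, continuous g} /\
          forall x, X° x -> g x = mderiv k f x].

(* The entries of a multi-index of order [j] are at most [j], so the maximum is
   over all of them. The norm is finite on [Cs X s] for [X] compact. *)
Definition Cs_norm X (s : nat) f : \bar R :=
  (\sum_(j < s.+1)
    \big[maxe/0]_(k : {ffun 'I_d -> 'I_j.+1} | (\sum_(i < d) k i == j)%N)
      ereal_sup [set `|mderiv (fun i => k i) f x|%:E | x in X°])%E.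

Definition Cs_ball X (s : nat) : set (Rd R d -> R) :=
  [set f | Cs X s f /\ (Cs_norm X s f <= 1)%E].

Lemma mderiv0 k f : (forall i, k i = 0%N) -> mderiv k f = f.
Proof. by move=> k0; rewrite /mderiv; elim: (enum _) => //= i l ->; rewrite k0. Qed.

Lemma Cs_ball_le1_interior X s f x : Cs_ball X s f -> X° x -> `|f x| <= 1.
Proof.
move=> [_ f1] Xx; rewrite -lee_fin; apply: le_trans f1.
have max_ge0 (j : nat) : (0 <= \big[maxe/0]_(k : {ffun 'I_d -> 'I_j.+1} | (\sum_(i < d) k i == j)%N)
      ereal_sup [set `|mderiv (fun i => k i) f x|%:E | x in X°])%E.
  by elim/big_ind : _ => // [u v u0 v0|k _]; [rewrite le_max u0|
    apply: le_trans (ereal_sup_ubound _); [|exists x; [exact: Xx|reflexivity]];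
    rewrite lee_fin].
rewrite /Cs_norm big_ord_recl; apply: (@le_trans _ _ (_ + 0)%E); last first.
  by apply: leeD2l; apply: sume_ge0 => j _; exact: max_ge0.
rewrite adde0; apply: le_trans (le_bigmax_cond _ _ (j := [ffun=> ord0]) _).
  apply: ereal_sup_ubound; exists x => //.
  by rewrite mderiv0// => i; rewrite ffunE.
by rewrite big1// => i _; rewrite ffunE.
Qed.

Lemma Cs_ball_le1 (a : Rd R d) (r : R) s f x : 0 < r ->
  Cs_ball (closed_eball a r) s f -> closed_eball a r x -> `|f x| <= 1.
Proof.
move=> r0 fB Xx; rewrite leNgt; apply/negP => fx.
have [[_ _ cf _] _] := fB.
have /continuousP/(_ [set y : R | 1 < `|y|]) := cf.
have o1 : open [set y : R | 1 < `|y|].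
  apply: (@open_comp _ _ (fun z : R => `|z|) [set t | 1 < t]); last exact: open_gt.
  by move=> y _; exact: norm_continuous.
move=> /(_ o1)/open_subspaceP[V oV VX].
have [y [Xy Vy]] : (closed_eball a r)° `&` V !=set0.
  apply: (closed_eball_closure r0 Xx); apply: open_nbhs_nbhs; split => //.
  have [] : (V `&` closed_eball a r) x by rewrite VX; split.
  by [].
have : (V `&` closed_eball a r) y by split=> //; exact: interior_subset.
rewrite VX => -[/= ]; rewrite ltNge => /negP + _; apply.
exact: Cs_ball_le1_interior fB Xy.
Qed.

End Cs_space.

Section measures.
Context (R : realType) (d : nat).
Implicit Types (mu nu eta : probability (Rd R d) R).

(* Probability measures on a Borel set [X] are the Borel probability measures
   on the whole space that give mass 1 to [X]. *)
Definition prob_on (X : set (Rd R d)) : set (probability (Rd R d) R) :=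
  [set nu | nu X = 1%E].

Definition spt nu : set (Rd R d) :=
  [set x | forall U, open U -> U x -> (0 < nu U)%E].

Definition prob_spt_on (X : set (Rd R d)) eta : set (probability (Rd R d) R) :=
  prob_on X `&` [set nu | spt nu `<=` spt eta].

Lemma Rintegral_linf (a : Rd R d) (r : {posnum R}) s nu :
  (fun f : Cs_ball (closed_eball a r%:num) s =>
    \int[nu]_(x in closed_eball a r%:num) (\val f x)) \in @linf_pred R _.
Proof.
apply/linf_predP; exists 1 => f.
have fB : Cs_ball (closed_eball a r%:num) s (\val f) by exact: set_mem (valP f).
have mX : measurable (closed_eball a r%:num).
  by apply: measurable_closed; exact: closed_eball_closed.
have mf : measurable_fun (closed_eball a r%:num) (\val f).
  apply: within_continuous_measurable; first exact: closed_eball_closed.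
  by case: fB => -[].
have le1 : (\int[nu]_(x in closed_eball a r%:num) `|(\val f x)%:E| <= 1)%E.
  apply: (@le_trans _ _ (\int[nu]_(x in closed_eball a r%:num) 1)%E).
    apply: ge0_le_integral => //.
    - by apply/measurableT_comp => //; exact/measurable_EFinP.
    - by move=> x Xx; rewrite lee_fin; apply: Cs_ball_le1 fB Xx.
  by rewrite integral_cst// mul1e probability_le1.
have fi : nu.-integrable (closed_eball a r%:num) (EFin \o \val f).
  apply/integrableP; split; first exact/measurable_EFinP.
  exact: le_lt_trans le1 (ltry _).
rewrite -lee_fin EFin_normr_Rintegral//.
apply: le_trans le1; apply: le_abse_integral => //.
exact/measurable_EFinP.
Qed.

(* A measure is identified with the functional [f |-> \int f]; by linearity the
   signed measure [t (nu - eta)] is [t] times a difference of such. *)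
Definition linf_of_prob (a : Rd R d) (r : {posnum R}) (s : nat) nu :
  linf R (Cs_ball (closed_eball a r%:num) s) := Linf (Rintegral_linf a r s nu).

Definition tangent (a : Rd R d) (r : {posnum R}) (s : nat) eta :
  set (linf R (Cs_ball (closed_eball a r%:num) s)) :=
  [set g | exists nu t, [/\ prob_spt_on (closed_eball a r%:num) eta nu, 0 < t &
    g = t *: (linf_of_prob a r s nu - linf_of_prob a r s eta)]].

End measures.
Arguments tangent {R d} a r s eta _.

Section sinkhorn.
Context (R : realType).
Local Open Scope charge_scope.
Local Open Scope ereal_scope.

(* [ln] is total with [ln 0 = 0]; the density vanishes only on a [pi]-null
   set. *)
Definition KL (dd : measure_display) (T : measurableType dd)
    (pi rho : probability T R) : \bar R :=
  if `[< pi `<< rho >] then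
    \int[pi]_z (ln (fine ('d (charge_of_finite_measure pi) '/d rho z)))%:E
  else +oo.

Context (d : nat).
Implicit Types mu nu : probability (Rd R d) R.

Definition couplings mu nu : set (probability (Rd R d * Rd R d)%type R) :=
  [set pi | forall A : set (Rd R d), measurable A ->
     pi (A `*` setT) = mu A /\ pi (setT `*` A) = nu A].

Definition eot (c : Rd R d * Rd R d -> R) (eps : R) mu nu : \bar R :=
  ereal_inf [set (\int[pi]_z (c z)%:E) + eps%:E * KL pi (mu \x nu)
            | pi in couplings mu nu].

Definition sinkhorn_div (c : Rd R d * Rd R d -> R) (eps : R) mu nu : \bar R :=
  eot c eps mu nu - 2^-1%:E * (eot c eps mu mu + eot c eps nu nu).

End sinkhorn.

(* Main.v *)
Require Import Defs.
From HB Require Import structures.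
From mathcomp Require Import all_boot all_order all_algebra.
From mathcomp Require Import all_classical all_reals all_analysis.
From mathcomp Require Import measurable_realfun ring lra.
Import Order.TTheory GRing.Theory Num.Theory.
Import numFieldNormedType.Exports.
Local Open Scope classical_set_scope.
Local Open Scope ring_scope.

(** Let [u > 0] solve the Schroedinger equation
    [u(x) * \int e^(-c(x,y)/eps) u(y) mu(dy) = 1], and put
    [k(x,y) = u(x) u(y) e^(-c(x,y)/eps)], the density of the optimal plan from
    [mu] to itself.  For [nu1], [nu2] close to [mu] the kernel [k] fails to be
    the density of a coupling of [nu1] and [nu2] only by the defects
    [A_i(x) = \int k(x,y) nu_i(dy) - 1], which are linear in [nu_i - mu].  The
    density [k(x,y) (1 + phi(x) + psi(y))] has the right marginals to first
    order when [phi + K psi = - A_2] and [psi + K phi = - A_1], where [K] is the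
    integral operator of [k] with respect to [mu].  The claim is then

      [S(nu1,nu2) = \int f dnu1 + \int f dnu2 + eps (- B + q / 2) + O(N^3)],

    where [f = eps ln u], [B = \int A_2 dnu1],
    [q = - \int phi A_2 dmu - \int psi A_1 dmu], and [N] bounds the norms of
    [nu_i - mu] in [l^infty(B^s)].  In the Sinkhorn divergence the terms linear
    in [f] cancel, and [- B + q / 2] is a quadratic form in
    [(nu1 - mu, nu2 - mu)]; this gives the second-order limit along differences
    of probability measures.

    The expansion is a pair of matching inequalities, so that no potential has
    to be differentiated along a path.
    - From below, weak duality ([eot_ge], which rests on the Gibbs variational
      inequality [gibbs_le_KL]) is applied to the approximate dual potentials
      [f + eps phi] and [f + eps psi] ([eot_lower]).
    - From above, [k (1 + phi + psi)] is corrected by a term of second order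
      into the density of an exact coupling ([eot_le], [eot_upper]).
    Both sides use the same value of [\int k (phi + psi)^2 d(nu1 (x) nu2)]
    ([quadratic_value]).  The remainders are integrals of products of [A_i],
    [phi], [psi] and sections of [k] against [nu_i - mu].  They are
    small because [A_i], [phi] and [psi] are of order [N] together with their
    derivatives up to order [s]: each of them is obtained by applying to
    [k(x,.)] a functional of dual norm [O(N)], so that derivatives in [x] fall
    on the smooth kernel ([bnd_functional_sec], [potentials_smooth]).  This is
    where the smoothness of the cost matters.

    The function [u] and the pair [phi, psi] come from contractions: since [k]
    is bounded below, [K] shrinks the oscillation of a function by a fixed
    factor ([kop_osc]), and [f |-> - ln \int e^(-c/eps) e^f dmu] shrinks it too
    ([sinkhorn_contraction]).

    Finally, the quadratic form is Lipschitz on bounded sets for the norm of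
    [l^infty(B^s)].  A supremum of lower bounds, in the manner of McShane,
    extends it to the closure of the tangent cone ([quad_ext]); continuity,
    homogeneity and the passage to the limit all follow from the one estimate
    [quad_ext_close].

    Functions on the ball are turned into functions on the whole space by
    composition with a Borel retraction onto the ball; all measures involved
    are carried by the ball. *)

Set Implicit Arguments.
Unset Strict Implicit.
Unset Printing Implicit Defensive.

(** * Bounded measurable functions and their expectations *)

Section bounded_measurable.
Context {R : realType}.

(** Such functions are integrable for every probability measure, so that the
    rules for expectations carry no integrability condition. *)
Definition bmeas d (T : measurableType d) (f : T -> R) : Prop :=
  measurable_fun setT f /\ exists M : R, forall x, `|f x| <= M.

Definition Ex d (T : measurableType d) (P : probability T R) (f : T -> R) : R :=
  \int[P]_x f x.

Context d (T : measurableType d).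
Implicit Types (f g : T -> R) (P : probability T R).

Lemma bmeas_measurable f : bmeas f -> measurable_fun setT f.
Proof. by case. Qed.

Lemma bmeas_bound f : bmeas f -> exists2 M : R, 0 <= M & forall x, `|f x| <= M.
Proof.
move=> [_ [M hM]]; exists (Num.max M 0); first by rewrite le_max lexx orbT.
by move=> x; rewrite le_max hM.
Qed.

Lemma bmeas_le f M : measurable_fun setT f -> (forall x, `|f x| <= M) -> bmeas f.
Proof. by move=> mf fM; split=> //; exists M. Qed.

Lemma bmeas_cst (k : R) : bmeas (fun _ : T => k).
Proof. by apply: (@bmeas_le _ `|k|) => //; exact: measurable_cst. Qed.

Lemma bmeasD f g : bmeas f -> bmeas g -> bmeas (fun x => f x + g x).
Proof.
move=> [mf [M fM]] [mg [N gN]]; apply: (@bmeas_le _ (M + N)).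
  exact: measurable_funD.
by move=> x; apply: le_trans (ler_normD _ _) _; rewrite lerD.
Qed.

Lemma bmeasM f g : bmeas f -> bmeas g -> bmeas (fun x => f x * g x).
Proof.
move=> [mf [M fM]] [mg [N gN]]; apply: (@bmeas_le _ (M * N)).
  exact: measurable_funM.
by move=> x; rewrite normrM ler_pM.
Qed.

Lemma bmeasZ (k : R) f : bmeas f -> bmeas (fun x => k * f x).
Proof. by move=> bf; apply: bmeasM => //; exact: bmeas_cst. Qed.

Lemma bmeasN f : bmeas f -> bmeas (fun x => - f x).
Proof.
move=> bf; rewrite (_ : (fun x => _) = (fun x => -1 * f x)); first exact: bmeasZ.
by apply/funext => x; rewrite mulN1r.
Qed.

Lemma bmeasB f g : bmeas f -> bmeas g -> bmeas (fun x => f x - g x).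
Proof. by move=> bf bg; apply: bmeasD => //; exact: bmeasN. Qed.

Lemma bmeasX f n : bmeas f -> bmeas (fun x => f x ^+ n).
Proof.
move=> bf; elim: n => [|n IH].
  by rewrite (_ : (fun x => _) = fun=> 1); [exact: bmeas_cst|apply/funext => x; rewrite expr0].
rewrite (_ : (fun x => _) = (fun x => f x * f x ^+ n)); first exact: bmeasM.
by apply/funext => x; rewrite exprS.
Qed.

Lemma bmeas_expR f : bmeas f -> bmeas (fun x => expR (f x)).
Proof.
move=> [mf [M fM]]; apply: (@bmeas_le _ (expR M)).
  by apply: measurableT_comp mf; exact: measurable_expR.
move=> x; rewrite gtr0_norm ?expR_gt0// ler_expR.
by apply: le_trans (fM x); exact: ler_norm.
Qed.

Lemma bmeas_ln f m : 0 < m -> (forall x, m <= f x) -> bmeas f ->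
  bmeas (fun x => ln (f x)).
Proof.
move=> m0 mf [meas [M fM]]; apply: (@bmeas_le _ (`|ln m| + `|ln M|)).
  by apply: measurableT_comp meas; exact: measurable_ln.
move=> x; have fx : 0 < f x by exact: lt_le_trans (mf x).
have h1 : ln m <= ln (f x) by rewrite ler_ln ?posrE.
have fxM : f x <= M by apply: le_trans (fM x); exact: ler_norm.
have h2 : ln (f x) <= ln M by rewrite ler_ln ?posrE// (lt_le_trans fx).
have h3 := ler_norm (ln M); have h4 := ler_norm (- ln m).
have h5 := normr_ge0 (ln M); have h6 := normr_ge0 (ln m).
move: h4; rewrite normrN => h4.
by rewrite ler_norml; apply/andP; split; lra.
Qed.

Lemma bmeas_comp d' (T' : measurableType d') (h : T' -> T) f :
  measurable_fun setT h -> bmeas f -> bmeas (fun x => f (h x)).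
Proof.
by move=> mh [mf [M fM]]; split; [exact: (measurableT_comp mf)|exists M].
Qed.

Lemma bmeas_integrable P f : bmeas f -> P.-integrable setT (EFin \o f).
Proof.
move=> [mf [M fM]]; apply: measurable_bounded_integrable => //=.
  by rewrite (le_lt_trans (probability_le1 _ _)) ?ltry.
exists M; split; first exact: num_real.
by move=> z Mz x _; exact: le_trans (fM x) (ltW Mz).
Qed.

Lemma ExD P f g : bmeas f -> bmeas g ->
  Ex P (fun x => f x + g x) = Ex P f + Ex P g.
Proof. by move=> bf bg; rewrite /Ex RintegralD//; exact: bmeas_integrable. Qed.

Lemma ExB P f g : bmeas f -> bmeas g ->
  Ex P (fun x => f x - g x) = Ex P f - Ex P g.
Proof. by move=> bf bg; rewrite /Ex RintegralB//; exact: bmeas_integrable. Qed.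

Lemma ExZ P k f : bmeas f -> Ex P (fun x => k * f x) = k * Ex P f.
Proof. by move=> bf; rewrite /Ex RintegralZl//; exact: bmeas_integrable. Qed.

Lemma ExN P f : bmeas f -> Ex P (fun x => - f x) = - Ex P f.
Proof.
move=> bf; rewrite -mulN1r -ExZ//; congr Ex.
by apply/funext => x; rewrite mulN1r.
Qed.

Lemma Ex_cst P k : Ex P (fun=> k) = k.
Proof.
have -> : Ex P (fun=> k) = k * fine (P setT) by exact: Rintegral_cst.
by rewrite (probability_setT P) mulr1.
Qed.

Lemma Ex_le P f g : bmeas f -> bmeas g -> (forall x, f x <= g x) ->
  Ex P f <= Ex P g.
Proof.
move=> bf bg fg; apply: le_Rintegral => //; exact: bmeas_integrable.
Qed.

Lemma Ex_le_cst P f k : bmeas f -> (forall x, f x <= k) -> Ex P f <= k.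
Proof.
move=> bf fk; rewrite -[leRHS](Ex_cst P); apply: Ex_le => //; exact: bmeas_cst.
Qed.

Lemma Ex_ge_cst P f k : bmeas f -> (forall x, k <= f x) -> k <= Ex P f.
Proof.
move=> bf fk; rewrite -[leLHS](Ex_cst P); apply: Ex_le => //; exact: bmeas_cst.
Qed.

Lemma Ex_norm_le P f k : bmeas f -> (forall x, `|f x| <= k) -> `|Ex P f| <= k.
Proof.
move=> bf fk; rewrite ler_norml Ex_ge_cst ?Ex_le_cst// => x.
  by have := fk x; rewrite ler_norml => /andP[].
by have := fk x; rewrite ler_norml => /andP[].
Qed.

Lemma EFin_Ex P f : bmeas f -> (Ex P f)%:E = (\int[P]_x (f x)%:E)%E.
Proof.
move=> bf; rewrite /Ex /Rintegral fineK//.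
exact: integrable_fin_num (bmeas_integrable P bf).
Qed.

End bounded_measurable.

Section bounded_measurable_product.
Context {R : realType} d1 d2 (T1 : measurableType d1) (T2 : measurableType d2).
Implicit Types (k : T1 * T2 -> R) (P : probability T1 R) (Q : probability T2 R).

Lemma bmeas_fst (f : T1 -> R) : bmeas f -> bmeas (fun z : T1 * T2 => f z.1).
Proof. by apply: bmeas_comp. Qed.

Lemma bmeas_snd (f : T2 -> R) : bmeas f -> bmeas (fun z : T1 * T2 => f z.2).
Proof. by apply: bmeas_comp. Qed.

Lemma bmeas_sec1 k x : bmeas k -> bmeas (fun y => k (x, y)).
Proof. by apply: bmeas_comp. Qed.

Lemma bmeas_sec2 k y : bmeas k -> bmeas (fun x => k (x, y)).
Proof. by apply: bmeas_comp. Qed.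

Lemma bmeas_Ex1 Q k : bmeas k -> bmeas (fun x => Ex Q (fun y => k (x, y))).
Proof.
move=> bk; have [M M0 kM] := bmeas_bound bk.
apply: (@bmeas_le _ _ _ _ M); last first.
  by move=> x; apply: Ex_norm_le => //; exact: bmeas_sec1.
have mk : measurable_fun setT (EFin \o (fun z => k z + M)).
  by apply/measurable_EFinP; apply: measurable_funD => //; exact: bmeas_measurable.
have k0 z : (0 <= (EFin \o (fun z => k z + M)%R) z)%E.
  by rewrite /= lee_fin; have := kM z; rewrite ler_norml => /andP[]; lra.
have := measurable_fun_fubini_tonelli_F (m2 := Q) _ mk k0.
rewrite (_ : fubini_F _ _ = EFin \o (fun x => Ex Q (fun y => k (x, y)) + M)).
  move=> /measurable_EFinP mF.
  rewrite (_ : (fun x => _) = (fun x => Ex Q (fun y => k (x, y)) + M - M)).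
    exact: measurable_funB.
  by apply/funext => x; rewrite addrK.
apply/funext => x; rewrite /fubini_F /= -{2}(Ex_cst Q M) -ExD; first last.
- exact: bmeas_cst.
- exact: bmeas_sec1.
rewrite EFin_Ex//; apply: bmeasD; [exact: bmeas_sec1|exact: bmeas_cst].
Qed.

Lemma bmeas_Ex2 P k : bmeas k -> bmeas (fun y => Ex P (fun x => k (x, y))).
Proof.
move=> bk; have [M M0 kM] := bmeas_bound bk.
apply: (@bmeas_le _ _ _ _ M); last first.
  by move=> x; apply: Ex_norm_le => //; exact: bmeas_sec2.
have mk : measurable_fun setT (EFin \o (fun z => k z + M)).
  by apply/measurable_EFinP; apply: measurable_funD => //; exact: bmeas_measurable.
have k0 z : (0 <= (EFin \o (fun z => k z + M)%R) z)%E.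
  by rewrite /= lee_fin; have := kM z; rewrite ler_norml => /andP[]; lra.
have := measurable_fun_fubini_tonelli_G (m1 := P) _ mk k0.
rewrite (_ : fubini_G _ _ = EFin \o (fun y => Ex P (fun x => k (x, y)) + M)).
  move=> /measurable_EFinP mF.
  rewrite (_ : (fun y => _) = (fun y => Ex P (fun x => k (x, y)) + M - M)).
    exact: measurable_funB.
  by apply/funext => x; rewrite addrK.
apply/funext => x; rewrite /fubini_G /= -{2}(Ex_cst P M) -ExD; first last.
- exact: bmeas_cst.
- exact: bmeas_sec2.
rewrite EFin_Ex//; apply: bmeasD; [exact: bmeas_sec2|exact: bmeas_cst].
Qed.

Lemma Ex_prod1 P Q k : bmeas k ->
  Ex (P \x Q)%E k = Ex P (fun x => Ex Q (fun y => k (x, y))).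
Proof.
move=> bk; apply: EFin_inj; rewrite !EFin_Ex//; last exact: bmeas_Ex1.
rewrite -integral12_prod_meas1; last exact: bmeas_integrable.
by apply: eq_integral => x _; rewrite EFin_Ex//; exact: bmeas_sec1.
Qed.

Lemma Ex_prod2 P Q k : bmeas k ->
  Ex (P \x Q)%E k = Ex Q (fun y => Ex P (fun x => k (x, y))).
Proof.
move=> bk; apply: EFin_inj; rewrite !EFin_Ex//; last exact: bmeas_Ex2.
rewrite -integral21_prod_meas1; last exact: bmeas_integrable.
by apply: eq_integral => x _; rewrite EFin_Ex//; exact: bmeas_sec2.
Qed.

Lemma Ex_swap P Q k : bmeas k ->
  Ex P (fun x => Ex Q (fun y => k (x, y))) =
  Ex Q (fun y => Ex P (fun x => k (x, y))).
Proof. by move=> bk; rewrite -Ex_prod1// Ex_prod2. Qed.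

End bounded_measurable_product.

Section kernel_operator.
Context {R : realType} d (T : measurableType d).
Implicit Types (P : probability T R) (k : T * T -> R) (f : T -> R).

Definition kop P k f x := Ex P (fun y => k (x, y) * f y).

Lemma kopE P k f x : kop P k f x = Ex P (fun y => k (x, y) * f y).
Proof. by []. Qed.

Lemma bmeas_sec_mul k f x : bmeas k -> bmeas f -> bmeas (fun y => k (x, y) * f y).
Proof. by move=> bk bf; apply: bmeasM => //; exact: bmeas_sec1. Qed.

Lemma bmeas_kop P k f : bmeas k -> bmeas f -> bmeas (kop P k f).
Proof.
move=> bk bf; apply: (bmeas_Ex1 P (k := fun z => k z * f z.2)).
by apply: bmeasM => //; exact: (bmeas_snd T bf).
Qed.

End kernel_operator.

(* Keeps unification from unfolding integrals when real expressions that contain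
   them are compared. *)
Global Opaque Ex kop.

(** * Contractions of the oscillation *)

Section oscillation.
Context {R : realType} {T : Type}.
Implicit Types (f g : T -> R).

Definition osc_le f (w : R) : Prop := forall x y, f x - f y <= w.

Lemma osc_le_uniform f (e : R) : (forall x, `|f x| <= e) -> osc_le f (2 * e).
Proof.
move=> fe x y; have := fe x; have := fe y; rewrite !ler_norml.
by move=> /andP[? ?] /andP[? ?]; lra.
Qed.

(** The oscillation of a bounded function is finite, so the hypothesis may be
    applied to it; it then lies below the fixed point of [w |-> q * w + b]. *)
Lemma osc_le_selfbound f (q b M : R) : q < 1 -> (forall x, `|f x| <= M) ->
  (forall w, osc_le f w -> osc_le f (q * w + b)) -> osc_le f (b / (1 - q)).
Proof.
move=> q1 fM fw x0 y0.
pose D := [set f z.1 - f z.2 | z in [set: T * T]].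
have hD : has_ubound D.
  by exists (2 * M) => _ [[x y] _ <-]; exact: osc_le_uniform fM x y.
have oscD : osc_le f (sup D).
  by move=> x y; apply: ub_le_sup => //; exists (x, y).
have : sup D <= q * sup D + b.
  apply: ge_sup; first by exists (f x0 - f y0), (x0, y0).
  by move=> _ [[x y] _ <-]; exact: fw.
move=> h; apply: le_trans (oscD x0 y0) _.
by rewrite ler_pdivlMr ?subr_gt0//; lra.
Qed.

(** The iterates of [G] form a Cauchy sequence for the oscillation, hence
    for uniform convergence: functions in [S] are normalized so that the
    oscillation of a difference dominates it.  Stating the closedness of [S]
    under uniform limits as a hypothesis spares the construction of a complete
    space of functions. *)
Lemma osc_contraction_fixpoint (S : set (T -> R)) (G : (T -> R) -> T -> R)
    (q w0 : R) (f0 : T -> R) :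
  0 <= q -> q < 1 -> S f0 -> osc_le (fun x => G f0 x - f0 x) w0 ->
  (forall f, S f -> S (G f)) ->
  (forall f g w, S f -> S g -> osc_le (fun x => f x - g x) w ->
     osc_le (fun x => G f x - G g x) (q * w)) ->
  (forall f g w, S f -> S g -> osc_le (fun x => f x - g x) w ->
     forall x, `|f x - g x| <= w) ->
  (forall (F : nat -> T -> R) f, (forall n, S (F n)) ->
     (forall e, 0 < e -> exists N, forall n, (N <= n)%N ->
        forall x, `|F n x - f x| <= e) -> S f) ->
  exists2 f, S f & forall x, G f x = f x.
Proof.
move=> q0 q1 Sf0 w0P GS Gq Snorm Slim.
pose F n := iter n G f0.
have SF n : S (F n) by elim: n => //= n; exact: GS.
have oscF n : osc_le (fun x => F n.+1 x - F n x) (q ^+ n * w0).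
  elim: n => [|n IH]; first by rewrite expr0 mul1r.
  by rewrite exprS -mulrA; exact: (Gq _ _ _ (SF n.+1) (SF n) IH).
have [w00|w00] := ltP w0 0.
  (* a negative oscillation bound forces the domain to be empty *)
  exists f0 => // x; have := w0P x x; rewrite subrr => h.
  by have := le_lt_trans h w00; rewrite ltxx.
have q1' : 0 < 1 - q by rewrite subr_gt0.
pose b n := q ^+ n * w0 / (1 - q).
have b0 n : 0 <= b n by rewrite /b !mulr_ge0// ?exprn_ge0// invr_ge0 ltW.
have bS n : q ^+ n * w0 + b n.+1 = b n.
  by rewrite /b exprS; field; rewrite gt_eqF.
have dF n m x : `|F (n + m)%N x - F n x| <= b n.
  elim: m n => [|m IH] n; first by rewrite addn0 subrr normr0.
  rewrite -(bS n) addnS -addSn.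
  have := IH n.+1; have := Snorm _ _ _ (SF n.+1) (SF n) (oscF n) x.
  have := ler_normD (F (n.+1 + m)%N x - F n.+1 x) (F n.+1 x - F n x).
  rewrite subrKA => h1 h2 h3.
  by apply: le_trans h1 _; rewrite addrC lerD.
have bsmall e : 0 < e -> exists N, forall n, (N <= n)%N -> b n <= e.
  move=> e0.
  have : geometric (w0 / (1 - q)) q n @[n --> \oo] --> (0 : R).
    by apply: cvg_geometric; rewrite ger0_norm.
  move=> /cvgrPdist_le /(_ e e0)[N _ hN].
  exists N => n Nn; have := hN n Nn.
  have -> : geometric (w0 / (1 - q)) q n = b n by rewrite /geometric/= /b; ring.
  by rewrite sub0r normrN ger0_norm.
(* the distance from F n to the limit is at most b n, so that the limit is the
   supremum of these lower bounds *)
pose f x := sup [set F n x - b n | n in [set: nat]].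
have fF n x : `|F n x - f x| <= b n.
  have ub m : F m x - b m <= F n x + b n.
    have [nm|/ltnW mn] := leqP n m.
      have := dF n (m - n)%N x; rewrite subnKC// ler_norml => /andP[_].
      by have := b0 m; lra.
    have := dF m (n - m)%N x; rewrite subnKC// ler_norml => /andP[+ _].
    by have := b0 n; lra.
  have h1 : f x <= F n x + b n.
    by apply: ge_sup; [exists (F 0%N x - b 0%N), 0%N|move=> _ [m _ <-]].
  have h2 : F n x - b n <= f x.
    by apply: ub_le_sup; [exists (F n x + b n) => _ [m _ <-]|exists n].
  by rewrite ler_norml; apply/andP; split; lra.
have Sf : S f.
  apply: (Slim F) => // e e0; have [N hN] := bsmall e e0.
  by exists N => n Nn x; exact: le_trans (fF n x) (hN n Nn).
exists f => // x; apply/eqP; rewrite -subr_eq0 -normr_le0.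
apply/ler_addgt0Pr => e e0; rewrite add0r.
have [N hN] := bsmall (e / 3) (divr_gt0 e0 (ltr0n _ 3)).
have h1 := Snorm _ _ _ (SF N.+1) (GS _ Sf)
  (Gq _ _ _ (SF N) Sf (osc_le_uniform (fF N))) x.
have h2 := fF N.+1 x.
have h3 := hN N (leqnn _); have h4 := hN N.+1 (leqnSn _).
have h5 : q * (2 * b N) <= 2 * b N.
  by apply: ler_piMl; [exact: mulr_ge0|exact: ltW].
have -> : G f x - f x = - (F N.+1 x - G f x) + (F N.+1 x - f x) by ring.
apply: le_trans (ler_normD _ _) _; rewrite normrN.
by move: h1; rewrite /F /= -/(F N) => h1; lra.
Qed.

End oscillation.

(** * The Schroedinger equation *)

Lemma bmeas_ulim (R : realType) d (T : measurableType d) (F : nat -> T -> R)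
    (f : T -> R) :
  (forall n, bmeas (F n)) ->
  (forall e, 0 < e -> exists N, forall n, (N <= n)%N ->
     forall x, `|F n x - f x| <= e) -> bmeas f.
Proof.
move=> bF Ff; have [N hN] := Ff 1 ltr01.
have [M M0 FM] := bmeas_bound (bF N).
apply: (@bmeas_le _ _ _ _ (M + 1)); last first.
  move=> x; have h1 := FM x; have h2 := hN N (leqnn _) x.
  rewrite (_ : f x = F N x - (F N x - f x)); last by ring.
  by apply: le_trans (ler_normB _ _) _; exact: lerD.
apply: (measurable_fun_cvg (h := F)) => [n|x _]; first exact: bmeas_measurable.
apply/cvgrPdist_le => e e0; have [n hn] := Ff e e0.
by exists n => // m /= nm; rewrite distrC; exact: hn.
Qed.

(** Convexity of the exponential between [- w] and [0], from its tangent at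
    the intermediate point. *)
Lemma expR_interp (R : realType) (th w : R) : 0 <= th -> th <= 1 ->
  expR (- ((1 - th) * w)) <= th + (1 - th) * expR (- w).
Proof.
move=> th0 th1; set E := expR (- ((1 - th) * w)).
have E0 : 0 < E by exact: expR_gt0.
have h1 : E * (1 + (1 - th) * w) <= 1.
  have := expR_ge1Dx ((1 - th) * w); rewrite -(ler_pM2l E0).
  by rewrite /E -expRD addNr expR0.
have h2 : E * (1 - th * w) <= expR (- w).
  have := expR_ge1Dx (- (th * w)); rewrite -(ler_pM2l E0).
  have -> : E * expR (- (th * w)) = expR (- w).
    by rewrite /E -expRD; congr expR; ring.
  by [].
have : th * (E * (1 + (1 - th) * w)) <= th by rewrite ler_piMr.
have : (1 - th) * (E * (1 - th * w)) <= (1 - th) * expR (- w).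
  by rewrite ler_wpM2l// subr_ge0.
move=> h3 h4; apply: le_trans (lerD h4 h3).
by rewrite le_eqVlt; apply/orP; left; apply/eqP; ring.
Qed.

Section schroedinger.
Context {R : realType} d (T : measurableType d) (P : probability T R).
Context (kap : T * T -> R) (del : R).
Hypotheses (bkap : bmeas kap) (del0 : 0 < del).
Hypothesis (kap_ge : forall z, del <= kap z).
Hypothesis (kap_le1 : forall z, kap z <= 1).
Implicit Types (f g : T -> R).

Let I f := kop P kap (fun y => expR (f y)).

Let IE f x : I f x = Ex P (fun y => kap (x, y) * expR (f y)).
Proof. exact: kopE. Qed.

Let bI f x : bmeas f -> bmeas (fun y => kap (x, y) * expR (f y)).
Proof. by move=> bf; apply: bmeas_sec_mul => //; exact: bmeas_expR. Qed.

Let bIf f : bmeas f -> bmeas (I f).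
Proof. by move=> bf; apply: bmeas_kop => //; exact: bmeas_expR. Qed.

Let I_lb f : bmeas f -> exists2 m, 0 < m & forall x, m <= I f x.
Proof.
move=> bf; have [M M0 fM] := bmeas_bound bf.
exists (del * expR (- M)); first by rewrite mulr_gt0// expR_gt0.
move=> x; rewrite IE; apply: Ex_ge_cst; first exact: bI.
move=> y; apply: (ler_pM (ltW del0) (expR_ge0 _) (kap_ge _)); rewrite ler_expR.
by have := fM y; rewrite ler_norml => /andP[].
Qed.

Let I_gt0 f x : bmeas f -> 0 < I f x.
Proof. by move=> bf; have [m m0 mI] := I_lb bf; exact: lt_le_trans (mI x). Qed.

(** Since [del <= kap <= 1], the kernel at [x'] is at least a multiple [th']
    of the kernel at [x].  With [J = I g x / I f x], the bound on [g - f] gives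
    [e^g >= e^(-w) J e^f] pointwise; on the part [th' kap(x,.)] of the kernel
    the factor [e^(-w)] is not lost, because there the ratio of the integrals is
    exactly [J].  Hence [I g x' / I f x' >= J (th + (1 - th) e^(-w))] with
    [th = del^2], and the right-hand side is at least [J e^(-(1 - th) w)] by
    convexity. *)
Lemma sinkhorn_contraction f g w x x' : bmeas f -> bmeas g ->
  osc_le (fun y => g y - f y) w ->
  I g x * I f x' <= expR ((1 - del ^+ 2) * w) * (I g x' * I f x).
Proof.
clearbody I; move=> bf bg gfw; set th := del ^+ 2.
have del1 : del <= 1 by apply: le_trans (kap_ge (x, x')) _.
have th0 : 0 <= th by rewrite exprn_ge0// ltW.
have th1 : th <= 1 by rewrite expr_le1// ltW.
have If0 := I_gt0 x bf; have If0' := I_gt0 x' bf; have Ig0 := I_gt0 x bg.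
set J := I g x / I f x; have J0 : 0 < J by rewrite divr_gt0.
have JE : J * I f x = I g x by rewrite /J divfK// gt_eqF.
have gJ y : expR (- w) * J * expR (f y) <= expR (g y).
  have : I g x <= expR (w + (g y - f y)) * I f x.
    rewrite !IE -ExZ; last exact: bI.
    apply: Ex_le; [exact: bI|by apply: bmeasZ; exact: bI|move=> z].
    rewrite mulrCA ler_wpM2l//; first by rewrite (le_trans (ltW del0)).
    rewrite -expRD ler_expR -[leLHS](subrK (f z)) lerD2r -lerBlDr.
    exact: gfw z y.
  rewrite -ler_pdivrMr// -/J => hJ.
  rewrite mulrAC -expRD.
  apply: le_trans (ler_wpM2l (expR_ge0 _) hJ) _.
  by rewrite -expRD (_ : _ + _ = g y)//; ring.
set th' := th * I f x' / I f x.
have th'0 : 0 <= th' by rewrite /th' !mulr_ge0 ?invr_ge0 ?ltW.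
have th'E : th' * I f x = th * I f x' by rewrite /th' divfK// gt_eqF.
have th'del : th' <= del.
  rewrite /th' ler_pdivrMr// /th expr2 -mulrA ler_pM2l//.
  rewrite !IE -ExZ; last exact: bI.
  apply: Ex_le; [by apply: bmeasZ; exact: bI|exact: bI|move=> y].
  rewrite mulrA ler_wpM2r ?expR_ge0//.
  by apply: le_trans (kap_ge _); rewrite ler_piMr// ltW.
have h1 : expR (- w) * J * (I f x' - th' * I f x) <= I g x' - th' * I g x.
  have bIf' := bI x' bf; have bIg' := bI x' bg.
  have bIZ := bmeasZ th' (bI x bf); have bIgZ := bmeasZ th' (bI x bg).
  have [bDf bDg] := (bmeasB bIf' bIZ, bmeasB bIg' bIgZ).
  rewrite !IE -(ExZ P th' (bI x bf)) -(ExZ P th' (bI x bg)) -!ExB//.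
  rewrite -(ExZ P _ bDf); apply: Ex_le => //; first exact: bmeasZ.
  move=> y; set E := expR (- w); have kk : 0 <= kap (x', y) - th' * kap (x, y).
    rewrite subr_ge0; apply: le_trans (kap_ge _); apply: le_trans th'del.
    by rewrite ler_piMr.
  have := ler_wpM2l kk (gJ y); rewrite -/E => hk.
  have -> : E * J * (kap (x', y) * expR (f y) - th' * (kap (x, y) * expR (f y)))
    = (kap (x', y) - th' * kap (x, y)) * (E * J * expR (f y)) by ring.
  have -> : kap (x', y) * expR (g y) - th' * (kap (x, y) * expR (g y))
    = (kap (x', y) - th' * kap (x, y)) * expR (g y) by ring.
  exact: hk.
have h2 := expR_interp w th0 th1.
have h3 : J * I f x' * expR (- ((1 - th) * w)) <= I g x'.
  have : J * I f x' * expR (- ((1 - th) * w)) <=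
         J * I f x' * (th + (1 - th) * expR (- w)).
    by rewrite ler_wpM2l// mulr_ge0// ltW.
  move=> /le_trans; apply; move: h1; rewrite th'E.
  have h4 : th' * I g x = J * I f x' * th by rewrite -JE mulrCA th'E; ring.
  rewrite h4 lerBrDr => h5; apply: le_trans h5.
  by rewrite [leLHS](_ : _ = expR (- w) * J * (I f x' - th * I f x') +
    J * I f x' * th)//; ring.
have := ler_wpM2l (expR_ge0 ((1 - th) * w)) h3.
rewrite mulrCA -expRD subrr expR0 mulr1 => h4.
have := ler_wpM2r (ltW If0) h4.
have -> : I g x * I f x' = J * I f x' * I f x by rewrite mulrAC JE.
by rewrite mulrA.
Qed.

(** The map [f |-> - ln (I f)] contracts the oscillation by the factor
    [1 - del^2].  Subtracting the value at [x0] keeps the contraction and makes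
    the oscillation dominate the values, so that there is a fixed point. *)
Lemma exists_schroedinger_potential (x0 : T) : exists2 u, bmeas u &
  (exists2 m, 0 < m & forall x, m <= u x) /\
  forall x, u x * Ex P (fun y => kap (x, y) * u y) = 1.
Proof.
clearbody I.
pose S : set (T -> R) := [set f | bmeas f /\ f x0 = 0].
pose G f x := ln (I f x0) - ln (I f x).
have bG f : bmeas f -> bmeas (G f).
  move=> bf; apply: bmeasB; first exact: bmeas_cst.
  by have [m m0 mI] := I_lb bf; apply: bmeas_ln m0 mI _; exact: bIf.
have del1 : del <= 1 by apply: le_trans (kap_ge (x0, x0)) _.
pose q := 1 - del ^+ 2.
have q1 : q < 1 by rewrite /q ltrBlDr ltrDl exprn_gt0.
have q0 : 0 <= q by rewrite subr_ge0 expr_le1// ltW.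
have [M M0 GM] := bmeas_bound (bG _ (bmeas_cst T (0 : R))).
have := @osc_contraction_fixpoint R T S G q (2 * M) (fun=> 0) q0 q1.
case.
- by split => //; exact: bmeas_cst.
- by apply: osc_le_uniform => x; rewrite subr0; exact: GM.
- by move=> f [bf _]; split; [exact: bG|rewrite /G subrr].
- move=> f g w [bf _] [bg _] fgw x x'; rewrite /G.
  have := sinkhorn_contraction x' x bg bf fgw.
  have := I_gt0 x bf; have := I_gt0 x' bf.
  have := I_gt0 x bg; have := I_gt0 x' bg.
  move=> g' g0 f' f00 h.
  have : ln (I f x' * I g x) <= ln (expR (q * w) * (I f x * I g x')).
    by rewrite ler_ln ?posrE ?mulr_gt0 ?expR_gt0.
  rewrite !lnM ?posrE ?mulr_gt0 ?expR_gt0// expRK.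
  move: (ln (I f x)) (ln (I f x')) (ln (I g x)) (ln (I g x')) => p p' r r'.
  by move: (ln (I f x0)) (ln (I g x0)) => {h g' g0 f' f00 GM} *; lra.
- move=> f g w [bf f0] [bg g0] fgw x; rewrite ler_norml.
  have := fgw x x0; have := fgw x0 x; rewrite f0 g0 => h1 h2.
  by apply/andP; split; lra.
- move=> F f SF Ff; split; first by apply: (bmeas_ulim (F := F)) => // n; case: (SF n).
  apply/eqP; rewrite -normr_le0; apply/ler_addgt0Pr => e e0; rewrite add0r.
  have [N hN] := Ff e e0; have := hN N (leqnn _) x0.
  by case: (SF N) => _ ->; rewrite sub0r normrN.
move=> f [bf _] fG.
(* the fixed point solves the equation up to a constant, which is split evenly *)
pose b := ln (I f x0); exists (fun x => expR (f x - b / 2)).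
  by apply: bmeas_expR; apply: bmeasB => //; exact: bmeas_cst.
split.
  have [N N0 fN] := bmeas_bound bf.
  exists (expR (- N - b / 2)); first exact: expR_gt0.
  by move=> x; rewrite ler_expR lerD2r; have := fN x; rewrite ler_norml => /andP[].
move=> x; have -> : Ex P (fun y => kap (x, y) * expR (f y - b / 2)) =
    expR (- (b / 2)) * I f x.
  rewrite IE -ExZ; last exact: bI.
  by congr Ex; apply/funext => y; rewrite expRD; ring.
rewrite -{1}(lnK (x := I f x)) ?posrE ?I_gt0// -!expRD -fG /G -/b -[RHS]expR0.
by congr expR; field.
Qed.

End schroedinger.

(** * The linearized Schroedinger system *)

Section linear_system.
Context {R : realType} d (T : measurableType d) (P : probability T R).
Context (k : T * T -> R) (del : R).
Hypotheses (bk : bmeas k) (del0 : 0 < del) (del1 : del < 1).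
Hypothesis (k_ge : forall z, del <= k z).
Hypothesis (k_sym : forall x y, k (x, y) = k (y, x)).
Hypothesis (k_mass : forall x, Ex P (fun y => k (x, y)) = 1).
Implicit Types (f g h A phi psi : T -> R).

Local Notation K := (kop P k).

Let bks f x : bmeas f -> bmeas (fun y => k (x, y) * f y).
Proof. exact: bmeas_sec_mul. Qed.

Let bK f : bmeas f -> bmeas (K f).
Proof. exact: bmeas_kop. Qed.

Lemma kop_lin (s : R) f g x : bmeas f -> bmeas g ->
  K (fun y => f y - s * g y) x = K f x - s * K g x.
Proof.
move=> bf bg; have [bkf bkg] := (bks x bf, bks x bg).
rewrite !kopE -ExZ// -ExB//; last exact: bmeasZ.
by congr Ex; apply/funext => y; ring.
Qed.

Lemma kop_mean f : bmeas f -> Ex P (K f) = Ex P f.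
Proof.
move=> bf; rewrite (_ : K f = fun x => Ex P (fun y => k (x, y) * f y)); last first.
  by apply/funext => x; rewrite kopE.
rewrite (Ex_swap P P (k := fun z => k z * f z.2)); last first.
  by apply: bmeasM => //; exact: (bmeas_snd T bf).
congr Ex; apply/funext => y /=.
under [X in Ex P X]funext do rewrite mulrC k_sym.
by rewrite ExZ ?k_mass ?mulr1//; exact: bmeas_sec1.
Qed.

Lemma kop_norm_le f (b : R) : bmeas f -> (forall x, `|f x| <= b) ->
  forall x, `|K f x| <= b.
Proof.
move=> bf fb x; have k0 z : 0 <= k z by apply: le_trans (k_ge _); exact: ltW.
have bkx : bmeas (fun y => k (x, y)) by exact: bmeas_sec1.
have hb : Ex P (fun y => b * k (x, y)) = b by rewrite ExZ// k_mass mulr1.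
rewrite ler_norml; apply/andP; split.
  rewrite !kopE -{1}hb -ExN; last exact: bmeasZ.
  apply: Ex_le; [by apply: bmeasN; exact: bmeasZ|exact: bks|move=> y].
  have := fb y; rewrite ler_norml => /andP[+ _].
  by move=> /(ler_wpM2l (k0 (x, y))); lra.
rewrite !kopE -hb; apply: Ex_le; [exact: bks|exact: bmeasZ|move=> y].
have := fb y; rewrite ler_norml => /andP[_].
by move=> /(ler_wpM2l (k0 (x, y))); lra.
Qed.

(** A Doeblin argument: [k - del] is a nonnegative kernel of mass [1 - del],
    and the kernel [del] that is left out contributes the same constant to every
    value of [K f]. *)
Lemma kop_osc f w : bmeas f -> osc_le f w -> osc_le (K f) ((1 - del) * w).
Proof.
move=> bf fw x x'; have [bkx bkx'] := (bks x bf, bks x' bf).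
have bx y : bmeas (fun z => k (y, z)) by exact: bmeas_sec1.
pose a y := Ex P (fun z => (k (y, z) - del) * f z).
have bm y : bmeas (fun z => k (y, z) - del).
  by apply: bmeasB => //; exact: bmeas_cst.
have bmf y : bmeas (fun z => (k (y, z) - del) * f z) by exact: bmeasM.
have mass y : Ex P (fun z => k (y, z) - del) = 1 - del.
  by rewrite ExB ?k_mass ?Ex_cst//; exact: bmeas_cst.
have aE y : K f y = a y + del * Ex P f.
  rewrite kopE -ExZ// -ExD//; last exact: bmeasZ.
  by congr Ex; apply/funext => z; ring.
have al z : a x <= (1 - del) * (f z + w).
  rewrite mulrC -(mass x) -ExZ//; apply: Ex_le => // [|y]; first exact: bmeasZ.
  rewrite mulrC ler_wpM2r ?subr_ge0//.
  by have := fw y z; lra.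
have : (1 - del) * (a x / (1 - del) - w) <= a x'.
  have -> : (1 - del) * (a x / (1 - del) - w) =
      Ex P (fun z => (a x / (1 - del) - w) * (k (x', z) - del)).
    by rewrite ExZ// mass mulrC.
  apply: Ex_le => // [|y]; first exact: bmeasZ.
  rewrite mulrC; apply: ler_wpM2l; first by rewrite subr_ge0.
  rewrite lerBlDr ler_pdivrMr; last by rewrite subr_gt0.
  by rewrite mulrC; exact: al.
rewrite mulrBr mulrCA divff ?mulr1; last by rewrite gt_eqF// subr_gt0.
by rewrite !aE; lra.
Qed.

(** The linearization at [k] of the equations for the marginals.  The mean of
    [phi] is prescribed because [(phi + t, psi - t)] solves the same
    equations. *)
Definition linsys A1 A2 phi psi : Prop :=
  [/\ bmeas phi, bmeas psi, Ex P phi = 0,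
      forall x, phi x + K psi x = - A2 x &
      forall x, psi x + K phi x = - A1 x].

Let q := (1 - del) ^+ 2.

Let q0 : 0 <= q. Proof. exact: sqr_ge0. Qed.

Let q1 : q < 1.
Proof. by rewrite /q expr_lt1// ?subr_ge0 ?ltW// ltrBlDr ltrDl. Qed.

Let kop2_osc f w : bmeas f -> osc_le f w -> osc_le (K (K f)) (q * w).
Proof.
move=> bf fw; rewrite /q expr2 -mulrA.
by apply: kop_osc; [exact: bK|exact: kop_osc].
Qed.

Let mean0_osc f w : bmeas f -> Ex P f = 0 -> osc_le f w -> forall x, `|f x| <= w.
Proof.
move=> bf f0 fw x; rewrite ler_norml; apply/andP; split.
  suff : Ex P f <= f x + w by rewrite f0; lra.
  by apply: Ex_le_cst => // y; have := fw y x; lra.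
suff : f x - w <= Ex P f by rewrite f0; lra.
by apply: Ex_ge_cst => // y; have := fw x y; lra.
Qed.

(** Eliminating [psi] leaves [phi = K (K phi) + K A1 - A2], a contraction for
    the oscillation on functions of mean zero, where the oscillation dominates
    the values. *)
Lemma linsys_exists A1 A2 : bmeas A1 -> bmeas A2 -> Ex P A1 = 0 -> Ex P A2 = 0 ->
  exists phi psi, linsys A1 A2 phi psi.
Proof.
move=> b1 b2 m1 m2.
pose h x := K A1 x - A2 x.
have bh : bmeas h by apply: bmeasB => //; exact: bK.
have mh : Ex P h = 0 by rewrite [LHS](ExB P (bK b1) b2) kop_mean// m1 m2 subrr.
pose S : set (T -> R) := [set f | bmeas f /\ Ex P f = 0].
pose G f x := K (K f) x + h x.
have bG f : bmeas f -> bmeas (G f).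
  by move=> bf; apply: bmeasD => //; do 2 apply: bK.
have [M M0 GM] := bmeas_bound (bG _ (bmeas_cst T (0 : R))).
case: (@osc_contraction_fixpoint R T S G q (2 * M) (fun=> 0) q0 q1).
- by split; [exact: bmeas_cst|rewrite Ex_cst].
- by apply: osc_le_uniform => x; rewrite subr0; exact: GM.
- move=> f [bf mf]; split; first exact: bG.
  by rewrite [LHS](ExD P (bK (bK bf)) bh) !kop_mean ?mf ?mh ?addr0//; exact: bK.
- move=> f g w [bf _] [bg _] fgw.
  have := kop2_osc (bmeasB bf bg) fgw; rewrite /osc_le => + x y => /(_ x y).
  have e z : K (fun x => f x - g x) z = K f z - K g z.
    have := kop_lin 1 z bf bg; rewrite mul1r => <-; congr K.
    by apply/funext => t; rewrite mul1r.
  have e2 z : K (K (fun x => f x - g x)) z = K (K f) z - K (K g) z.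
    have := kop_lin 1 z (bK bf) (bK bg); rewrite mul1r => <-.
    by congr K; apply/funext => t; rewrite mul1r e.
  rewrite !e2 /G; move: (h x) (h y) (K (K f) x) (K (K f) y) => ? ? ? ?.
  by move: (K (K g) x) (K (K g) y) => {GM e e2} *; lra.
- move=> f g w [bf mf] [bg mg] fgw; apply: mean0_osc => //; first exact: bmeasB.
  by rewrite ExB// mf mg subrr.
- move=> F f SF Ff; have bf : bmeas f.
    by apply: (bmeas_ulim (F := F)) => // n; case: (SF n).
  split=> //.
  apply/eqP; rewrite -normr_le0; apply/ler_addgt0Pr => e e0; rewrite add0r.
  have [N hN] := Ff e e0; have [bN mN] := SF N.
  have : `|Ex P (fun x => F N x - f x)| <= e.
    by apply: Ex_norm_le; [exact: bmeasB|exact: hN].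
  by rewrite ExB// mN sub0r normrN.
move=> phi [bphi mphi] phiE.
exists phi, (fun x => - A1 x - K phi x); split=> //.
- by apply: bmeasB; [exact: bmeasN|exact: bK].
- move=> x; rewrite -{1}phiE /G /h.
  have -> : K (fun y => - A1 y - K phi y) x = - K A1 x - K (K phi) x.
    have b0 := bmeas_cst T (0 : R).
    have := kop_lin 1 x (bmeasB b0 b1) (bK bphi).
    have := kop_lin 1 x b0 b1; rewrite !mul1r.
    have -> : K (fun=> 0) x = 0.
      rewrite !kopE (_ : (fun y => _) = fun=> 0) ?Ex_cst//.
      by apply/funext => y; rewrite mulr0.
    move=> + h2; rewrite sub0r => h3.
    rewrite -h3 -(_ : K (fun y => 0 - A1 y) x = K (fun y => 0 - 1 * A1 y) x).
      rewrite -h2; congr K; apply/funext => y; by rewrite sub0r mul1r.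
    by congr K; apply/funext => y; rewrite mul1r.
  by ring.
by move=> x; ring.
Qed.

(** The oscillation of [K A1 - A2] is at most [4 b], which gives
    [4 b / (1 - q)] for [phi]; the further [b] is the contribution of [A1] to
    [psi]. *)
Definition linsys_const : R := 4 / (1 - q) + 1.

Lemma linsys_const_ge1 : 1 <= linsys_const.
Proof. by rewrite lerDr divr_ge0// subr_ge0 ltW. Qed.

Lemma linsys_bound A1 A2 phi psi (b : R) : bmeas A1 -> bmeas A2 ->
  linsys A1 A2 phi psi ->
  (forall x, `|A1 x| <= b) -> (forall x, `|A2 x| <= b) ->
  forall x, `|phi x| <= linsys_const * b /\ `|psi x| <= linsys_const * b.
Proof.
move=> b1 b2 [bphi bpsi mphi e1 e2] A1b A2b.
have kA1 : forall x, `|K A1 x| <= b by exact: kop_norm_le.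
have phiE x : phi x = K (K phi) x + (K A1 x - A2 x).
  have -> : K A1 x = - K psi x - K (K phi) x.
    have bkphi := bK bphi.
    have := kop_lin (-1) x bpsi bkphi; rewrite mulN1r opprK => h.
    have : K (fun y => (fun=> 0) y - 1 * (psi y - (-1) * K phi y)) x =
           K A1 x.
      by congr K; apply/funext => y; have := e2 y; lra.
    rewrite kop_lin ?h; last first.
    - by apply: bmeasB => //; exact: bmeasZ.
    - exact: bmeas_cst.
    move=> <-; rewrite (_ : K (fun=> 0) x = 0); first by ring.
    rewrite !kopE (_ : (fun y => _) = fun=> 0) ?Ex_cst//.
    by apply/funext => y; rewrite mulr0.
  by have := e1 x; lra.
have [M M0 phiM] := bmeas_bound bphi.
have oscphi : osc_le phi (4 * b / (1 - q)).
  apply: (osc_le_selfbound q1 phiM) => w phiw x y.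
  have := kop2_osc bphi phiw x y; rewrite [in X in _ -> X]phiE [phi y]phiE.
  have := kA1 x; have := kA1 y; have := A2b x; have := A2b y.
  by rewrite !ler_norml => /andP[? ?] /andP[? ?] /andP[? ?] /andP[? ?]; lra.
have phib : forall x, `|phi x| <= 4 * b / (1 - q) by exact: mean0_osc.
have eC : linsys_const * b = 4 * b / (1 - q) + b.
  by rewrite /linsys_const mulrDl mul1r mulrAC.
move=> x; rewrite eC; split.
  by apply: le_trans (phib x) _; rewrite lerDl (le_trans (normr_ge0 _) (A1b x)).
have -> : psi x = - A1 x - K phi x by have := e2 x; lra.
apply: le_trans (ler_normB _ _) _; rewrite normrN addrC.
by apply: lerD => //; exact: kop_norm_le.
Qed.

Lemma linsys_lin (s : R) A1 A2 phi psi A1' A2' phi' psi' :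
  linsys A1 A2 phi psi -> linsys A1' A2' phi' psi' ->
  linsys (fun x => A1 x - s * A1' x) (fun x => A2 x - s * A2' x)
    (fun x => phi x - s * phi' x) (fun x => psi x - s * psi' x).
Proof.
move=> [bphi bpsi mphi e1 e2] [bphi' bpsi' mphi' e1' e2']; split.
- by apply: bmeasB => //; exact: bmeasZ.
- by apply: bmeasB => //; exact: bmeasZ.
- by rewrite ExB ?ExZ ?mphi ?mphi' ?mulr0 ?subr0//; exact: bmeasZ.
- by move=> x; rewrite kop_lin//; have := e1 x; have := e1' x;
    move=> /(congr1 (fun z => s * z)); lra.
- by move=> x; rewrite kop_lin//; have := e2 x; have := e2' x;
    move=> /(congr1 (fun z => s * z)); lra.
Qed.

End linear_system.

(** * Calculus of smooth functions *)

Section directional_derivative.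
Context {R : realType} {V : normedModType R}.
Implicit Types (f g : V -> R) (x v : V).

(** Reduces directional derivatives to derivatives in one real variable, for
    which the chain rule and the mean value theorem are available. *)
Lemma is_derive_line f x v (t : R) (l : R) :
  is_derive (t *: v + x) v f l <->
  is_derive t 1 (fun h : R => f (h *: v + x)) l.
Proof.
have e : (fun h : R => h^-1 *: ((f \o shift (t *: v + x)) (h *: v) -
    f (t *: v + x))) =
  (fun h : R => h^-1 *: (((fun h : R => f (h *: v + x)) \o shift t) (h *: 1) -
    f (t *: v + x))).
  by apply/funext => h /=; rewrite addrA -scalerDl [_%:A]mulr1.
split=> -[dv <-]; apply: DeriveDef.
- by move: dv; rewrite /derivable e.
- by rewrite /derive e.
- by move: dv; rewrite /derivable e.
- by rewrite /derive e.
Qed.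

Lemma is_derive_line0 f x v (l : R) :
  is_derive x v f l <-> is_derive (0 : R) 1 (fun h : R => f (h *: v + x)) l.
Proof. by rewrite -is_derive_line scale0r add0r. Qed.

Lemma is_derive_expR f x v l : is_derive x v f l ->
  is_derive x v (fun y => expR (f y)) (expR (f x) * l).
Proof.
move=> /is_derive_line0 dl; apply/is_derive_line0.
have := is_derive_expR (f (0 *: v + x)).
move=> /(is_derive1_comp (g := fun h : R => f (h *: v + x))) /(_ dl).
by rewrite {1}scale0r add0r.
Qed.

End directional_derivative.

Section smooth_calculus.
Context {R : realType} {V : normedModType R}.
Implicit Types (f g : V -> R) (x v : V) (n : nat).

Local Notation Cn := (Cn_on [set: V]).

Lemma Cn_continuous n f : Cn n f -> continuous f.
Proof. by case: n => [|n] [cf _] x; exact: cf. Qed.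

Lemma Cn_derivable n f x v : Cn n.+1 f -> derivable f x v.
Proof. by move=> [_ /(_ v)[df _]]; exact: df. Qed.

Lemma Cn_derive n f v : Cn n.+1 f -> Cn n (fun x => 'D_v f x).
Proof. by move=> [_ /(_ v)[_]]. Qed.

Lemma CnS n f : continuous f ->
  (forall v x, derivable f x v) ->
  (forall v, Cn n (fun x => 'D_v f x)) -> Cn n.+1 f.
Proof. by move=> cf df Df; split=> [x _|v]; [exact: cf|split=> [x _|]]. Qed.

Lemma CnW n f : Cn n.+1 f -> Cn n f.
Proof.
elim: n f => [|n IH] f Cf; first by split=> // x _; exact: Cn_continuous Cf x.
apply: CnS => [|v x|v].
- exact: Cn_continuous Cf.
- exact: Cn_derivable Cf.
- by apply: IH; exact: Cn_derive Cf.
Qed.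

Lemma Cn_cst n (k : R) : Cn n (fun=> k).
Proof.
elim: n k => [|n IH] k; first by split=> // x _; exact: cst_continuous.
apply: CnS => [x|v x|v]; first exact: cst_continuous.
  exact: derivable_cst.
rewrite (_ : (fun x => 'D_v (fun=> k) x) = fun=> 0)//.
by apply/funext => x; exact: derive_cst.
Qed.

Lemma CnD n f g : Cn n f -> Cn n g -> Cn n (fun x => f x + g x).
Proof.
elim: n f g => [|n IH] f g Cf Cg.
  split=> // x _; apply: (@continuousD _ _ _ f g); last exact: Cn_continuous Cg x.
  exact: Cn_continuous Cf x.
apply: CnS => [x|v x|v].
- apply: (@continuousD _ _ _ f g); last exact: Cn_continuous Cg x.
  exact: Cn_continuous Cf x.
- by apply: (@derivableD _ _ _ f g); [exact: Cn_derivable Cf|exact: Cn_derivable Cg].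
rewrite (_ : (fun x => 'D_v (fun x => f x + g x) x) =
  (fun x => 'D_v f x + 'D_v g x)).
  by apply: IH; [exact: Cn_derive Cf|exact: Cn_derive Cg].
apply/funext => x; apply: (@deriveD _ _ _ f g).
  exact: Cn_derivable Cf.
exact: Cn_derivable Cg.
Qed.

Lemma CnM n f g : Cn n f -> Cn n g -> Cn n (fun x => f x * g x).
Proof.
elim: n f g => [|n IH] f g Cf Cg.
  split=> // x _; apply: (@continuousM _ _ f g); last exact: Cn_continuous Cg x.
  exact: Cn_continuous Cf x.
apply: CnS => [x|v x|v].
- apply: (@continuousM _ _ f g); last exact: Cn_continuous Cg x.
  exact: Cn_continuous Cf x.
- by apply: (@derivableM _ _ f g); [exact: Cn_derivable Cf|exact: Cn_derivable Cg].
rewrite (_ : (fun x => 'D_v (fun x => f x * g x) x) =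
  (fun x => f x * 'D_v g x + g x * 'D_v f x)).
  apply: CnD; apply: IH.
  - exact: CnW.
  - exact: Cn_derive Cg.
  - exact: CnW.
  - exact: Cn_derive Cf.
apply/funext => x; apply: (@deriveM _ _ f g).
  exact: Cn_derivable Cf.
exact: Cn_derivable Cg.
Qed.

Lemma Cn_expR n f : Cn n f -> Cn n (fun x => expR (f x)).
Proof.
have ce m h x : Cn m h -> {for x, continuous (fun x => expR (h x))}.
  move=> Ch; apply: (@continuous_comp _ _ _ h (@expR R)).
    exact: Cn_continuous Ch x.
  exact: continuous_expR.
elim: n f => [|n IH] f Cf; first by split=> // x _; exact: ce Cf.
have de x v : is_derive x v (fun y => expR (f y)) (expR (f x) * 'D_v f x).
  by apply: is_derive_expR; apply: DeriveDef => //; exact: Cn_derivable Cf.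
apply: CnS => [x|v x|v]; first exact: ce Cf.
  by case: (de x v).
rewrite (_ : (fun x => 'D_v (fun x => expR (f x)) x) =
  (fun x => expR (f x) * 'D_v f x)).
  by apply: CnM; [apply: IH; exact: CnW|exact: Cn_derive Cf].
by apply/funext => x; case: (de x v).
Qed.

Lemma Cn_inv n f : (forall x, f x != 0) -> Cn n f -> Cn n (fun x => (f x)^-1).
Proof.
move=> f0.
elim: n => [|n IH] Cf.
  by split=> // x _; apply: continuousV; [exact: f0|exact: Cn_continuous Cf x].
apply: CnS => [x|v x|v].
- by apply: continuousV; [exact: f0|exact: Cn_continuous Cf x].
- by apply: derivableV; [exact: f0|exact: Cn_derivable Cf].
rewrite (_ : (fun x => 'D_v (fun x => (f x)^-1) x) =
  (fun x => -1 * ((f x)^-1 * (f x)^-1) * 'D_v f x)).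
  apply: CnM; last exact: Cn_derive Cf.
  by apply: CnM; [exact: Cn_cst|apply: CnM; apply: IH; exact: CnW].
apply/funext => x; rewrite deriveV//; last exact: Cn_derivable Cf.
by rewrite mulN1r -invfM -expr2.
Qed.

Lemma smooth_continuous f : smooth f -> continuous f.
Proof. by move=> /(_ 0%N); exact: Cn_continuous. Qed.

Lemma smooth_derivable f x v : smooth f -> derivable f x v.
Proof. by move=> /(_ 1%N); exact: Cn_derivable. Qed.

Lemma smooth_derive f v : smooth f -> smooth (fun x => 'D_v f x).
Proof. by move=> Sf n; exact: Cn_derive (Sf n.+1). Qed.

Lemma smooth_cst (k : R) : smooth (fun _ : V => k).
Proof. by move=> n; exact: Cn_cst. Qed.

Lemma smoothM f g : smooth f -> smooth g -> smooth (fun x => f x * g x).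
Proof. by move=> Sf Sg n; exact: CnM. Qed.

Lemma smooth_expR f : smooth f -> smooth (fun x => expR (f x)).
Proof. by move=> Sf n; exact: Cn_expR. Qed.

Lemma smooth_inv f : (forall x, f x != 0) -> smooth f ->
  smooth (fun x => (f x)^-1).
Proof. by move=> f0 Sf n; exact: Cn_inv. Qed.

End smooth_calculus.

Section smooth_product.
Context {R : realType} {V W : normedModType R}.
Implicit Types (H : V * W -> R).

Lemma Cn_sec2 n H x : Cn_on [set: V * W] n H -> Cn_on [set: W] n (fun y => H (x, y)).
Proof.
have cH m h : Cn_on [set: V * W] m h -> continuous (fun y => h (x, y)).
  move=> Ch y; apply: (@continuous_comp _ _ _ (fun y : W => (x, y)) h).
    by apply: cvg_pair => //=; exact: cvg_cst.
  exact: Cn_continuous Ch _.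
have dH m h y w : Cn_on [set: V * W] m.+1 h ->
    is_derive y w (fun y => h (x, y)) ('D_((0, w) : V * W) h (x, y)).
  move=> Ch; apply/is_derive_line0.
  have : is_derive (x, y) ((0, w) : V * W) h ('D_((0, w) : V * W) h (x, y)).
    by apply: DeriveDef => //; exact: Cn_derivable Ch.
  move=> /is_derive_line0.
  rewrite (_ : (fun k : R => _) = (fun k : R => h (x, k *: w + y)))//.
  by apply/funext => k; congr h; congr pair; rewrite /= scaler0 add0r.
elim: n H => [|n IH] H CH; first by split=> // y _; exact: cH CH _.
apply: CnS => [|w y|w]; first exact: cH CH.
  by case: (dH n H y w CH).
rewrite (_ : (fun y => 'D_w (fun y => H (x, y)) y) =
  (fun y => 'D_((0, w) : V * W) H (x, y))).
  by apply: (IH (fun z => 'D_((0, w) : V * W) H z)); exact: Cn_derive CH.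
by apply/funext => y; case: (dH n H y w CH).
Qed.

Lemma Cn_fst n (u : V -> R) : Cn_on [set: V] n u ->
  Cn_on [set: V * W] n (fun z => u z.1).
Proof.
have cu m h : Cn_on [set: V] m h -> continuous (fun z : V * W => h z.1).
  move=> Ch z; apply: (@continuous_comp _ _ _ (fun z : V * W => z.1) h).
    exact: cvg_fst.
  exact: Cn_continuous Ch _.
have du m h (z w : V * W) : Cn_on [set: V] m.+1 h ->
    is_derive z w (fun z => h z.1) ('D_(w.1) h z.1).
  move=> Ch; apply/is_derive_line0.
  have : is_derive z.1 w.1 h ('D_(w.1) h z.1).
    by apply: DeriveDef => //; exact: Cn_derivable Ch.
  by move=> /is_derive_line0.
elim: n u => [|n IH] u Cu; first by split=> // z _; exact: cu Cu _.
apply: CnS => [|w z|w]; first exact: cu Cu.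
  by case: (du n u z w Cu).
rewrite (_ : (fun z => 'D_w (fun z => u z.1) z) = (fun z => 'D_(w.1) u z.1)).
  by apply: (IH (fun x => 'D_(w.1) u x)); exact: Cn_derive Cu.
by apply/funext => z; case: (du n u z w Cu).
Qed.

Lemma Cn_snd n (u : W -> R) : Cn_on [set: W] n u ->
  Cn_on [set: V * W] n (fun z => u z.2).
Proof.
have cu m h : Cn_on [set: W] m h -> continuous (fun z : V * W => h z.2).
  move=> Ch z; apply: (@continuous_comp _ _ _ (fun z : V * W => z.2) h).
    exact: cvg_snd.
  exact: Cn_continuous Ch _.
have du m h (z w : V * W) : Cn_on [set: W] m.+1 h ->
    is_derive z w (fun z => h z.2) ('D_(w.2) h z.2).
  move=> Ch; apply/is_derive_line0.
  have : is_derive z.2 w.2 h ('D_(w.2) h z.2).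
    by apply: DeriveDef => //; exact: Cn_derivable Ch.
  by move=> /is_derive_line0.
elim: n u => [|n IH] u Cu; first by split=> // z _; exact: cu Cu _.
apply: CnS => [|w z|w]; first exact: cu Cu.
  by case: (du n u z w Cu).
rewrite (_ : (fun z => 'D_w (fun z => u z.2) z) = (fun z => 'D_(w.2) u z.2)).
  by apply: (IH (fun x => 'D_(w.2) u x)); exact: Cn_derive Cu.
by apply/funext => z; case: (du n u z w Cu).
Qed.

Lemma smooth_sec2 H x : smooth H -> smooth (fun y => H (x, y)).
Proof. by move=> SH n; exact: Cn_sec2 (SH n). Qed.

Lemma smooth_fst (u : V -> R) : smooth u -> smooth (fun z : V * W => u z.1).
Proof. by move=> Su n; exact: Cn_fst. Qed.

Lemma smooth_snd (u : W -> R) : smooth u -> smooth (fun z : V * W => u z.2).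
Proof. by move=> Su n; exact: Cn_snd. Qed.

Lemma derive_sec2 H x y w : smooth H ->
  'D_w (fun y => H (x, y)) y = 'D_((0, w) : V * W) H (x, y).
Proof.
move=> SH; apply: derive_val; apply/is_derive_line0.
have : is_derive (x, y) ((0, w) : V * W) H ('D_((0, w) : V * W) H (x, y)).
  by apply: DeriveDef => //; exact: smooth_derivable.
move=> /is_derive_line0.
rewrite (_ : (fun k : R => _) = (fun k : R => H (x, k *: w + y)))//.
by apply/funext => k; congr H; congr pair; rewrite /= scaler0 add0r.
Qed.

End smooth_product.

(** * Functionals applied to the sections of a smooth function *)

Section mean_value.
Context {R : realType}.

(** The mean value theorem for [t |-> g t - t * m].  It yields both the Taylor
    remainders and the uniform convergence of difference quotients. *)
Lemma remainder_le (g dg : R -> R) (m e h : R) :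
  (forall t : R, `|t| <= `|h| -> is_derive t 1 g (dg t)) ->
  (forall t : R, `|t| <= `|h| -> `|dg t - m| <= e) ->
  `|g h - g 0 - h * m| <= `|h| * e.
Proof.
move=> dgP dge.
have cg a b : (forall t, t \in `[a, b] -> `|t| <= `|h|) ->
    {within `[a, b], continuous g}.
  move=> ab; apply: derivable_within_continuous => t tab.
  by case: (dgP t (ab t tab)).
have [h0|h0|->] := ltgtP h 0; last by rewrite subrr mul0r subr0 !normr0 mul0r.
- have th t : t \in `[h, 0] -> `|t| <= `|h|.
    by rewrite in_itv/= => /andP[ht t0]; rewrite (ltr0_norm h0) ler0_norm// lerN2.
  have [t] := @MVT R g dg h 0 h0
    (fun t tin => dgP t (th t (subset_itv_oo_cc tin))) (cg _ _ th).
  move=> /subset_itv_oo_cc/th tin gt.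
  have -> : g h - g 0 - h * m = h * (dg t - m).
    by rewrite -[g h - g 0]opprB gt; ring.
  by rewrite normrM ler_wpM2l//; apply: dge.
- have th t : t \in `[0, h] -> `|t| <= `|h|.
    by rewrite in_itv/= => /andP[ht t0]; rewrite (gtr0_norm h0) ger0_norm.
  have [t] := @MVT R g dg 0 h h0
    (fun t tin => dgP t (th t (subset_itv_oo_cc tin))) (cg _ _ th).
  move=> /subset_itv_oo_cc/th tin gt.
  have -> : g h - g 0 - h * m = h * (dg t - m).
    by rewrite gt; ring.
  by rewrite normrM ler_wpM2l//; apply: dge.
Qed.

Lemma expR_taylor2 (z : R) : `|z| <= 2^-1 ->
  `|expR z - (1 + z + z ^+ 2 / 2)| <= 2 * `|z| ^+ 3.
Proof.
move=> z2; pose g (t : R) := expR t - (1 + t + t ^+ 2 / 2).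
have dg (t : R) : is_derive t 1 g (expR t - (1 + t)).
  rewrite /g; apply: is_derive_eq.
  by rewrite /GRing.scale/=; field.
have := @remainder_le g (fun t => expR t - (1 + t)) 0 (2 * `|z| ^+ 2) z
  (fun t _ => dg t).
have -> : g 0 = 0 by rewrite /g expR0 expr0n/=; ring.
rewrite mulr0 !subr0.
move=> h; apply: le_trans (h _) _; last by rewrite mulrCA -exprS.
- move=> t tz; rewrite subr0.
  have h1 := expR_ge1Dx t; have h2 := expR_ge1Dx (- t).
  have t2 : `|t| <= 2^-1 by exact: le_trans tz z2.
  move: t2; rewrite ler_norml => /andP[t2 t2'].
  have eP : 0 < expR t by exact: expR_gt0.
  have h3 : expR t * (1 - t) <= 1.
    have := ler_wpM2l (ltW eP) h2; rewrite -expRD subrr expR0.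
    by [].
  have h4 : expR t - (1 + t) <= 2 * t ^+ 2.
    have h5 : expR t * (1 - t) <= (1 + t + 2 * t ^+ 2) * (1 - t).
      by apply: le_trans h3 _; nra.
    have : expR t <= 1 + t + 2 * t ^+ 2.
      by move: h5; rewrite ler_pM2r//; lra.
    by lra.
  rewrite ger0_norm ?subr_ge0//; apply: le_trans h4 _.
  by rewrite ler_pM2l// -real_normK ?num_real// ler_pXn2r// nnegrE.
Qed.

Lemma ln_taylor2 (w : R) : `|w| <= 2^-1 ->
  `|ln (1 + w) - (w - w ^+ 2 / 2)| <= 2 * `|w| ^+ 3.
Proof.
move=> w2; pose g (t : R) := ln (1 + t) - (t - t ^+ 2 / 2).
have pos (t : R) : `|t| <= `|w| -> 2^-1 <= 1 + t.
  move=> tw; have : `|t| <= 2^-1 by exact: le_trans tw w2.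
  by rewrite ler_norml => /andP[]; lra.
have dg (t : R) : `|t| <= `|w| -> is_derive t 1 g ((1 + t)^-1 - (1 - t)).
  move=> tw; have p := pos t tw; have p0 : 0 < 1 + t by lra.
  have dl := is_derive1_ln p0.
  have d1 : is_derive t 1 (fun t : R => 1 + t) 1.
    by apply: is_derive_eq; rewrite add0r mulr1.
  have d2 := is_derive1_comp dl d1.
  rewrite /g; apply: is_derive_eq.
  by rewrite /GRing.scale/=; field; rewrite gt_eqF.
have := @remainder_le g (fun t => (1 + t)^-1 - (1 - t)) 0 (2 * `|w| ^+ 2) w dg.
have -> : g 0 = 0 by rewrite /g addr0 ln1 expr0n/=; ring.
rewrite mulr0 !subr0.
move=> h; apply: le_trans (h _) _; last by rewrite mulrCA -exprS.
move=> t tw; have p := pos t tw; have p0 : 0 < 1 + t by lra.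
have -> : (1 + t)^-1 - (1 - t) - 0 = t ^+ 2 / (1 + t) by field; rewrite gt_eqF.
rewrite normrM normfV (ger0_norm (sqr_ge0 t)) (gtr0_norm p0) ler_pdivrMr//.
have tw2 : t ^+ 2 <= `|w| ^+ 2.
  by rewrite -real_normK ?num_real// ler_pXn2r// nnegrE.
have := sqr_ge0 `|w|; nra.
Qed.

Lemma entropy_le (w : R) : `|w| <= 2^-1 ->
  (1 + w) * ln (1 + w) <= w + w ^+ 2 / 2 + 4 * `|w| ^+ 3.
Proof.
move=> w2; have := ln_taylor2 w2; rewrite ler_norml => /andP[_ h].
have w1 : 0 <= 1 + w by move: w2; rewrite ler_norml => /andP[]; lra.
have h1 : ln (1 + w) <= w - w ^+ 2 / 2 + 2 * `|w| ^+ 3.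
  by move: (ln _) h => l h; lra.
apply: le_trans (ler_wpM2l w1 h1) _.
have w3 : - w ^+ 3 <= `|w| ^+ 3 by rewrite -normrX -normrN ler_norm.
have w4 : w * `|w| ^+ 3 <= 2^-1 * `|w| ^+ 3.
  rewrite ler_wpM2r// ?exprn_ge0//.
  by apply: le_trans w2; exact: ler_norm.
have w30 : 0 <= `|w| ^+ 3 by exact: exprn_ge0.
by move: (`|w| ^+ 3) w3 w4 w30 => a ? ? ?; lra.
Qed.

End mean_value.

Section bounded_functionals.
Context {R : realType} {V W : normedModType R} (X : set W).
Hypothesis cptX : compact X.
Implicit Types (H : V * W -> R) (J : (W -> R) -> R) (f g : W -> R) (k : R).

(** In effect the signed measures carried by the compact set [X], through
    their action on continuous functions.  This covers both integration against
    a multiple of [nu - mu] and integration against [mu] with a weight. *)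
Definition bfunctional J : Prop :=
  (forall (k : R) f g, continuous f -> continuous g ->
     J (fun y => k * f y + g y) = k * J f + J g) /\
  exists2 C0 : R, 0 <= C0 & forall f (b : R), continuous f ->
     (forall y, X y -> `|f y| <= b) -> `|J f| <= C0 * b.

Lemma bfunctionalB J f g : bfunctional J -> continuous f -> continuous g ->
  J (fun y => f y - g y) = J f - J g.
Proof.
move=> [Jlin _] cf cg; rewrite addrC -mulN1r -Jlin//; congr J.
by apply/funext => y; rewrite mulN1r addrC.
Qed.

Lemma bfunctionalZ J k f : bfunctional J -> continuous f ->
  J (fun y => k * f y) = k * J f.
Proof.
move=> [Jlin _] cf.
have c0 : continuous (fun _ : W => (0 : R)) by move=> y; exact: cst_continuous.
have J0 : J (fun=> 0) = 0.
  have := Jlin 1 _ _ c0 c0.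
  rewrite (_ : (fun y : W => 1 * 0 + 0) = fun=> 0); last first.
    by apply/funext => y; rewrite mulr0 addr0.
  by lra.
rewrite -[RHS]addr0 -J0 -Jlin//; congr J.
by apply/funext => y; rewrite addr0.
Qed.

Lemma continuous_sec2 H x : continuous H -> continuous (fun y => H (x, y)).
Proof.
move=> cH y; apply: (@continuous_comp _ _ _ (fun y : W => (x, y)) H).
  by apply: cvg_pair => //=; exact: cvg_cst.
exact: cH.
Qed.

Lemma continuous_subf f g : continuous f -> continuous g ->
  continuous (fun y => f y - g y).
Proof. by move=> cf cg y; exact: (@continuousB _ _ _ f g y (cf y) (cg y)). Qed.

Lemma scaled_le (C e : R) : 0 <= C -> 0 < e -> C * (e / (C + 1)) <= e.
Proof.
move=> C0 e0; have C1 : 0 < C + 1 by rewrite ltr_wpDl.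
by rewrite mulrA ler_pdivrMr// mulrC; apply: ler_wpM2l; [exact: ltW|rewrite lerDl].
Qed.

(** The tube lemma. *)
Lemma near_uniform_sec H x (e : R) : continuous H -> 0 < e ->
  \forall x' \near x, forall y, X y -> `|H (x', y) - H (x, y)| <= e.
Proof.
move=> cH e0; apply: (proj1 (compact_near_coveringP X) cptX V (nbhs x)
  (fun x' y => `|H (x', y) - H (x, y)| <= e)) => y Xy.
have e20 : 0 < e / 2 by rewrite divr_gt0.
have /cvgrPdist_le/(_ _ e20) [[A B] /= [Ax By] AB] := cH (x, y).
exists (B, A) => //= -[y' x'] /= [By' Ax'].
have h1 := AB (x', y') (conj Ax' By').
have h2 := AB (x, y') (conj (nbhs_singleton Ax) By').
rewrite (_ : _ - _ = (H (x, y) - H (x, y')) - (H (x, y) - H (x', y'))); last by ring.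
apply: le_trans (ler_normB _ _) _.
by rewrite [leRHS](splitr e) lerD.
Qed.

Lemma continuous_functional_sec J H : bfunctional J -> continuous H ->
  continuous (fun x => J (fun y => H (x, y))).
Proof.
move=> bJ cH x; have [_ [C0 C00 JC]] := bJ.
apply/cvgrPdist_le => e e0.
have e' : 0 < e / (C0 + 1) by rewrite divr_gt0// ltr_wpDl.
near=> x'.
have -> : J (fun y => H (x, y)) - J (fun y => H (x', y)) =
    J (fun y => H (x, y) - H (x', y)).
  by rewrite bfunctionalB//; exact: continuous_sec2.
have /le_trans : `|J (fun y => H (x, y) - H (x', y))| <= C0 * (e / (C0 + 1)).
  apply: JC.
    by apply: continuous_subf; exact: continuous_sec2.
  move=> y Xy; rewrite distrC; move: y Xy.
  by near: x'; exact: near_uniform_sec.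
apply; exact: scaled_le.
Unshelve. all: by end_near. Qed.

(** Differentiation under the integral sign: by the mean value theorem and
    compactness of [X], the difference quotients of the sections converge
    uniformly on [X]. *)
Lemma is_derive_functional_sec J H x v : bfunctional J -> smooth H ->
  is_derive x v (fun x => J (fun y => H (x, y)))
    (J (fun y => 'D_((v, 0) : V * W) H (x, y))).
Proof.
move=> bJ SH; have [_ [C0 C00 JC]] := bJ.
pose D z := 'D_((v, 0) : V * W) H z.
have cD : continuous D by apply: smooth_continuous; exact: smooth_derive.
have cH : continuous H by exact: smooth_continuous.
suff : (fun h : R => h^-1 *: (((fun x => J (fun y => H (x, y))) \o shift x) (h *: v)
    - J (fun y => H (x, y)))) @ 0^' --> J (fun y => D (x, y)).
  by move=> h; apply: DeriveDef; [apply/cvg_ex; eexists; exact: h|exact: cvg_lim h].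
apply/cvgrPdist_le => e e0.
have e' : 0 < e / (C0 + 1) by rewrite divr_gt0// ltr_wpDl.
have near_t : \forall t \near (0 : R), forall y, X y ->
    `|D (t *: v + x, y) - D (x, y)| <= e / (C0 + 1).
  have ct : (fun t : R => t *: v + x) @ (0 : R) --> x.
    rewrite -[X in _ --> X](_ : 0 *: v + x = x); last by rewrite scale0r add0r.
    apply: cvgD; last exact: cvg_cst.
    by apply: cvgZr_tmp; exact: cvg_id.
  exact: ct (near_uniform_sec x cD e').
have [del /= del0 hdel] := near_t.
near=> h.
have h0 : h != 0 by near: h; exact: nbhs_dnbhs_neq.
have hd : `|h| < del by near: h; apply: dnbhs0_lt.
have c1 := continuous_sec2 (x := h *: v + x) cH.
have c2 := continuous_sec2 (x := x) cH.
have c3 := continuous_sec2 (x := x) cD.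
have c12 : continuous (fun y => H (h *: v + x, y) - H (x, y)).
  exact: continuous_subf c1 c2.
have -> : h^-1 *: (((fun x => J (fun y => H (x, y))) \o shift x) (h *: v)
    - J (fun y => H (x, y))) = J (fun y => h^-1 * (H (h *: v + x, y) - H (x, y))).
  by rewrite /= (bfunctionalZ _ bJ c12) (bfunctionalB bJ c1 c2).
have c4 : continuous (fun y => h^-1 * (H (h *: v + x, y) - H (x, y))).
  move=> y; apply: (@continuousM R W (fun=> h^-1)
    (fun y => H (h *: v + x, y) - H (x, y))); last exact: c12.
  exact: cst_continuous.
rewrite -bfunctionalB//.
have /le_trans : `|J (fun y => D (x, y) - h^-1 * (H (h *: v + x, y) - H (x, y)))|
    <= C0 * (e / (C0 + 1)).
  apply: JC => [y|y Xy]; first exact: continuous_subf c3 c4 y.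
  have := @remainder_le R (fun t => H (t *: v + x, y)) (fun t => D (t *: v + x, y))
    (D (x, y)) (e / (C0 + 1)) h.
  rewrite scale0r add0r => hr.
  have {hr} : `|H (h *: v + x, y) - H (x, y) - h * D (x, y)| <= `|h| * (e / (C0 + 1)).
    apply: hr => t.
      move=> _; have : is_derive (t *: ((v, 0) : V * W) + (x, y)) ((v, 0) : V * W) H
          ('D_((v, 0) : V * W) H (t *: ((v, 0) : V * W) + (x, y))).
        by apply: DeriveDef => //; exact: smooth_derivable.
      move=> /is_derive_line.
      have E s : s *: ((v, 0) : V * W) + (x, y) = (s *: v + x, y).
        by congr pair; rewrite /= scaler0 add0r.
      by rewrite E; under eq_fun do rewrite E.
    move=> th; apply: hdel => //=.
    by rewrite sub0r normrN (le_lt_trans th).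
  rewrite -ler_pdivrMl ?normr_gt0// -normfV -normrM.
  by rewrite mulrBr mulrA mulVf// mul1r distrC.
apply; exact: scaled_le.
Unshelve. all: by end_near. Qed.

Lemma Cn_functional_sec n J H : bfunctional J -> smooth H ->
  Cn_on [set: V] n (fun x => J (fun y => H (x, y))).
Proof.
move=> bJ; elim: n H => [|n IH] H SH.
  split=> // x _; exact: (continuous_functional_sec bJ (smooth_continuous SH)).
apply: CnS => [|v x|v].
- exact: (continuous_functional_sec bJ (smooth_continuous SH)).
- by case: (is_derive_functional_sec x v bJ SH).
rewrite (_ : (fun x => 'D_v (fun x => J (fun y => H (x, y))) x) =
    (fun x => J (fun y => 'D_((v, 0) : V * W) H (x, y)))).
  by apply: (IH (fun z => 'D_((v, 0) : V * W) H z)); exact: smooth_derive.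
by apply/funext => x; case: (is_derive_functional_sec x v bJ SH).
Qed.

Lemma smooth_functional_sec J H : bfunctional J -> smooth H ->
  smooth (fun x => J (fun y => H (x, y))).
Proof. by move=> bJ SH n; exact: (Cn_functional_sec n bJ SH). Qed.

Lemma bfunctional_lin J1 J2 k : bfunctional J1 -> bfunctional J2 ->
  bfunctional (fun f => k * J1 f + J2 f).
Proof.
move=> [lin1 [C1 C10 b1]] [lin2 [C2 C20 b2]]; split.
  by move=> l f g cf cg; rewrite lin1// lin2//; ring.
exists (`|k| * C1 + C2); first by rewrite addr_ge0// mulr_ge0.
move=> f b cf fb; apply: le_trans (ler_normD _ _) _.
by rewrite normrM mulrDl -mulrA lerD ?b2// ler_wpM2l ?b1.
Qed.

End bounded_functionals.

(** * Bounds on iterated partial derivatives *)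

Section derivative_bounds.
Context {R : realType} {d : nat} (X : set (Rd R d)).
Implicit Types (f g : Rd R d -> R) (H : Rd R d * Rd R d -> R) (a b : R).

Local Notation e_ i := (delta_mx ord0 i : Rd R d).

(** A bound on a [C^n] norm that is defined by recursion, in the same way as
    [Cn_on], so that calculus rules are proved by induction on [n]. *)
Fixpoint bnd n b f : Prop := (forall x, X x -> `|f x| <= b) /\
  if n is m.+1 then forall i : 'I_d, bnd m b (fun x => 'D_(e_ i) f x) else True.

Lemma bnd_sup n b f x : bnd n b f -> X x -> `|f x| <= b.
Proof. by case: n => [|n] [h _] Xx; exact: h. Qed.

Lemma bnd_derive n b f i : bnd n.+1 b f -> bnd n b (fun x => 'D_(e_ i) f x).
Proof. by move=> [_ /(_ i)]. Qed.

Lemma bnd_le n a b f : a <= b -> bnd n a f -> bnd n b f.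
Proof.
move=> ab; elim: n f => [|n IH] f Hf.
  by split=> // x Xx; exact: le_trans (bnd_sup Hf Xx) ab.
split=> [x Xx|i]; first exact: le_trans (bnd_sup Hf Xx) ab.
by apply: IH; exact: bnd_derive.
Qed.

Lemma bndW n b f : bnd n.+1 b f -> bnd n b f.
Proof.
elim: n f => [|n IH] f Hf; split=> //; try by move=> x Xx; exact: bnd_sup Hf Xx.
by move=> i; apply: IH; exact: bnd_derive.
Qed.

Lemma bndD n a b f g : smooth f -> smooth g -> bnd n a f -> bnd n b g ->
  bnd n (a + b) (fun x => f x + g x).
Proof.
have base m (a' b' : R) f' g' x : bnd m a' f' -> bnd m b' g' -> X x ->
    `|f' x + g' x| <= a' + b'.
  move=> hf hg Xx; apply: le_trans (ler_normD _ _) _.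
  by rewrite lerD ?(bnd_sup hf)// (bnd_sup hg).
elim: n f g => [|n IH] f g Sf Sg hf hg.
  by split=> // x Xx; exact: base hf hg Xx.
split=> [x Xx|i]; first exact: base hf hg Xx.
rewrite (_ : (fun x => 'D_(e_ i) (fun x => f x + g x) x) =
  (fun x => 'D_(e_ i) f x + 'D_(e_ i) g x)).
  by apply: IH; do ?exact: smooth_derive; exact: bnd_derive.
by apply/funext => x; apply: (@deriveD _ _ _ f g); exact: smooth_derivable.
Qed.

(** The factor [2 ^+ n] counts the terms of the iterated Leibniz rule. *)
Lemma bndM n a b f g : smooth f -> smooth g -> bnd n a f -> bnd n b g ->
  bnd n (2 ^+ n * a * b) (fun x => f x * g x).
Proof.
have base m (a' b' : R) f' g' x : bnd m a' f' -> bnd m b' g' -> X x ->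
    `|f' x * g' x| <= a' * b'.
  by move=> hf hg Xx; rewrite normrM ler_pM ?(bnd_sup hf)// (bnd_sup hg).
have pow n' (a' b' : R) f' g' x : bnd n' a' f' -> bnd n' b' g' -> X x ->
    a' * b' <= 2 ^+ n' * a' * b'.
  move=> hf hg Xx; rewrite -mulrA ler_peMl//.
    apply: mulr_ge0; [exact: le_trans (bnd_sup hf Xx)|].
    exact: le_trans (bnd_sup hg Xx).
  by rewrite exprn_ege1// ler1n.
elim: n a b f g => [|n IH] a b f g Sf Sg hf hg.
  by rewrite expr0 mul1r; split=> // x Xx; exact: base hf hg Xx.
split=> [x Xx|i].
  exact: le_trans (base _ _ _ _ _ _ hf hg Xx) (pow _ _ _ _ _ _ hf hg Xx).
rewrite (_ : (fun x => 'D_(e_ i) (fun x => f x * g x) x) =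
  (fun x => f x * 'D_(e_ i) g x + g x * 'D_(e_ i) f x)); last first.
  by apply/funext => x; apply: (@deriveM _ _ f g); exact: smooth_derivable.
rewrite (_ : 2 ^+ n.+1 * a * b = 2 ^+ n * a * b + 2 ^+ n * b * a); last first.
  by rewrite exprS; ring.
have [Df Dg] := (smooth_derive (e_ i) Sf, smooth_derive (e_ i) Sg).
apply: bndD; [exact: smoothM|exact: smoothM| |].
- exact: (IH a b _ _ Sf Dg (bndW hf) (bnd_derive i hg)).
- exact: (IH b a _ _ Sg Df (bndW hg) (bnd_derive i hf)).
Qed.

Lemma bnd_cst n k : bnd n `|k| (fun=> k).
Proof.
have gen m (b k' : R) : `|k'| <= b -> bnd m b (fun=> k').
  elim: m k' => [|m IH] k' kb; split=> // i.
  rewrite (_ : (fun x => 'D_(e_ i) (fun=> k') x) = fun=> 0); last first.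
    by apply/funext => x; exact: derive_cst.
  by apply: IH; rewrite normr0 (le_trans _ kb).
exact: gen.
Qed.

Lemma bndZ n k b f : smooth f -> bnd n b f -> bnd n (`|k| * b) (fun x => k * f x).
Proof.
elim: n f => [|n IH] f Sf hf.
  by split=> // x Xx; rewrite normrM ler_wpM2l//; exact: bnd_sup hf Xx.
split=> [x Xx|i].
  by rewrite normrM ler_wpM2l//; exact: bnd_sup hf Xx.
rewrite (_ : (fun x => 'D_(e_ i) (fun x => k * f x) x) =
  (fun x => k * 'D_(e_ i) f x)); last first.
  by apply/funext => x; apply: (@deriveZ _ _ _ f); exact: smooth_derivable.
by apply: IH; [exact: smooth_derive|exact: bnd_derive].
Qed.

Hypothesis cptX : compact X.

Lemma bounded_on_square H : continuous H ->
  exists2 C : R, 0 <= C & forall x y, X x -> X y -> `|H (x, y)| <= C.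
Proof.
move=> cH; have : compact (H @` (X `*` X)).
  apply: continuous_compact; last exact: compact_setX.
  exact: continuous_subspaceT.
move=> /compact_bounded[M [_ MB]]; exists (`|M| + 1); first by rewrite addr_ge0.
move=> x y Xx Xy; apply: (MB (`|M| + 1)); last by exists (x, y).
by rewrite ltr_pwDr// ler_norm.
Qed.

Lemma bnd_sec2 n H : smooth H ->
  exists2 C : R, 0 <= C & forall x, X x -> bnd n C (fun y => H (x, y)).
Proof.
elim: n H => [|n IH] H SH.
  have [C C0 HC] := bounded_on_square (smooth_continuous SH).
  by exists C => // x Xx; split=> // y Xy; exact: HC.
have [C C0 HC] := bounded_on_square (smooth_continuous SH).
have D i : exists Ci : R, 0 <= Ci /\ forall x, X x ->
    bnd n Ci (fun y => 'D_(e_ i) (fun y => H (x, y)) y).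
  have [Ci Ci0 HCi] := IH _ (smooth_derive ((0, e_ i) : Rd R d * Rd R d) SH).
  exists Ci; split=> // x Xx.
  rewrite (_ : (fun y => 'D_(e_ i) (fun y => H (x, y)) y) =
      (fun y => 'D_((0, e_ i) : Rd R d * Rd R d) H (x, y))); first exact: HCi x Xx.
  by apply/funext => y; exact: derive_sec2.
have [Cf HCf] := fin_all_exists D.
have S0 i : Cf i <= \sum_j Cf j.
  rewrite (bigD1 i)//= lerDl; apply: sumr_ge0 => j _; by case: (HCf j).
have Sge0 : 0 <= \sum_j Cf j by apply: sumr_ge0 => j _; case: (HCf j).
exists (C + \sum_j Cf j); first exact: addr_ge0.
move=> x Xx; split=> [y Xy|i].
  by apply: le_trans (HC x y Xx Xy) _; rewrite lerDl.
apply: (@bnd_le _ (Cf i)); last by case: (HCf i) => _; exact.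
by rewrite (le_trans (S0 i))// lerDr.
Qed.

(** The derivatives in [x] fall on [H], and the sections in [y] of each
    derivative of [H] are bounded in [C^s] uniformly in [x].  A functional that
    is small in the dual of [C^s] is thus turned into a function that is small
    in [C^n] for every [n], with no loss of derivatives. *)
Lemma bnd_functional_sec s n H : smooth H -> exists2 C : R, 0 <= C &
  forall (J : (Rd R d -> R) -> R) b, bfunctional X J ->
    (forall F, smooth F -> bnd s 1 F -> `|J F| <= b) ->
    bnd n (C * b) (fun x => J (fun y => H (x, y))).
Proof.
(* a functional of norm at most b on the unit ball is at most C b on a ball of
   radius C *)
have base H' : smooth H' -> exists2 C : R, 0 < C &
    forall (J : (Rd R d -> R) -> R) b, bfunctional X J ->
    (forall F, smooth F -> bnd s 1 F -> `|J F| <= b) ->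
    forall x, X x -> `|J (fun y => H' (x, y))| <= C * b.
  move=> SH; have [C C0 HC] := bnd_sec2 s SH.
  have C1 : 0 < C + 1 by rewrite ltr_wpDl.
  have nC : `|(C + 1)^-1| = (C + 1)^-1 by rewrite ger0_norm// invr_ge0 ltW.
  exists (C + 1) => // J b bJ Jb x Xx.
  have SF := smooth_sec2 x SH.
  have : `|J (fun y => (C + 1)^-1 * H' (x, y))| <= b.
    apply: Jb; first by apply: smoothM => //; exact: smooth_cst.
    have := bndZ (C + 1)^-1 SF (HC x Xx).
    by apply: bnd_le; rewrite nC ler_pdivrMl// mulr1 lerDl.
  rewrite (bfunctionalZ _ bJ (smooth_continuous SF)).
  by rewrite normrM nC ler_pdivrMl.
elim: n H => [|n IH] H SH.
  have [C C0 HC] := base _ SH.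
  by exists C; [exact: ltW|move=> J b bJ Jb; split=> // x Xx; exact: HC].
have [C C0 HC] := base _ SH.
have D i : exists Ci : R, 0 <= Ci /\
    forall (J : (Rd R d -> R) -> R) b, bfunctional X J ->
    (forall F, smooth F -> bnd s 1 F -> `|J F| <= b) ->
    bnd n (Ci * b) (fun x => 'D_(e_ i) (fun x => J (fun y => H (x, y))) x).
  have [Ci Ci0 HCi] := IH _ (smooth_derive ((e_ i, 0) : Rd R d * Rd R d) SH).
  exists Ci; split=> // J b bJ Jb.
  rewrite (_ : (fun x => 'D_(e_ i) (fun x => J (fun y => H (x, y))) x) =
      (fun x => J (fun y => 'D_((e_ i, 0) : Rd R d * Rd R d) H (x, y)))).
    exact: HCi J b bJ Jb.
  by apply/funext => x; case: (is_derive_functional_sec cptX x (e_ i) bJ SH).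
have [Cf HCf] := fin_all_exists D.
have S0 i : Cf i <= \sum_j Cf j.
  rewrite (bigD1 i)//= lerDl; apply: sumr_ge0 => j _; by case: (HCf j).
have Sge0 : 0 <= \sum_j Cf j by apply: sumr_ge0 => j _; case: (HCf j).
exists (C + \sum_j Cf j); first by rewrite addr_ge0// ltW.
move=> J b bJ Jb.
have b0 : 0 <= b.
  apply: le_trans (Jb (fun=> 0) (smooth_cst _) _) => //.
  by apply: (@bnd_le _ `|0|); [rewrite normr0|exact: bnd_cst].
split=> [x Xx|i].
  apply: le_trans (HC J b bJ Jb x Xx) _.
  by rewrite ler_wpM2r// lerDl.
apply: (@bnd_le _ (Cf i * b)); last by case: (HCf i) => _; exact.
by rewrite ler_wpM2r// (le_trans (S0 i))// lerDr ltW.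
Qed.

End derivative_bounds.

(** * Test functions in the unit ball of C^s *)

Section Cs_unit_ball.
Context {R : realType} {d : nat}.
Implicit Types (f g F : Rd R d -> R) (k : 'I_d -> nat) (U X : set (Rd R d)).

Local Notation e_ i := (delta_mx ord0 i : Rd R d).

Lemma derive_eq_on U f g v : open U -> (forall x, U x -> f x = g x) ->
  forall x, U x -> 'D_v f x = 'D_v g x.
Proof.
move=> oU fg x Ux; apply: near_eq_derive.
by apply: filterS (open_nbhs_nbhs (conj oU Ux)) => y; exact: fg.
Qed.

Lemma mderiv_eq_on U f g k : open U -> (forall x, U x -> f x = g x) ->
  forall x, U x -> mderiv k f x = mderiv k g x.
Proof.
move=> oU fg; rewrite /mderiv; elim: (enum 'I_d) => [|i l IH] //=.
elim: (k i) => [|n IHn] //= x Ux.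
exact: (derive_eq_on (e_ i) oU IHn).
Qed.

Lemma Cn_eq_on n U f g : open U -> (forall x, U x -> f x = g x) ->
  Cn_on [set: Rd R d] n g -> Cn_on U n f.
Proof.
move=> oU.
have cont f' g' : (forall x, U x -> f' x = g' x) -> continuous g' ->
    forall x, U x -> {for x, continuous f'}.
  move=> fg cg x Ux; suff : f' @ x --> g' x by rewrite -fg.
  apply: cvg_trans (cg x).
  have nU : \forall y \near x, g' y = f' y.
    by apply: filterS (open_nbhs_nbhs (conj oU Ux)) => y Uy; exact/esym/fg.
  exact: near_eq_cvg nU.
elim: n f g => [|n IH] f g fg Cg.
  split=> // x Ux; exact: cont fg (Cn_continuous Cg) x Ux.
split=> [x Ux|v].
  exact: cont fg (Cn_continuous Cg) x Ux.
split=> [x Ux|].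
  have nU : \forall y \near x, g y = f y.
    by apply: filterS (open_nbhs_nbhs (conj oU Ux)) => y Uy; exact/esym/fg.
  have dg := @Cn_derivable _ _ _ _ x v Cg.
  refine (@near_eq_derivable _ _ _ g f x v nU dg).
apply: (IH _ (fun x => 'D_v g x)); last exact: Cn_derive.
exact: derive_eq_on.
Qed.

Lemma mderiv_smooth k F : smooth F -> smooth (mderiv k F).
Proof.
move=> SF; rewrite /mderiv; elim: (enum 'I_d) => [|i l IH] //=.
by elim: (k i) => [|n IHn] //=; exact: smooth_derive.
Qed.

Lemma bnd_mderiv X n b k F : bnd X n b F -> (\sum_(i < d) k i <= n)%N ->
  forall x, X x -> `|mderiv k F x| <= b.
Proof.
move=> hF kn x Xx.
have iterP (i : 'I_d) m j g : bnd X (m + j)%N b g ->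
    bnd X m b (iter j (fun h x => 'D_(e_ i) h x) g).
  elim: j m => [|j IH] m; first by rewrite addn0.
  rewrite -addSnnS => /IH hg /=.
  exact: (bnd_derive i hg).
have foldP l m g : bnd X (m + \sum_(i <- l) k i)%N b g ->
    bnd X m b (foldr (fun i g => iter (k i) (fun h x => 'D_(e_ i) h x) g) g l).
  elim: l m => [|i l IH] m /=; first by rewrite big_nil addn0.
  by rewrite big_cons addnA => hg; apply: iterP; exact: IH.
have := foldP (enum 'I_d) (n - \sum_(i < d) k i)%N F.
rewrite big_enum/= subnK// => /(_ hF) h.
exact: bnd_sup h Xx.
Qed.

(** The normal form of the elements of [Cs X s], which vanish outside [X]. *)
Definition cutoff X F : Rd R d -> R := fun x => if x \in X then F x else 0.

(** The norm of [Cs X s] adds up one maximum for each order of derivation,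
    hence the factor [s.+1]. *)
Lemma Cs_ball_cutoff X s F : smooth F -> bnd X s 1 F ->
  Cs_ball X s (cutoff X (fun x => s.+1%:R^-1 * F x)).
Proof.
move=> SF hF; set G := fun x => s.+1%:R^-1 * F x.
have s0 : (0 : R) <= s.+1%:R^-1 by [].
have SG : smooth G by apply: smoothM => //; exact: smooth_cst.
have hG : bnd X s s.+1%:R^-1 G.
  have := bndZ s.+1%:R^-1 SF hF; by rewrite mulr1 ger0_norm.
have GX x : X x -> cutoff X G x = G x by move=> Xx; rewrite /cutoff mem_set.
have Go : open X° by exact: open_interior.
have GXo x : X° x -> cutoff X G x = G x.
  by move=> Xx; apply: GX; exact: interior_subset.
split; first split.
- by move=> x nXx; rewrite /cutoff memNset.
- exact: Cn_eq_on Go GXo (SG s).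
- have e : {in X, G =1 cutoff X G} by move=> x /[!inE] Xx; rewrite GX.
  apply: (@subspace_eq_continuous (Rd R d) X R G (cutoff X G) e).
  apply: continuous_subspaceT; exact: smooth_continuous.
- move=> k ks; exists (mderiv k G); split.
    by apply: continuous_subspaceT; apply: smooth_continuous; exact: mderiv_smooth.
  by move=> x Xx; rewrite (mderiv_eq_on k Go GXo).
rewrite /Cs_norm.
apply: (@le_trans _ _ (\sum_(j < s.+1) (s.+1%:R^-1 : R)%:E)%E); last first.
  by rewrite sumEFin lee_fin sumr_const card_ord -[leLHS]mulr_natl divff.
apply: lee_sum => j _; apply: bigmax_le; first by rewrite lee_fin.
move=> k /eqP ksum; apply: ge_ereal_sup => _ [x Xx <-].
rewrite lee_fin (mderiv_eq_on _ Go GXo)//.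
apply: (bnd_mderiv hG); last exact: interior_subset.
by rewrite ksum -ltnS.
Qed.

End Cs_unit_ball.

(** * Continuous functions on a product are Borel *)

Section borel_product.
Context {R : realType} {d : nat}.

Lemma measurable_continuous (f : Rd R d -> R) : continuous f ->
  measurable_fun setT f.
Proof.
move=> cf; apply: within_continuous_measurable; first exact: closedT.
exact: continuous_subspaceT.
Qed.

(* points with rational coordinates *)
Let rpt (q : 'rV[rat]_d) : Rd R d := \row_j ratr (q ord0 j).

Let rpt_dense (x : Rd R d) (e : R) : 0 < e -> exists q, ball x e (rpt q).
Proof.
move=> e0; have /choice[q hq] (j : 'I_d) : exists q : rat, `|x ord0 j - ratr q| < e.
  have xe : x ord0 j - e < x ord0 j + e by lra.
  have [q] := rat_in_itvoo xe.
  rewrite in_itv/= => /andP[h1 h2]; exists q.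
  by rewrite distrC ltr_distl h1.
exists (\row_j q j); split=> // i j; rewrite /ball/= !mxE (ord1 i).
exact: hq.
Qed.

(** An open set of the product is a countable union of products of balls with
    rational centres and radii [1/n]; so the product of the Borel sigma-algebras
    contains it. *)
Lemma measurable_open_prod (U : set (Rd R d * Rd R d)) : open U -> measurable U.
Proof.
move=> oU.
pose B (q : 'rV[rat]_d * 'rV[rat]_d * nat) : set (Rd R d * Rd R d) :=
  ball (rpt q.1.1) q.2.+1%:R^-1 `*` ball (rpt q.1.2) q.2.+1%:R^-1.
have -> : U = \bigcup_(q in [set q | B q `<=` U]) B q.
  apply/seteqP; split=> [[x y] Uxy|z [q qU]]; last exact: qU.
  have [[A C] [/= Ax Cy] ACU] : nbhs (x, y) U by exact: open_nbhs_nbhs.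
  have [e /= e0 eA] := (nbhs_ballP _ _).1 Ax.
  have [e' /= e'0 eC] := (nbhs_ballP _ _).1 Cy.
  pose m := Num.min e e'; have m0 : 0 < m by rewrite lt_min e0.
  have [n hn] : exists n : nat, n.+1%:R^-1 < m / 2.
    have := near_infty_natSinv_lt (PosNum (divr_gt0 m0 (ltr0n R 2))).
    by move=> [n _ /(_ n (leqnn _))] ?; exists n.
  have n0 : (0 : R) < n.+1%:R^-1 by [].
  have [qx hx] := rpt_dense x n0; have [qy hy] := rpt_dense y n0.
  exists ((qx, qy), n); last first.
    by split; [exact: ball_sym hx|exact: ball_sym hy].
  move=> [x' y'] [/= hx' hy']; apply: ACU; split.
    apply: eA; apply: (@le_ball _ _ _ (n.+1%:R^-1 + n.+1%:R^-1)).
      have me : m <= e by rewrite ge_min lexx.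
      by apply: le_trans me; rewrite [leRHS](splitr m) lerD// ltW.
    exact: ball_triangle hx hx'.
  apply: eC; apply: (@le_ball _ _ _ (n.+1%:R^-1 + n.+1%:R^-1)).
    have me : m <= e' by rewrite ge_min lexx orbT.
    by apply: le_trans me; rewrite [leRHS](splitr m) lerD// ltW.
  exact: ball_triangle hy hy'.
pose G n := if unpickle n is Some q then
  if `[< B q `<=` U >] then B q else set0 else set0.
have -> : \bigcup_(q in [set q | B q `<=` U]) B q = \bigcup_n G n.
  apply/seteqP; split=> [z [q qU Bz]|z [n _]].
    exists (pickle q); first exact: I.
    by rewrite /G pickleK; case: asboolP => [_|/(_ qU)].
  rewrite /G; case: unpickle => // q; case: asboolP => // qU Bz.
  by exists q.
apply: bigcupT_measurable => n; rewrite /G; case: unpickle => // q.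
case: asboolP => // _; apply: measurableX; apply: measurable_open; exact: ball_open.
Qed.

Lemma measurable_continuous_prod (f : Rd R d * Rd R d -> R) : continuous f ->
  measurable_fun setT f.
Proof.
move=> /continuousP cf; apply: (measurability _ (RGenOpens.measurableE R)) => //.
move=> _ [_ [p [q ->] <-]]; rewrite setTI; apply: measurable_open_prod.
by apply: cf; exact: interval_open.
Qed.

End borel_product.

(** * The Gibbs variational inequality *)

Section relative_entropy.
Context {R : realType} dd (T : measurableType dd).
Implicit Types (pi rho : probability T R).
Local Open Scope charge_scope.

(** Monotonicity when only the smaller function is integrable; it is used for
    the logarithm of a density, whose integral may be infinite. *)
Lemma integral_ge_integrable (pi : probability T R) (u v : T -> \bar R) :
  measurable_fun setT u -> pi.-integrable setT v -> (forall x, v x <= u x)%E ->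
  (\int[pi]_x v x <= \int[pi]_x u x)%E.
Proof.
move=> mu iv vu; have mv := measurable_int _ iv.
rewrite integralE [leRHS]integralE leeB//.
- apply: ge0_le_integral => //; [exact: measurable_funepos|exact: measurable_funepos|].
  by move=> x _; apply: (@funepos_le _ _ setT) => [y _|]; [exact: vu|rewrite inE].
- apply: ge0_le_integral => //; [exact: measurable_funeneg|exact: measurable_funeneg|].
  by move=> x _; apply: (@funeneg_le _ _ setT) => [y _|]; [exact: vu|rewrite inE].
Qed.

(** With [h] the density of [pi] with respect to [rho], integrate
    [ln h >= zeta + 1 - e^zeta / h] against [pi]; the last term integrates to at
    most [\int e^zeta drho]. *)
Lemma gibbs_le_KL pi rho (zeta : T -> R) : bmeas zeta ->
  ((Ex pi zeta + 1 - Ex rho (fun z => expR (zeta z)))%:E <= KL pi rho)%E.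
Proof.
move=> bz; rewrite /KL; case: asboolP => [dom|_]; last exact: leey.
set D := 'd _ '/d _.
pose h z := fine (D z).
have Dfin z : D z \is a fin_num by exact: Radon_Nikodym_fin_num.
have DE z : D z = (h z)%:E by rewrite /h fineK.
have mD : measurable_fun setT D by apply: (measurable_int rho); exact: Radon_Nikodym_integrable.
have mh : measurable_fun setT h.
  by apply/measurable_EFinP; rewrite (_ : _ \o _ = D)//; apply/funext => z; rewrite /= DE.
have mlnh : measurable_fun setT (fun z => ln (h z)).
  by apply: measurableT_comp mh; exact: measurable_ln.
have hpos : measurable_fun setT (fun z => 0 < h z) by exact: measurable_fun_ltr.
have be := bmeas_expR bz.
(* the density is positive pi-almost everywhere *)
pose N := [set z | h z <= 0].
have mN : measurable N.
  rewrite (_ : N = setT `&` h @^-1` `]-oo, 0]); last first.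
    by rewrite setTI; apply/seteqP; split=> z; rewrite /N /= in_itv.
  by apply: mh => //; exact: measurable_itv.
have piN : pi N = 0%E.
  apply/eqP; rewrite eq_le measure_ge0 andbT.
  have -> : pi N = (\int[rho]_(x in N) D x)%E.
    exact: (@Radon_Nikodym_integral _ _ _ (charge_of_finite_measure pi) rho N dom mN).
  apply: (@le_trans _ _ (\int[rho]_(x in N) 0)%E); last by rewrite integral0.
  apply: le_integral => //.
  - by apply: (integrableS measurableT) => //; exact: Radon_Nikodym_integrable.
  - exact: integrable0.
  - by move=> z; rewrite inE => Nz; rewrite -/D DE lee_fin.
(* f is e^zeta / h, made total where the density vanishes *)
pose f z := if 0 < h z then expR (zeta z - ln (h z)) else 0.
have f0 z : 0 <= f z by rewrite /f; case: ifPn => // h0; exact: expR_ge0.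
have mf : measurable_fun setT f.
  apply: measurable_fun_ifT => //.
  have mzl : measurable_fun setT (fun z => zeta z - ln (h z)).
    by apply: measurable_funB => //; exact: bmeas_measurable.
  by apply: measurableT_comp mzl; exact: measurable_expR.
have mfE : measurable_fun setT (fun z => (f z)%:E) by exact/measurable_EFinP.
have int_f : (\int[pi]_z (f z)%:E <= (Ex rho (fun z => expR (zeta z)))%:E)%E.
  rewrite -(Radon_Nikodym_SigmaFinite.change_of_variables dom (f := EFin \o f)) => //.
  have aeD : ae_eq rho setT (Radon_Nikodym_SigmaFinite.f pi rho) D.
    exact: ae_eq_Radon_Nikodym_SigmaFinite.
  have mR : measurable_fun setT (Radon_Nikodym_SigmaFinite.f pi rho).
    by apply: (measurable_int rho); exact: Radon_Nikodym_SigmaFinite.f_integrable.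
  rewrite (ae_eq_integral (fun z => ((f z)%:E * D z)%E))//; last 3 first.
  - exact: emeasurable_funM.
  - exact: emeasurable_funM.
  - by apply: ae_eqe_mul2l.
  have fhE z : ((f z)%:E * D z = (if (0 < h z)%R then expR (zeta z) else 0)%:E)%E.
    rewrite DE -EFinM /f; case: ifPn => h0; last by rewrite mul0r.
    by rewrite expRB lnK ?posrE// divfK// gt_eqF.
  rewrite EFin_Ex//; apply: ge0_le_integral => //.
  - by move=> z _; rewrite fhE lee_fin; case: ifPn => // _; exact: expR_ge0.
  - exact: emeasurable_funM.
  - by apply/measurable_EFinP; exact: bmeas_measurable.
  - by move=> z _; rewrite fhE lee_fin; case: ifPn => // _; exact: expR_ge0.
have int_f_fin : (\int[pi]_z (f z)%:E)%E \is a fin_num.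
  rewrite ge0_fin_numE; last by apply: integral_ge0 => z _; rewrite lee_fin.
  exact: le_lt_trans int_f (ltry _).
have if_ : pi.-integrable setT (fun z => (f z)%:E).
  apply/integrableP; split=> //.
  under eq_integral do rewrite gee0_abs ?lee_fin//.
  exact: le_lt_trans int_f (ltry _).
have bz1 : bmeas (fun z => zeta z + 1) by apply: bmeasD => //; exact: bmeas_cst.
have iz1 := bmeas_integrable pi bz1.
pose u z := if 0 < h z then ln (h z) else zeta z + 1.
have mu : measurable_fun setT u.
  by apply: measurable_fun_ifT => //; exact: bmeas_measurable.
rewrite (ae_eq_integral (fun z => (u z)%:E))//; last 3 first.
- exact/measurable_EFinP.
- exact/measurable_EFinP.
- exists N; split=> // z /= zN; rewrite /N /=; rewrite leNgt; apply/negP => h0.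
  by apply: zN => _; rewrite /u h0.
apply: (@le_trans _ _ (\int[pi]_z ((zeta z + 1)%:E - (f z)%:E))%E); last first.
  apply: integral_ge_integrable.
  - exact/measurable_EFinP.
  - exact: integrableB.
  move=> z; rewrite -EFinB lee_fin /u /f; case: ifPn => h0; last by rewrite subr0.
  have := expR_ge1Dx (zeta z - ln (h z)).
  by move: (ln (h z)) => p; move: (expR _) => p'; lra.
rewrite integralB// -EFin_Ex// -(fineK int_f_fin) -EFinB lee_fin.
rewrite ExD ?Ex_cst//; last exact: bmeas_cst.
by rewrite lerB// -lee_fin fineK.
Qed.

End relative_entropy.

(** * Dual and primal bounds on the entropic transport cost *)

Section density.
Context {R : realType} dd (T : measurableType dd) (rho : probability T R).
Context (h : T -> R) (m : R).
Hypotheses (bh : bmeas h) (m0 : 0 < m) (mh : forall z, m <= h z).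
Hypothesis (h1 : Ex rho h = 1).
Local Open Scope charge_scope.

Let h0 z : 0 <= h z. Proof. exact: le_trans (ltW m0) (mh z). Qed.

Let mhE : measurable_fun setT (EFin \o h).
Proof. by apply/measurable_EFinP; exact: bmeas_measurable. Qed.

(** The hypotheses on the density are arguments, so that the structure of
    probability measure can be attached to this set function. *)
Definition dens_prob of bmeas h & 0 < m & (forall z, m <= h z) & Ex rho h = 1 :
    set T -> \bar R :=
  fun A => (\int[rho]_(z in A) (h z)%:E)%E.

Local Notation pi := (dens_prob bh m0 mh h1).

Let dens0 : pi set0 = 0%E.
Proof. by rewrite /dens_prob integral_set0. Qed.

Let dens_ge0 A : (0 <= pi A)%E.
Proof. by apply: integral_ge0 => z _; rewrite lee_fin. Qed.

Let dens_sigma : semi_sigma_additive pi.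
Proof.
move=> /= A mA tA mUA; rewrite /dens_prob integral_bigcup//=; last first.
  by apply: (integrableS _ _ (subsetT _)) => //; exact: bmeas_integrable.
apply: is_cvg_ereal_nneg_natsum_cond => n _ _.
by apply: integral_ge0 => z _; rewrite lee_fin.
Qed.

HB.instance Definition _ := isMeasure.Build _ _ _ pi dens0 dens_ge0 dens_sigma.

Let dens_setT : pi setT = 1%E.
Proof. by rewrite /dens_prob -EFin_Ex// h1. Qed.

HB.instance Definition _ := @Measure_isProbability.Build _ _ R pi dens_setT.

Definition dens : probability T R := pi.

Lemma dens_dominated : dens `<< rho.
Proof.
apply/null_content_dominatesP => A mA rhoA; rewrite /dens /dens_prob.
by apply: null_set_integral => //; exact: measurable_funTS.
Qed.

Lemma dens_RN : ae_eq rho setT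
  ('d (charge_of_finite_measure dens) '/d rho) (EFin \o h).
Proof.
have dom := dens_dominated.
apply: integral_ae_eq => //; first exact: Radon_Nikodym_integrable.
move=> A _ mA.
by rewrite -(@Radon_Nikodym_integral _ _ _ (charge_of_finite_measure dens) rho A dom mA).
Qed.

Lemma Ex_dens f : bmeas f -> Ex dens f = Ex rho (fun z => f z * h z).
Proof.
move=> bf; apply: EFin_inj; rewrite !EFin_Ex//; last exact: bmeasM.
have dom := dens_dominated.
rewrite -(Radon_Nikodym_change_of_variables dom measurableT (bmeas_integrable dens bf)).
apply: ae_eq_integral => //.
- apply: emeasurable_funM.
    by apply/measurable_EFinP; exact: bmeas_measurable.
  by apply: (measurable_int rho); exact: Radon_Nikodym_integrable.
- by apply/measurable_EFinP; apply: bmeas_measurable; exact: bmeasM.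
apply: filterS dens_RN => z /(_ I) e _.
by rewrite e /= EFinM.
Qed.

Lemma KL_dens : KL dens rho = (Ex rho (fun z => ln (h z) * h z))%:E.
Proof.
have dom := dens_dominated.
have bl : bmeas (fun z => ln (h z)) by exact: bmeas_ln m0 mh bh.
rewrite /KL asboolT// -Ex_dens// EFin_Ex//.
apply: ae_eq_integral => //.
- have mD : measurable_fun setT ('d (charge_of_finite_measure dens) '/d rho).
    by apply: (measurable_int rho); exact: Radon_Nikodym_integrable.
  apply/measurable_EFinP.
  apply: (measurableT_comp (f := @ln R)); first exact: measurable_ln.
  apply/measurable_EFinP.
  rewrite (_ : _ \o _ = 'd (charge_of_finite_measure dens) '/d rho)//.
  by apply/funext => z /=; rewrite fineK// Radon_Nikodym_fin_num.
- by apply/measurable_EFinP; exact: bmeas_measurable.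
apply: (null_dominates_ae_eq measurableT dom).
by apply: filterS dens_RN => z /(_ I) e _; rewrite e.
Qed.

End density.

Section eot_bounds.
Context {R : realType} {d : nat} (X : set (Rd R d)) (eps : R).
Context (c C : Rd R d * Rd R d -> R).
Hypotheses (mX : measurable X) (eps0 : 0 < eps).
Hypotheses (mc : measurable_fun setT c) (bC : bmeas C).
Hypothesis (cC : forall x y, X x -> X y -> c (x, y) = C (x, y)).
Implicit Types (nu : probability (Rd R d) R).

Lemma Ex_coupling1 nu1 nu2 pi f : couplings nu1 nu2 pi -> bmeas f ->
  Ex pi (fun z => f z.1) = Ex nu1 f.
Proof.
move=> cp bf; have bf1 := bmeas_fst (Rd R d) bf.
apply: EFin_inj; rewrite !EFin_Ex//.
have mf : measurable_fun setT (EFin \o f).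
  by apply/measurable_EFinP; exact: bmeas_measurable.
rewrite -(@integral_pushforward _ _ _ _ _ _ (@measurable_fst _ _ (Rd R d) (Rd R d)) pi setT (EFin \o f))//.
  apply: eq_measure_integral => A mA _.
  transitivity (pi (A `*` setT)); last exact: (proj1 (cp A mA)).
  rewrite /pushforward; congr (pi _).
  by apply/seteqP; split=> z //= -[].
exact: (bmeas_integrable pi bf1).
Qed.

Lemma Ex_coupling2 nu1 nu2 pi f : couplings nu1 nu2 pi -> bmeas f ->
  Ex pi (fun z => f z.2) = Ex nu2 f.
Proof.
move=> cp bf; have bf1 := bmeas_snd (Rd R d) bf.
apply: EFin_inj; rewrite !EFin_Ex//.
have mf : measurable_fun setT (EFin \o f).
  by apply/measurable_EFinP; exact: bmeas_measurable.
rewrite -(@integral_pushforward _ _ _ _ _ _ (@measurable_snd _ _ (Rd R d) (Rd R d)) pi setT (EFin \o f))//.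
  apply: eq_measure_integral => A mA _.
  transitivity (pi (setT `*` A)); last exact: (proj2 (cp A mA)).
  rewrite /pushforward; congr (pi _).
  by apply/seteqP; split=> z //= -[].
exact: (bmeas_integrable pi bf1).
Qed.

(** A coupling of measures carried by [X] is carried by [X `*` X], where [c]
    and [C] agree; [C] is bounded whereas [c] need not be. *)
Lemma coupling_cost nu1 nu2 pi : couplings nu1 nu2 pi ->
  prob_on X nu1 -> prob_on X nu2 ->
  (\int[pi]_z (c z)%:E)%E = (Ex pi C)%:E.
Proof.
move=> cp n1 n2; rewrite EFin_Ex//.
pose N := (~` X `*` setT) `|` (setT `*` ~` X) : set (Rd R d * Rd R d).
have mN : measurable N.
  apply: measurableU; apply: measurableX => //; exact: measurableC.
have nX nu : prob_on X nu -> nu (~` X) = 0%E.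
  by move=> nuX; rewrite probability_setC// nuX subee.
apply: ae_eq_integral => //.
- exact/measurable_EFinP.
- by apply/measurable_EFinP; exact: bmeas_measurable.
exists N; split=> //.
  apply/eqP; rewrite eq_le measure_ge0 andbT.
  apply: le_trans (measureU2 _ _ _) _.
  - by apply: measurableX => //; exact: measurableC.
  - by apply: measurableX => //; exact: measurableC.
  have [h1 _] := cp _ (measurableC mX); have [_ h2] := cp _ (measurableC mX).
  have e1 : (pi (~` X `*` setT) <= 0)%E by rewrite h1 (nX _ n1).
  have e2 : (pi (setT `*` ~` X) <= 0)%E by rewrite h2 (nX _ n2).
  by apply: le_trans (leeD e1 e2) _; rewrite adde0.
move=> [x y] /= h; apply: contrapT => hN; apply: h => _.
rewrite cC//.
  by apply: contrapT => nx; apply: hN; left.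
by apply: contrapT => ny; apply: hN; right.
Qed.

(** Weak duality: [gibbs_le_KL] with the exponent [(phi + psi - C) / eps]. *)
Lemma eot_ge nu1 nu2 (phi psi : Rd R d -> R) : bmeas phi -> bmeas psi ->
  prob_on X nu1 -> prob_on X nu2 ->
  ((Ex nu1 phi + Ex nu2 psi + eps -
    eps * Ex (nu1 \x nu2)%E
      (fun z => expR ((phi z.1 + psi z.2 - C z) / eps)))%:E <= eot c eps nu1 nu2)%E.
Proof.
move=> bphi bpsi n1 n2; apply: le_ereal_inf_tmp => _ [pi cp <-].
pose zeta z := (phi z.1 + psi z.2 - C z) / eps.
have [b1 b2] := (bmeas_fst (Rd R d) bphi, bmeas_snd (Rd R d) bpsi).
have bz' : bmeas (fun z => phi z.1 + psi z.2 - C z).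
  by apply: bmeasB => //; exact: bmeasD.
have bz : bmeas zeta.
  by apply: bmeasM => //; exact: bmeas_cst.
have e : Ex nu1 phi + Ex nu2 psi = Ex pi C + eps * Ex pi zeta.
  rewrite -(Ex_coupling1 cp bphi) -(Ex_coupling2 cp bpsi) -ExZ//.
  rewrite -ExD// -ExD//; last exact: bmeasZ.
  congr Ex; apply/funext => z; rewrite /zeta mulrCA divff ?gt_eqF//.
  by rewrite mulr1; ring.
rewrite (coupling_cost cp n1 n2).
have := gibbs_le_KL pi (nu1 \x nu2)%E bz.
move=> /(lee_wpmul2l (_ : (0 <= eps%:E)%E)); rewrite lee_fin => /(_ (ltW eps0)) hKL.
rewrite e; apply: le_trans (leeD2l (Ex pi C)%:E hKL).
rewrite -EFinM -EFinD lee_fin.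
by rewrite mulrBr mulrDr mulr1 !addrA.
Qed.

(** The cost of the coupling with density [h]. *)
Lemma eot_le nu1 nu2 (h : Rd R d * Rd R d -> R) (m : R) :
  bmeas h -> 0 < m -> (forall z, m <= h z) ->
  (forall x, Ex nu2 (fun y => h (x, y)) = 1) ->
  (forall y, Ex nu1 (fun x => h (x, y)) = 1) ->
  prob_on X nu1 -> prob_on X nu2 ->
  (eot c eps nu1 nu2 <=
   (Ex (nu1 \x nu2)%E (fun z => (C z + eps * ln (h z)) * h z))%:E)%E.
Proof.
move=> bh m0 mh h1 h2 n1 n2.
have hmass : Ex (nu1 \x nu2)%E h = 1.
  by rewrite Ex_prod1//; under [X in Ex nu1 X]funext do rewrite h1; rewrite Ex_cst.
pose pi := dens bh m0 mh hmass.
have piE A : measurable A -> pi A = (Ex (nu1 \x nu2)%E (fun z => \1_A z * h z))%:E.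
  move=> mA; have bA : bmeas (\1_A : Rd R d * Rd R d -> R).
    split; first exact: measurable_indic.
    by exists 1 => z; rewrite indicE; case: (_ \in _); rewrite ?normr1 ?normr0.
  by rewrite -(Ex_dens bh m0 mh hmass bA) EFin_Ex// integral_indic// setIT.
have b1 (A : set (Rd R d)) : measurable A -> bmeas (\1_A : Rd R d -> R).
  move=> mA; split; first exact: measurable_indic.
  by exists 1 => z; rewrite indicE; case: (_ \in _); rewrite ?normr1 ?normr0.
have nuE (nu : probability (Rd R d) R) A : measurable A -> nu A = (Ex nu \1_A)%:E.
  by move=> mA; rewrite (EFin_Ex nu (b1 A mA)) integral_indic// setIT.
have cp : couplings nu1 nu2 pi.
  move=> A mA; split.
  - rewrite piE; last exact: measurableX.
    rewrite nuE//; congr EFin; rewrite Ex_prod1; last first.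
      apply: bmeasM => //; rewrite (_ : \1_(A `*` setT) = (fun z => \1_A z.1)).
        exact: (bmeas_fst (Rd R d) (b1 A mA)).
      by apply/funext => -[x y]; rewrite !indicE in_setX in_setT andbT.
    congr Ex; apply/funext => x.
    rewrite (_ : (fun y => _) = (fun y => \1_A x * h (x, y))); last first.
      by apply/funext => y; rewrite !indicE in_setX in_setT andbT.
    by rewrite ExZ ?h1 ?mulr1//; exact: bmeas_sec1.
  - rewrite piE; last exact: measurableX.
    rewrite nuE//; congr EFin; rewrite Ex_prod2; last first.
      apply: bmeasM => //; rewrite (_ : \1_(setT `*` A) = (fun z => \1_A z.2)).
        exact: (bmeas_snd (Rd R d) (b1 A mA)).
      by apply/funext => -[x y]; rewrite !indicE in_setX in_setT.
    congr Ex; apply/funext => y.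
    rewrite (_ : (fun x => _) = (fun x => \1_A y * h (x, y))); last first.
      by apply/funext => x; rewrite !indicE in_setX in_setT.
    by rewrite ExZ ?h2 ?mulr1//; exact: bmeas_sec2.
apply: ge_ereal_inf; exists ((\int[pi]_z (c z)%:E)%E + eps%:E * KL pi (nu1 \x nu2))%E.
  by exists pi.
have bl : bmeas (fun z => ln (h z)) by exact: bmeas_ln m0 mh bh.
rewrite (coupling_cost cp n1 n2) KL_dens Ex_dens// -EFinM -EFinD lee_fin.
rewrite -ExZ; last exact: bmeasM.
rewrite -ExD; last 2 first.
- exact: bmeasM.
- by apply: bmeasZ; exact: bmeasM.
rewrite le_eqVlt; apply/orP; left; apply/eqP; congr Ex; apply/funext => z.
by ring.
Qed.

End eot_bounds.

(** * Third-order accurate bounds on the entropic transport cost *)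

Section expansion.
Context {R : realType} {d : nat} (X : set (Rd R d)) (eps : R).
Context (c C : Rd R d * Rd R d -> R).
Hypotheses (mX : measurable X) (eps0 : 0 < eps).
Hypotheses (mc : measurable_fun setT c) (bC : bmeas C).
Hypothesis (cC : forall x y, X x -> X y -> c (x, y) = C (x, y)).
Context (mu : probability (Rd R d) R) (u : Rd R d -> R) (k : Rd R d * Rd R d -> R).
Context (um del K : R).
Hypotheses (bu : bmeas u) (um0 : 0 < um) (u_ge : forall x, um <= u x).
Hypothesis (kE : forall z, k z = u z.1 * u z.2 * expR (- (C z / eps))).
Hypotheses (bk : bmeas k) (del0 : 0 < del) (k_ge : forall z, del <= k z).
Hypothesis (k_le : forall z, k z <= K).
Hypothesis (k_sym : forall x y, k (x, y) = k (y, x)).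

Definition lpot x : R := eps * ln (u x).

Lemma bmeas_lpot : bmeas lpot.
Proof. by apply: bmeasZ; exact: bmeas_ln um0 u_ge bu. Qed.

Let k0 z : 0 < k z. Proof. exact: lt_le_trans (k_ge z). Qed.

Let K0 : 0 <= K.
Proof. exact: le_trans (ltW (k0 (point, point))) (k_le _). Qed.

(** Complementary slackness for the pair [(mu, mu)]: [k] is the density of the
    optimal plan and [lpot] is an optimal dual potential. *)
Lemma ln_kernel z : C z + eps * ln (k z) = lpot z.1 + lpot z.2.
Proof.
have u0 x : 0 < u x by exact: lt_le_trans (u_ge x).
rewrite kE !lnM ?posrE ?mulr_gt0 ?expR_gt0// expRK /lpot.
by move: (ln (u z.1)) (ln (u z.2)) => a b; field; rewrite gt_eqF.
Qed.

Section pair.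
Context (nu1 nu2 : probability (Rd R d) R) (A1 A2 phi psi : Rd R d -> R) (b : R).
Hypothesis (A1E : forall x, A1 x = Ex nu1 (fun y => k (x, y)) - 1).
Hypothesis (A2E : forall x, A2 x = Ex nu2 (fun y => k (x, y)) - 1).
Hypothesis (sol : linsys mu k A1 A2 phi psi).
Hypotheses (b0 : 0 <= b) (A1b : forall x, `|A1 x| <= b) (A2b : forall x, `|A2 x| <= b).
Hypotheses (phib : forall x, `|phi x| <= b) (psib : forall x, `|psi x| <= b).
Hypothesis (R2b : forall x, `|kop nu2 k psi x - kop mu k psi x| <= b ^+ 2).
Hypothesis (R1b : forall x, `|kop nu1 k phi x - kop mu k phi x| <= b ^+ 2).
Hypothesis (P1b : `|Ex nu1 (fun x => phi x * A2 x) - Ex mu (fun x => phi x * A2 x)|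
   <= b ^+ 3).
Hypothesis (P2b : `|Ex nu2 (fun x => psi x * A1 x) - Ex mu (fun x => psi x * A1 x)|
   <= b ^+ 3).

Let rho := (nu1 \x nu2)%E.
Let s z := phi z.1 + psi z.2.
Let Bv := Ex nu1 A2.
Let qv := - Ex mu (fun x => phi x * A2 x) - Ex mu (fun x => psi x * A1 x).
Let qr := Ex rho (fun z => k z * s z ^+ 2).

Let bphi : bmeas phi. Proof. by case: sol. Qed.
Let bpsi : bmeas psi. Proof. by case: sol. Qed.
Let bks1 (nu : probability (Rd R d) R) : bmeas (fun x => Ex nu (fun y => k (x, y))).
Proof. exact: bmeas_Ex1. Qed.
Let bA1 : bmeas A1.
Proof.
rewrite (_ : A1 = fun x => Ex nu1 (fun y => k (x, y)) - 1); last exact/funext.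
by apply: bmeasB => //; exact: bmeas_cst.
Qed.
Let bA2 : bmeas A2.
Proof.
rewrite (_ : A2 = fun x => Ex nu2 (fun y => k (x, y)) - 1); last exact/funext.
by apply: bmeasB => //; exact: bmeas_cst.
Qed.

Let Ek_fst (f : Rd R d -> R) : bmeas f ->
  Ex rho (fun z => k z * f z.1) = Ex nu1 f + Ex nu1 (fun x => f x * A2 x).
Proof.
move=> bf; rewrite Ex_prod1; last by apply: bmeasM => //; exact: bmeas_fst.
rewrite -ExD//; last exact: bmeasM.
congr Ex; apply/funext => x /=; under [X in Ex nu2 X]funext do rewrite mulrC.
by rewrite ExZ ?A2E; [ring|exact: bmeas_sec1].
Qed.

Let Ek_snd (f : Rd R d -> R) : bmeas f ->
  Ex rho (fun z => k z * f z.2) = Ex nu2 f + Ex nu2 (fun x => f x * A1 x).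
Proof.
move=> bf; rewrite Ex_prod2; last by apply: bmeasM => //; exact: bmeas_snd.
rewrite -ExD//; last exact: bmeasM.
congr Ex; apply/funext => x /=; under [X in Ex nu1 X]funext do rewrite mulrC k_sym.
by rewrite ExZ ?A1E; [ring|exact: bmeas_sec1].
Qed.

Let Ek : Ex rho k = 1 + Bv.
Proof.
have := Ek_fst (bmeas_cst _ 1); rewrite Ex_cst.
rewrite (_ : (fun z => k z * 1) = k); last by apply/funext => z; rewrite mulr1.
by rewrite (_ : (fun x => 1 * A2 x) = A2)//; apply/funext => z; rewrite mul1r.
Qed.

Let Ek_cross1 : Ex rho (fun z => k z * (phi z.1 * psi z.2)) =
  Ex nu1 (fun x => phi x * kop nu2 k psi x).
Proof.
rewrite Ex_prod1; last first.
  by apply: bmeasM => //; apply: bmeasM; [exact: bmeas_fst|exact: bmeas_snd].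
congr Ex; apply/funext => x /=; rewrite kopE -ExZ; last exact: bmeas_sec_mul.
by congr Ex; apply/funext => y; ring.
Qed.

Let Ek_cross2 : Ex rho (fun z => k z * (phi z.1 * psi z.2)) =
  Ex nu2 (fun x => psi x * kop nu1 k phi x).
Proof.
rewrite Ex_prod2; last first.
  by apply: bmeasM => //; apply: bmeasM; [exact: bmeas_fst|exact: bmeas_snd].
congr Ex; apply/funext => x /=; rewrite kopE -ExZ; last exact: bmeas_sec_mul.
by congr Ex; apply/funext => y; rewrite (k_sym x y); ring.
Qed.

(** Expanding the square gives two squares and twice a cross term.  One copy of
    the cross term is evaluated with the equation for [phi], the other with the
    equation for [psi]; each cancels one of the squares and leaves integrals of
    [phi A2] and [psi A1].  Replacing [nu1], [nu2] by [mu] there is an error of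
    third order. *)
Lemma quadratic_value : `|qr - qv| <= 6 * b ^+ 3.
Proof.
have bp2 := bmeasX 2 bphi; have bs2 := bmeasX 2 bpsi.
have bph := bmeas_fst (Rd R d) bphi; have bps := bmeas_snd (Rd R d) bpsi.
have bcr : bmeas (fun z : Rd R d * Rd R d => phi z.1 * psi z.2) by exact: bmeasM.
have [_ _ _ e1 e2] := sol.
pose r2 x := kop nu2 k psi x - kop mu k psi x.
pose r1 x := kop nu1 k phi x - kop mu k phi x.
have br2 : bmeas r2 by apply: bmeasB; exact: bmeas_kop.
have br1 : bmeas r1 by apply: bmeasB; exact: bmeas_kop.
have qrE : qr = Ex rho (fun z => k z * phi z.1 ^+ 2) +
    Ex rho (fun z => k z * psi z.2 ^+ 2) +
    Ex rho (fun z => k z * (phi z.1 * psi z.2)) +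
    Ex rho (fun z => k z * (phi z.1 * psi z.2)).
  have b1 : bmeas (fun z => k z * phi z.1 ^+ 2) by apply: bmeasM => //; exact: bmeasX.
  have b2 : bmeas (fun z => k z * psi z.2 ^+ 2) by apply: bmeasM => //; exact: bmeasX.
  have b3 : bmeas (fun z => k z * (phi z.1 * psi z.2)) by exact: bmeasM.
  rewrite -ExD// -ExD//; last exact: bmeasD.
  rewrite -ExD//; last by apply: bmeasD => //; exact: bmeasD.
  by congr Ex; apply/funext => z; rewrite /s; ring.
have c1 : Ex rho (fun z => k z * (phi z.1 * psi z.2)) =
    - Ex nu1 (fun x => phi x * A2 x) - Ex nu1 (fun x => phi x ^+ 2) +
    Ex nu1 (fun x => phi x * r2 x).
  have [b1 b3] := (bmeasM bphi bA2, bmeasM bphi br2).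
  rewrite Ek_cross1 -(ExN _ b1) -(ExB _ (bmeasN b1) bp2).
  rewrite -(ExD _ (bmeasB (bmeasN b1) bp2) b3).
  congr Ex; apply/funext => x; have := e1 x; rewrite /r2.
  move=> /(congr1 (fun y => phi x * y)).
  by lra.
have c2 : Ex rho (fun z => k z * (phi z.1 * psi z.2)) =
    - Ex nu2 (fun x => psi x * A1 x) - Ex nu2 (fun x => psi x ^+ 2) +
    Ex nu2 (fun x => psi x * r1 x).
  have [b1 b3] := (bmeasM bpsi bA1, bmeasM bpsi br1).
  rewrite Ek_cross2 -(ExN _ b1) -(ExB _ (bmeasN b1) bs2).
  rewrite -(ExD _ (bmeasB (bmeasN b1) bs2) b3).
  congr Ex; apply/funext => x; have := e2 x; rewrite /r1.
  move=> /(congr1 (fun y => psi x * y)).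
  by lra.
have := Ek_fst bp2; have := Ek_snd bs2 => h2 h1.
have cube (f g : Rd R d -> R) (nu : probability (Rd R d) R) (i j : nat) :
    bmeas f -> bmeas g -> (forall x, `|f x| <= b ^+ i) -> (forall x, `|g x| <= b ^+ j) ->
    `|Ex nu (fun x => f x * g x)| <= b ^+ (i + j).
  move=> bf bg fb gb; apply: Ex_norm_le; first exact: bmeasM.
  by move=> x; rewrite normrM exprD ler_pM.
have sq (f : Rd R d -> R) : (forall x, `|f x| <= b) -> forall x, `|f x ^+ 2| <= b ^+ 2.
  by move=> fb x; rewrite normrX ler_pXn2r// nnegrE.
have t1 := cube _ _ nu1 2%N 1%N bp2 bA2 (sq _ phib) A2b.
have t2 := cube _ _ nu2 2%N 1%N bs2 bA1 (sq _ psib) A1b.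
have t3 := cube _ _ nu1 1%N 2%N bphi br2 phib R2b.
have t4 := cube _ _ nu2 1%N 2%N bpsi br1 psib R1b.
rewrite qrE {1}c1 c2 h1 h2 /qv.
move: t1 t2 t3 t4 P1b P2b; rewrite /= !ler_norml.
move: (Ex nu1 (fun x => phi x * A2 x)) (Ex nu2 (fun x => psi x * A1 x)).
move: (Ex mu (fun x => phi x * A2 x)) (Ex mu (fun x => psi x * A1 x)).
move: (Ex nu1 (fun x => phi x ^+ 2 * A2 x)) (Ex nu2 (fun x => psi x ^+ 2 * A1 x)).
move: (Ex nu1 (fun x => phi x ^+ 2)) (Ex nu2 (fun x => psi x ^+ 2)).
move: (Ex nu1 (fun x => phi x * r2 x)) (Ex nu2 (fun x => psi x * r1 x)) (b ^+ 3).
move=> {c1 c2 h1 h2 qrE} ? ? ? ? ? ? ? ? ? ? ?.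
move=> /andP[? ?] /andP[? ?] /andP[? ?] /andP[? ?] /andP[? ?] /andP[? ?].
by apply/andP; split; lra.
Qed.

Let bsz : bmeas s.
Proof. by apply: bmeasD; [exact: bmeas_fst|exact: bmeas_snd]. Qed.

Let s2b z : `|s z| <= 2 * b.
Proof.
apply: le_trans (ler_normD _ _) _.
by have := phib z.1; have := psib z.2; lra.
Qed.

Let bqr : bmeas (fun z => k z * s z ^+ 2).
Proof. by apply: bmeasM => //; exact: bmeasX. Qed.

(** Weak duality with the potentials [lpot + eps phi] and [lpot + eps psi]: the
    exponential integral becomes [\int k e^(phi + psi)], which is expanded to
    second order. *)
Lemma eot_lower : prob_on X nu1 -> prob_on X nu2 -> 4 * b <= 1 ->
  ((Ex nu1 lpot + Ex nu2 lpot +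
    eps * (- Bv + qv / 2 - (16 * K + 9) * b ^+ 3))%:E <= eot c eps nu1 nu2)%E.
Proof.
move=> n1 n2 b1.
have bl := bmeas_lpot.
have bz f g : bmeas f -> bmeas g -> bmeas (fun x : Rd R d => f x + eps * g x).
  by move=> bf bg; apply: bmeasD => //; exact: bmeasZ.
have := eot_ge mX eps0 mc bC cC (bz _ _ bl bphi) (bz _ _ bl bpsi) n1 n2.
apply: le_trans; rewrite lee_fin.
rewrite (ExD _ bl (bmeasZ eps bphi)) (ExD _ bl (bmeasZ eps bpsi)).
rewrite (ExZ _ _ bphi) (ExZ _ _ bpsi).
have eE : (fun z => expR ((lpot z.1 + eps * phi z.1 + (lpot z.2 + eps * psi z.2) - C z)
    / eps)) = (fun z => k z * expR (s z)).
  apply/funext => z; rewrite -[in RHS](@lnK _ (k z)) ?posrE// -expRD; congr expR.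
  have := ln_kernel z; move: (ln (k z)) => l hl.
  have -> : lpot z.1 = C z + eps * l - lpot z.2 by rewrite hl addrK.
  by rewrite /s; field; rewrite gt_eqF.
rewrite eE.
have hexp : Ex rho (fun z => k z * expR (s z)) <=
    (1 + Bv) + (Ex nu1 phi + Ex nu1 (fun x => phi x * A2 x)) +
    (Ex nu2 psi + Ex nu2 (fun x => psi x * A1 x)) + 2^-1 * qr + 16 * K * b ^+ 3.
  have bf := bmeasM bk (bmeas_fst (Rd R d) bphi).
  have bs := bmeasM bk (bmeas_snd (Rd R d) bpsi).
  have b4 := bmeas_cst (Rd R d * Rd R d)%type (16 * K * b ^+ 3).
  have b2 := bmeasZ 2^-1 bqr.
  rewrite -(Ek_fst bphi) -(Ek_snd bpsi) -Ek -(ExZ _ _ bqr).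
  rewrite -[16 * K * b ^+ 3](Ex_cst rho (16 * K * b ^+ 3)).
  rewrite -(ExD _ bk bf) -(ExD _ (bmeasD bk bf) bs).
  rewrite -(ExD _ (bmeasD (bmeasD bk bf) bs) b2).
  rewrite -(ExD _ (bmeasD (bmeasD (bmeasD bk bf) bs) b2) b4).
  apply: Ex_le.
  - by apply: bmeasM => //; exact: bmeas_expR.
  - by do !apply: bmeasD.
  move=> z; have z2 : `|s z| <= 2^-1 by have := s2b z; lra.
  have := expR_taylor2 z2; rewrite ler_norml => /andP[_ h].
  have h3 : `|s z| ^+ 3 <= 8 * b ^+ 3.
    have : `|s z| ^+ 3 <= (2 * b) ^+ 3 by rewrite lerXn2r// nnegrE mulr_ge0.
    by rewrite exprMn; lra.
  have h4 : expR (s z) <= 1 + s z + s z ^+ 2 / 2 + 16 * b ^+ 3.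
    by move: (expR _) h => e h; lra.
  have h5 := ler_wpM2l (ltW (k0 z)) h4.
  have h6 : k z * (16 * b ^+ 3) <= K * (16 * b ^+ 3).
    by rewrite ler_wpM2r ?k_le// mulr_ge0// exprn_ge0.
  by move: (expR _) h5 => e h5; rewrite /s in h5 *; lra.
have hq := quadratic_value; move: hq; rewrite ler_norml => /andP[hq hq'].
move: P1b P2b; rewrite !ler_norml => /andP[p1 p1'] /andP[p2 p2'].
have hb3 : 0 <= b ^+ 3 by exact: exprn_ge0.
rewrite -/rho.
have key : - Bv + qv / 2 - (16 * K + 9) * b ^+ 3 <=
    Ex nu1 phi + Ex nu2 psi + 1 - Ex rho (fun z => k z * expR (s z)).
  move: hexp hq hq' p1 p1' p2 p2'; rewrite /qv.
  move: (Ex nu1 (fun x => phi x * A2 x)) (Ex nu2 (fun x => psi x * A1 x)).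
  move: (Ex mu (fun x => phi x * A2 x)) (Ex mu (fun x => psi x * A1 x)).
  move: (Ex rho (fun z => k z * expR (s z))) (Ex nu1 phi) (Ex nu2 psi) => p p' p''.
  move: qr Bv (b ^+ 3) hb3 => q B' b3 {eE} *; lra.
by have := ler_wpM2l (ltW eps0) key; lra.
Qed.

(** Constants of [eot_upper]: the coupling is [k (1 + w)] with
    [|w| <= slope * b], and [upper_const * b ^+ 3] bounds the excess of its
    entropy density over [k w + k (phi + psi)^2 / 2]. *)
Definition slope : R := 2 + 6 / del.
Definition upper_const : R := K * (3 / del * (slope + 2) + 4 * slope ^+ 3).

(** The density [k (1 + phi + psi)] has the marginal densities [1 - e1] and
    [1 - e2], with [e1] and [e2] of second order by the linearized system.
    Adding [e1(x) + e2(y) - m], where [m] is the common mean of [e1] and [e2],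
    makes the marginals exact; since it is of second order, it changes the
    entropy by a term of third order only. *)
Lemma eot_upper : prob_on X nu1 -> prob_on X nu2 -> b <= 1 -> 2 * (slope * b) <= 1 ->
  (eot c eps nu1 nu2 <= (Ex nu1 lpot + Ex nu2 lpot +
    eps * (- Bv + qv / 2 + (upper_const + 3) * b ^+ 3))%:E)%E.
Proof.
move=> n1 n2 b1 Lb1.
have [_ _ _ sol1 sol2] := sol.
pose r2 x := kop nu2 k psi x - kop mu k psi x.
pose r1 x := kop nu1 k phi x - kop mu k phi x.
have br2 : bmeas r2 by apply: bmeasB; exact: bmeas_kop.
have br1 : bmeas r1 by apply: bmeasB; exact: bmeas_kop.
pose e1 x := - (phi x * A2 x + r2 x).
pose e2 x := - (psi x * A1 x + r1 x).
have be1 : bmeas e1 by apply: bmeasN; apply: bmeasD => //; exact: bmeasM.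
have be2 : bmeas e2 by apply: bmeasN; apply: bmeasD => //; exact: bmeasM.
have e1b x : `|e1 x| <= 2 * b ^+ 2.
  rewrite normrN; apply: le_trans (ler_normD _ _) _.
  have : `|phi x * A2 x| <= b ^+ 2 by rewrite normrM expr2 ler_pM.
  by have := R2b x; rewrite -/(r2 x); lra.
have e2b x : `|e2 x| <= 2 * b ^+ 2.
  rewrite normrN; apply: le_trans (ler_normD _ _) _.
  have : `|psi x * A1 x| <= b ^+ 2 by rewrite normrM expr2 ler_pM.
  by have := R1b x; rewrite -/(r1 x); lra.
pose mm := Ex nu1 e1.
have mmb : `|mm| <= 2 * b ^+ 2 by exact: Ex_norm_le.
pose g z := k z * (1 + s z).
have bg : bmeas g by apply: bmeasM => //; apply: bmeasD => //; exact: bmeas_cst.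
have marg1 x : Ex nu2 (fun y => g (x, y)) = 1 - e1 x.
  have bkx : bmeas (fun y => k (x, y)) by exact: bmeas_sec1.
  have -> : Ex nu2 (fun y => g (x, y)) =
      (1 + phi x) * Ex nu2 (fun y => k (x, y)) + kop nu2 k psi x.
    rewrite kopE -ExZ// -ExD//; last 2 first.
    - exact: bmeasZ.
    - exact: bmeasM.
    by congr Ex; apply/funext => y; rewrite /g /s; ring.
  have := A2E x; have := sol1 x; rewrite /e1 /r2.
  move: (Ex _ _) (kop mu k psi x) (kop nu2 k psi x) => v v1 v2 h1 h2.
  have -> : v = 1 + A2 x by rewrite h2; ring.
  have -> : v1 = - A2 x - phi x by rewrite -h1; ring.
  by ring.
have marg2 y : Ex nu1 (fun x => g (x, y)) = 1 - e2 y.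
  have bkx : bmeas (fun x => k (y, x)) by exact: bmeas_sec1.
  have -> : Ex nu1 (fun x => g (x, y)) =
      (1 + psi y) * Ex nu1 (fun x => k (y, x)) + kop nu1 k phi y.
    rewrite kopE -ExZ// -ExD//; last 2 first.
    - exact: bmeasZ.
    - exact: bmeasM.
    by congr Ex; apply/funext => x; rewrite /g /s (k_sym x y) /=; ring.
  have := A1E y; have := sol2 y; rewrite /e2 /r1.
  move: (Ex _ _) (kop mu k phi y) (kop nu1 k phi y) => v v1 v2 h1 h2.
  have -> : v = 1 + A1 y by rewrite h2; ring.
  have -> : v1 = - A1 y - psi y by rewrite -h1; ring.
  by ring.
have mmE : Ex nu2 e2 = mm.
  have := Ex_swap nu1 nu2 bg.
  rewrite (_ : (fun x => Ex nu2 _) = fun x => 1 - e1 x); last exact/funext.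
  rewrite (_ : (fun y => Ex nu1 _) = fun y => 1 - e2 y); last exact/funext.
  rewrite !ExB ?Ex_cst//; try exact: bmeas_cst.
  by rewrite -/mm; lra.
pose h z := g z + (e1 z.1 + e2 z.2 - mm).
have b12 : bmeas (fun z : Rd R d * Rd R d => e1 z.1 + e2 z.2 - mm).
  apply: bmeasB; last exact: bmeas_cst.
  by apply: bmeasD; [exact: bmeas_fst|exact: bmeas_snd].
have bh : bmeas h by exact: bmeasD.
have h1 x : Ex nu2 (fun y => h (x, y)) = 1.
  have bgx : bmeas (fun y => g (x, y)) by exact: bmeas_sec1.
  have bc : bmeas (fun _ : Rd R d => e1 x - mm) by exact: bmeas_cst.
  rewrite (_ : (fun y => h (x, y)) = (fun y => g (x, y) + (e2 y + (e1 x - mm)))).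
    rewrite (ExD _ bgx (bmeasD be2 bc)) (ExD _ be2 bc) Ex_cst marg1 mmE; ring.
  by apply/funext => y; rewrite /h /=; ring.
have h2 y : Ex nu1 (fun x => h (x, y)) = 1.
  have bgx : bmeas (fun x => g (x, y)) by exact: bmeas_sec2.
  have bc : bmeas (fun _ : Rd R d => e2 y - mm) by exact: bmeas_cst.
  rewrite (_ : (fun x => h (x, y)) = (fun x => g (x, y) + (e1 x + (e2 y - mm)))).
    rewrite (ExD _ bgx (bmeasD be1 bc)) (ExD _ be1 bc) Ex_cst marg2 -/mm; ring.
  by apply/funext => x; rewrite /h /=; ring.
(* the corrected density in the form k (1 + w) *)
pose t z := (e1 z.1 + e2 z.2 - mm) / k z.
pose w z := s z + t z.
have hE z : h z = k z * (1 + w z).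
  rewrite /w /t /h /g; move: (_ - mm) => v.
  by field; rewrite gt_eqF.
have tb z : `|t z| <= 6 / del * b ^+ 2.
  rewrite /t normrM normfV (gtr0_norm (k0 z)) ler_pdivrMr//.
  have n6 : `|e1 z.1 + e2 z.2 - mm| <= 6 * b ^+ 2.
    apply: le_trans (ler_normB _ _) _; have := ler_normD (e1 z.1) (e2 z.2).
    by have := e1b z.1; have := e2b z.2; move: mmb; lra.
  apply: le_trans n6 _.
  have -> : 6 / del * b ^+ 2 * k z = 6 * b ^+ 2 * (k z / del) by ring.
  rewrite ler_peMr ?mulr_ge0 ?exprn_ge0//.
  by rewrite ler_pdivlMr// mul1r.
have del6 : 0 <= 6 / del by rewrite divr_ge0// ltW.
have b2b : b ^+ 2 <= b by rewrite expr2 ler_piMr.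
have wb z : `|w z| <= slope * b.
  apply: le_trans (ler_normD _ _) _.
  have := s2b z; have := tb z; have := ler_wpM2l del6 b2b.
  by rewrite /slope; move: (6 / del) => v; lra.
have w2 z : `|w z| <= 2^-1 by apply: le_trans (wb z) _; lra.
have w1 z : 2^-1 <= 1 + w z by have := w2 z; rewrite ler_norml => /andP[]; lra.
have hm z : del / 2 <= h z.
  rewrite hE; apply: ler_pM => //; exact: ltW.
have del2 : 0 < del / 2 by rewrite divr_gt0.
apply: le_trans (eot_le eps mX mc bC cC bh del2 hm h1 h2 n1 n2) _.
rewrite lee_fin -/rho.
have bl := bmeas_lpot.
have blh1 : bmeas (fun z => h z * lpot z.1) by apply: bmeasM => //; exact: bmeas_fst.
have blh2 : bmeas (fun z => h z * lpot z.2) by apply: bmeasM => //; exact: bmeas_snd.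
have El1 : Ex rho (fun z => h z * lpot z.1) = Ex nu1 lpot.
  rewrite Ex_prod1//; congr Ex; apply/funext => x /=.
  under [X in Ex nu2 X]funext do rewrite mulrC.
  by rewrite ExZ ?h1 ?mulr1//; exact: bmeas_sec1.
have El2 : Ex rho (fun z => h z * lpot z.2) = Ex nu2 lpot.
  rewrite Ex_prod2//; congr Ex; apply/funext => x /=.
  under [X in Ex nu1 X]funext do rewrite mulrC.
  by rewrite ExZ ?h2 ?mulr1//; exact: bmeas_sec2.
have Eh : Ex rho h = 1.
  by rewrite Ex_prod1//; under [X in Ex nu1 X]funext do rewrite h1; rewrite Ex_cst.
have pw z : (C z + eps * ln (h z)) * h z <= h z * lpot z.1 + h z * lpot z.2 +
    eps * (h z - k z + 2^-1 * (k z * s z ^+ 2) + upper_const * b ^+ 3).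
  have w10 : 0 < 1 + w z by apply: lt_le_trans (w1 z).
  have lnh : ln (h z) = ln (k z) + ln (1 + w z) by rewrite hE lnM ?posrE.
  have -> : (C z + eps * ln (h z)) * h z = h z * lpot z.1 + h z * lpot z.2 +
      eps * (k z * ((1 + w z) * ln (1 + w z))).
    have := ln_kernel z; rewrite lnh.
    move: (ln (k z)) (ln (1 + w z)) => p q hk.
    have -> : h z * lpot z.1 + h z * lpot z.2 = h z * (C z + eps * p).
      by rewrite hk; ring.
    by rewrite hE; ring.
  rewrite lerD2l; apply: ler_wpM2l; first exact: ltW.
  apply: le_trans (ler_wpM2l (ltW (k0 z)) (entropy_le (w2 z))) _.
  have -> : h z - k z = k z * w z by rewrite hE; ring.
  have w3 : `|w z| ^+ 3 <= slope ^+ 3 * b ^+ 3.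
    rewrite -exprMn lerXn2r// nnegrE mulr_ge0// /slope addr_ge0//.
  have ws : w z ^+ 2 <= s z ^+ 2 + 6 / del * (slope + 2) * b ^+ 3.
    have -> : w z ^+ 2 = s z ^+ 2 + t z * (w z + s z) by rewrite /w; ring.
    rewrite lerD2l; apply: le_trans (ler_norm _) _; rewrite normrM.
    have -> : 6 / del * (slope + 2) * b ^+ 3 =
      (6 / del * b ^+ 2) * (slope * b + 2 * b) by ring.
    apply: ler_pM => //; apply: le_trans (ler_normD _ _) _.
    exact: lerD.
  have kw : k z * (w z + w z ^+ 2 / 2 + 4 * `|w z| ^+ 3) <=
      k z * w z + 2^-1 * (k z * s z ^+ 2) +
      k z * ((3 / del * (slope + 2) + 4 * slope ^+ 3) * b ^+ 3).
    rewrite (_ : k z * w z + 2^-1 * (k z * s z ^+ 2) +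
        k z * ((3 / del * (slope + 2) + 4 * slope ^+ 3) * b ^+ 3) =
      k z * (w z + s z ^+ 2 / 2 +
        ((3 / del * (slope + 2) + 4 * slope ^+ 3) * b ^+ 3))); last by ring.
    rewrite ler_wpM2l//; first exact: ltW.
    have -> : 3 / del = 6 / del / 2 by field; rewrite gt_eqF.
    move: (6 / del) (slope) (`|w z| ^+ 3) w3 ws => p q v w3 ws.
    by lra.
  apply: le_trans kw _; rewrite lerD2l /upper_const -[K * _ * _]mulrA.
  have slope0 : 0 <= slope by rewrite /slope addr_ge0.
  have c10 : 0 <= 3 / del * (slope + 2) + 4 * slope ^+ 3.
    apply: addr_ge0; apply: mulr_ge0 => //; last exact: exprn_ge0.
    - by rewrite divr_ge0// ltW.
    - by rewrite addr_ge0.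
  apply: ler_wpM2r; last exact: k_le.
  exact: mulr_ge0 c10 (exprn_ge0 3 b0).
have bk2 := bmeasZ 2^-1 bqr.
have bcst := bmeas_cst (Rd R d * Rd R d)%type (upper_const * b ^+ 3).
have bhk := bmeasB bh bk.
have bR := bmeasD (bmeasD bhk bk2) bcst.
have bll := bmeasD blh1 blh2.
have bL : bmeas (fun z => (C z + eps * ln (h z)) * h z).
  apply: bmeasM => //; apply: bmeasD => //; apply: bmeasZ.
  exact: bmeas_ln del2 hm bh.
apply: le_trans (Ex_le rho bL (bmeasD bll (bmeasZ eps bR)) pw) _.
rewrite (ExD _ bll (bmeasZ eps bR)) (ExD _ blh1 blh2) (ExZ _ _ bR) El1 El2 lerD2l.
apply: ler_wpM2l; first exact: ltW.
rewrite (ExD _ (bmeasD bhk bk2) bcst) (ExD _ bhk bk2) (ExB _ bh bk) (ExZ _ _ bqr).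
rewrite Ex_cst Eh Ek -/qr.
have := quadratic_value; rewrite ler_norml => /andP[_].
by move: qr qv Bv (b ^+ 3) upper_const => ? ? ? ? ? ?; lra.
Qed.

End pair.
End expansion.

(** * Retraction onto the ball *)

Section ball_retraction.
Context {R : realType} {d : nat} (a : Rd R d) (r : {posnum R}).

Local Notation X := (closed_eball a r%:num).

Lemma eball_center : X a.
Proof.
rewrite /closed_eball /= subrr (_ : enorm 0 = 0) ?ltW//.
have := enormZ (0 : R) (0 : Rd R d).
by rewrite normr0 mul0r scaler0.
Qed.

Lemma eball_measurable : measurable X.
Proof. by apply: measurable_closed; exact: closed_eball_closed. Qed.

Lemma coord_le_enorm (x : Rd R d) i : `|x ord0 i| <= enorm x.
Proof.
rewrite /enorm -sqrtr_sqr ler_wsqrtr// (bigD1 i)//= lerDl.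
by apply: sumr_ge0 => j _; exact: sqr_ge0.
Qed.

Lemma eball_compact : compact X.
Proof.
apply: bounded_closed_compact; last exact: closed_eball_closed.
exists (`|a| + r%:num); split; first exact: num_real.
move=> M aM x Xx; apply: le_trans (ltW aM).
have -> : x = (x - a) + a by rewrite subrK.
apply: le_trans (ler_normD _ _) _; rewrite addrC lerD2l.
have -> : `|x - a| = mx_norm (x - a) by [].
rewrite mx_normrE; apply: bigmax_le => //.
move=> [i j] _ /=; rewrite (ord1 i).
exact: le_trans (coord_le_enorm (x - a) j) Xx.
Qed.

(** Being constant outside the ball it is not continuous; a Borel map is all that
    integration needs. *)
Definition retract (x : Rd R d) : Rd R d := if x \in X then x else a.

Lemma retract_in x : X (retract x).
Proof.
by rewrite /retract; case: ifPn => [/set_mem//|_]; exact: eball_center.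
Qed.

Lemma retract_id x : X x -> retract x = x.
Proof. by move=> Xx; rewrite /retract mem_set. Qed.

Lemma measurable_retract : measurable_fun setT retract.
Proof.
apply: measurable_fun_ifT => //.
apply: (measurable_fun_bool true).
rewrite setTI (_ : _ @^-1` _ = X); first exact: eball_measurable.
by apply/seteqP; split=> x /=; [move=> /set_mem|move=> /mem_set].
Qed.

Lemma bmeas_retract (F : Rd R d -> R) : continuous F ->
  bmeas (fun x => F (retract x)).
Proof.
move=> cF; have : compact (F @` X).
  by apply: continuous_compact; [exact: continuous_subspaceT|exact: eball_compact].
move=> /compact_bounded[M [_ MB]].
apply: (@bmeas_le _ _ _ _ (`|M| + 1)).
  by apply: (measurableT_comp (measurable_continuous cF)); exact: measurable_retract.
move=> x; apply: (MB (`|M| + 1)); first by rewrite ltr_pwDr// ler_norm.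
by exists (retract x) => //; exact: retract_in.
Qed.

Lemma bmeas_retract2 (F : Rd R d * Rd R d -> R) : continuous F ->
  bmeas (fun z => F (retract z.1, retract z.2)).
Proof.
move=> cF; have [M M0 FM] := bounded_on_square eball_compact cF.
apply: (@bmeas_le _ _ _ _ M); last by move=> z; apply: FM; exact: retract_in.
apply: (measurableT_comp (measurable_continuous_prod cF)).
apply/measurable_fun_pairP; split.
- exact: (measurableT_comp measurable_retract).
- exact: (measurableT_comp measurable_retract).
Qed.

Lemma Rintegral_ball (nu : probability (Rd R d) R) (g : Rd R d -> R) :
  prob_on X nu -> bmeas g -> \int[nu]_(x in X) g x = Ex nu g.
Proof.
move=> nuX bg; apply: EFin_inj; rewrite EFin_Ex//.
have mX := eball_measurable.
have mXc : measurable (~` X) by exact: measurableC.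
have nuXc : nu (~` X) = 0%E by rewrite probability_setC// nuX subee.
have ig := bmeas_integrable nu bg.
have := negligible_integral mXc measurableT ig nuXc.
rewrite setTD setCK => ->; rewrite /Rintegral fineK//.
exact: integrable_fin_num (integrableS measurableT mX (subsetT _) ig).
Qed.

End ball_retraction.

(** * Signed measures in the dual of C^s *)

Section dual_norm.
Context {R : realType} {d : nat} (a : Rd R d) (r : {posnum R}) (s : nat).

Local Notation X := (closed_eball a r%:num).
Local Notation p := (retract a r).
Local Notation E := (linf R (Cs_ball X s)).
Implicit Types (J : (Rd R d -> R) -> R) (F w : Rd R d -> R).

(** A bound on the norm in the dual of [C^s], tested on smooth functions
    only. *)
Definition ndual (b : R) J : Prop :=
  forall F (e : R), smooth F -> 0 <= e -> bnd X s e F -> `|J F| <= b * e.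

Lemma ndual1 b J : ndual b J -> forall F, smooth F -> bnd X s 1 F -> `|J F| <= b.
Proof. by move=> nJ F SF FB; have := nJ F 1 SF ler01 FB; rewrite mulr1. Qed.

(** Scaling to the unit ball; a bound [e = 0] is reached as a limit. *)
Lemma ndualS b J : bfunctional X J ->
  (forall F, smooth F -> bnd X s 1 F -> `|J F| <= b) -> ndual b J.
Proof.
move=> bJ J1 F e SF e0 Fe.
have b0 : 0 <= b.
  apply: le_trans (J1 (fun=> 0) (smooth_cst _) _) => //.
  by apply: (@bnd_le _ _ _ _ `|0|); [rewrite normr0|exact: bnd_cst].
have step e' : e < e' -> `|J F| <= b * e'.
  move=> ee; have e'0 : 0 < e' by exact: le_lt_trans ee.
  have n' : `|e'^-1| = e'^-1 by rewrite ger0_norm// invr_ge0 ltW.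
  have := J1 (fun y => e'^-1 * F y); rewrite (bfunctionalZ _ bJ); last first.
    exact: smooth_continuous.
  rewrite normrM n' ler_pdivrMl// [e' * b]mulrC; apply.
    by apply: smoothM => //; exact: smooth_cst.
  apply: bnd_le (bndZ _ SF Fe); rewrite n' ler_pdivrMl// mulr1.
  exact: ltW.
apply/ler_addgt0Pr => d' d0.
have b1 : 0 < b + 1 by rewrite ltr_wpDl.
have := step (e + d' / (b + 1)); rewrite ltrDl divr_gt0// => /(_ isT).
move=> /le_trans; apply; rewrite mulrDr lerD2l.
exact: scaled_le.
Qed.

Lemma ndual_le b b' J : b <= b' -> ndual b J -> ndual b' J.
Proof.
by move=> bb nJ F e SF e0 Fe; apply: le_trans (nJ F e SF e0 Fe) _; rewrite ler_wpM2r.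
Qed.

Lemma bfunctional_int (nu : probability (Rd R d) R) w : bmeas w ->
  bfunctional X (fun F => Ex nu (fun y => F (p y) * w y)).
Proof.
move=> bw; split.
  move=> k f g cf cg; have [bf bg] := (bmeas_retract a r cf, bmeas_retract a r cg).
  have [bfw bgw] := (bmeasM bf bw, bmeasM bg bw).
  rewrite -(ExZ _ _ bfw) -(ExD _ (bmeasZ k bfw) bgw).
  by congr Ex; apply/funext => y; ring.
have [M M0 wM] := bmeas_bound bw; exists M => // f b cf fb.
apply: Ex_norm_le; first by apply: bmeasM => //; exact: bmeas_retract.
move=> y; rewrite normrM mulrC ler_pM//.
by apply: fb; exact: retract_in.
Qed.

Lemma ndual_int (nu : probability (Rd R d) R) w (b : R) : bmeas w ->
  (forall x, `|w x| <= b) -> ndual b (fun F => Ex nu (fun y => F (p y) * w y)).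
Proof.
move=> bw wb F e SF e0 Fe; apply: Ex_norm_le.
  by apply: bmeasM => //; apply: bmeas_retract; exact: smooth_continuous.
move=> y; rewrite normrM mulrC ler_pM//.
by apply: (bnd_sup Fe); exact: retract_in.
Qed.

(** The signed measure [l * (nu - mu)] acting on functions on the ball, and
    [tvec] below is the same measure as an element of [l^infty(B^s)]. *)
Definition gap (mu : probability (Rd R d) R) (l : R) (nu : probability (Rd R d) R) F :=
  l * (Ex nu (fun y => F (p y)) - Ex mu (fun y => F (p y))).

Lemma bfunctional_gap mu l nu : bfunctional X (gap mu l nu).
Proof.
have bi nu' : bfunctional X (fun F => Ex nu' (fun y => F (p y))).
  have := bfunctional_int nu' (bmeas_cst _ 1).
  by congr bfunctional; apply/funext => F; congr Ex; apply/funext => y; rewrite mulr1.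
have bz : bfunctional X (fun _ => 0).
  split=> [k f g _ _|]; first by rewrite mulr0 addr0.
  by exists 0 => // f b _ _; rewrite normr0 mul0r.
have := bfunctional_lin l (bfunctional_lin (-1) (bi mu) (bi nu)) bz.
by congr bfunctional; apply/funext => F; rewrite /gap addr0 mulN1r addrC.
Qed.

Definition tvec (mu : probability (Rd R d) R) (l : R) nu : E :=
  l *: (linf_of_prob a r s nu - linf_of_prob a r s mu).

(** A smooth function bounded by [1] in the sense of [bnd] becomes, after
    division by [s.+1] and restriction to the ball, a member of the unit ball on
    which the norm of [l^infty(B^s)] is computed. *)
Lemma gap_tvec mu l nu l' nu' F : prob_on X mu -> prob_on X nu -> prob_on X nu' ->
  smooth F -> bnd X s 1 F ->
  `|gap mu l nu F - gap mu l' nu' F| <= s.+1%:R * `|tvec mu l nu - tvec mu l' nu'|.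
Proof.
move=> muX nuX nu'X SF FB.
pose f : Cs_ball X s :=
  exist (fun f => f \in Cs_ball X s) _ (mem_set (Cs_ball_cutoff SF FB)).
have bF : bmeas (fun y => F (p y)) by apply: bmeas_retract; exact: smooth_continuous.
have fE nu0 : prob_on X nu0 ->
    linf_of_prob a r s nu0 f = s.+1%:R^-1 * Ex nu0 (fun y => F (p y)).
  move=> n0; rewrite -(ExZ _ _ bF) -(Rintegral_ball n0); last exact: bmeasZ.
  apply: eq_Rintegral => x /set_mem Xx /=.
  by rewrite /cutoff mem_set// retract_id.
have := linf_norm_ub (tvec mu l nu - tvec mu l' nu') f.
have -> : (tvec mu l nu - tvec mu l' nu') f =
    s.+1%:R^-1 * (gap mu l nu F - gap mu l' nu' F).
  have -> : (tvec mu l nu - tvec mu l' nu') f =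
    l * (linf_of_prob a r s nu f - linf_of_prob a r s mu f) -
    l' * (linf_of_prob a r s nu' f - linf_of_prob a r s mu f) by [].
  by rewrite !fE// /gap; ring.
have n0 : (0 : R) < s.+1%:R by rewrite ltr0n.
by rewrite normrM normfV (gtr0_norm n0) ler_pdivrMl.
Qed.

Lemma tvecZ mu (t l : R) nu : tvec mu (t * l) nu = t *: tvec mu l nu.
Proof. by rewrite /tvec scalerA. Qed.

Lemma ndual_gapB mu l nu l' nu' : prob_on X mu -> prob_on X nu -> prob_on X nu' ->
  ndual (s.+1%:R * `|tvec mu l nu - tvec mu l' nu'|)
    (fun F => gap mu l nu F - gap mu l' nu' F).
Proof.
move=> muX nuX nu'X; apply: ndualS => [|F SF FB]; last exact: gap_tvec.
have := bfunctional_lin (-1) (bfunctional_gap mu l' nu') (bfunctional_gap mu l nu).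
by congr bfunctional; apply/funext => F; rewrite mulN1r addrC.
Qed.

Lemma ndual_gap mu l nu : prob_on X mu -> prob_on X nu ->
  ndual (s.+1%:R * `|tvec mu l nu|) (gap mu l nu).
Proof.
move=> muX nuX; have := ndual_gapB l 0 muX nuX nuX.
rewrite (_ : tvec mu 0 nu = 0) ?subr0; last by rewrite /tvec scale0r.
congr ndual; apply/funext => F; rewrite /gap mul0r subr0//.
Qed.

End dual_norm.

(** * Second-order expansion around the base measure *)

Lemma half_sum_dist (R : realType) (B B' v1 v2 v3 v4 z1 z2 : R) :
  `|B - B'| <= 2 * z1 -> `|v1 - v2| <= 2 * z2 -> `|v3 - v4| <= 2 * z2 ->
  `|(- B + (- v1 - v3) / 2) - (- B' + (- v2 - v4) / 2)| <= 2 * z1 + 2 * z2.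
Proof.
rewrite !ler_norml => /andP[? ?] /andP[? ?] /andP[? ?].
by apply/andP; split; lra.
Qed.

Lemma two_sided_error (R : realType) (e m q A U B v : R) :
  0 <= e -> 0 <= A -> 0 <= B ->
  m + e * (q - A * B) <= v -> v <= m + e * (q + (U + 3) * B) ->
  `|v - (m + e * q)| <= e * (A + (`|U| + 3)) * B.
Proof.
move=> e0 A0 B0 lo up.
have eB : 0 <= e * B by exact: mulr_ge0.
have U1 : e * B * U <= e * B * `|U| by rewrite ler_wpM2l// ler_norm.
have U0 : 0 <= e * B * `|U| by exact: mulr_ge0.
have A1 : 0 <= e * B * A by exact: mulr_ge0.
by rewrite ler_norml; apply/andP; split; lra.
Qed.

Lemma small_bounds (R : realType) (b l : R) :
  0 <= b -> 0 <= l * b -> b * (4 + 2 * l) <= 1 ->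
  [/\ 4 * b <= 1, b <= 1 & 2 * (l * b) <= 1].
Proof. by move=> *; split; lra. Qed.

Lemma debias_dist (R : realType) (x y z x' y' z' e : R) :
  `|x - x'| <= e -> `|y - y'| <= e -> `|z - z'| <= e ->
  `|(x - (y + z) / 2) - (x' - (y' + z') / 2)| <= 2 * e.
Proof.
rewrite !ler_norml => /andP[? ?] /andP[? ?] /andP[? ?].
by apply/andP; split; lra.
Qed.

Lemma debias_error (R : realType) (v12 v11 v22 m1 m2 eps s12 s11 s22 e : R) :
  `|v12 - (m1 + m2 + eps * s12)| <= e -> `|v11 - (m1 + m1 + eps * s11)| <= e ->
  `|v22 - (m2 + m2 + eps * s22)| <= e ->
  `|v12 - 2^-1 * (v11 + v22) - 2 * eps * (s12 - (s11 + s22) / 2) / 2| <= 2 * e.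
Proof.
rewrite !ler_norml => /andP[? ?] /andP[? ?] /andP[? ?].
by apply/andP; split; lra.
Qed.

Section sinkhorn_kernel.
Context {R : realType} {d : nat} (eps : R) (c : Rd R d * Rd R d -> R).
Context (a : Rd R d) (r : {posnum R}) (s : nat) (mu : probability (Rd R d) R).
Context (u : Rd R d -> R) (um : R).

Local Notation X := (closed_eball a r%:num).
Local Notation p := (retract a r).

Hypotheses (eps0 : 0 < eps) (Sc : smooth c).
Hypothesis (csym : forall x y, c (x, y) = c (y, x)).
Hypothesis (muX : prob_on X mu).

Definition rcost z := c (p z.1, p z.2).
Definition gibbs z := expR (- (c z / eps)).

Hypotheses (bu : bmeas u) (um0 : 0 < um) (u_ge : forall x, um <= u x).
Hypothesis (u_eq : forall x,
  u x * Ex mu (fun y => gibbs (p x, p y) * u y) = 1).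

Lemma bmeas_rcost : bmeas rcost.
Proof. by apply: bmeas_retract2; exact: smooth_continuous. Qed.

Lemma smooth_gibbs : smooth gibbs.
Proof.
apply: smooth_expR; rewrite (_ : (fun z => _) = (fun z => - eps^-1 * c z)).
  by apply: smoothM => //; exact: smooth_cst.
by apply/funext => z; rewrite mulNr mulrC.
Qed.

(** The integral in the equation for [u], as a function of an unrestricted
    point [x]: it is smooth and gives a smooth function [upot] that agrees with
    [u] on the ball. *)
Definition ipot x := Ex mu (fun y => gibbs (x, p y) * u y).

Lemma ipot_gt0 x : 0 < ipot x.
Proof.
have cg : continuous (fun y => gibbs (x, y)).
  by apply: continuous_sec2; apply: smooth_continuous; exact: smooth_gibbs.
have cc : continuous (fun y => c (x, y)).
  by apply: continuous_sec2; exact: smooth_continuous.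
have [M M0 cM] := bmeas_bound (bmeas_retract a r cc).
apply: (@lt_le_trans _ _ (expR (- (M / eps)) * um)).
  by rewrite mulr_gt0// expR_gt0.
apply: Ex_ge_cst; first by apply: bmeasM => //; exact: (bmeas_retract a r cg).
move=> y; apply: (ler_pM (expR_ge0 _) (ltW um0) _ (u_ge y)).
rewrite ler_expR lerN2 ler_pM2r ?invr_gt0//.
by apply: le_trans (cM y); exact: ler_norm.
Qed.

Definition upot x := (ipot x)^-1.

Lemma smooth_upot : smooth upot.
Proof.
apply: smooth_inv; first by move=> x; rewrite gt_eqF// ipot_gt0.
exact: (smooth_functional_sec (@eball_compact R d a r) (bfunctional_int a r mu bu) smooth_gibbs).
Qed.

Lemma upotE x : u x = upot (p x).
Proof.
by have := u_eq x; rewrite /upot => /(canRL (mulfK _)); rewrite mul1r; apply;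
  rewrite gt_eqF// ipot_gt0.
Qed.

Definition kern z := upot z.1 * upot z.2 * gibbs z.

Lemma smooth_kern : smooth kern.
Proof.
apply: smoothM; last exact: smooth_gibbs.
apply: smoothM; [exact: smooth_fst smooth_upot|exact: smooth_snd smooth_upot].
Qed.

Definition rkern z := kern (p z.1, p z.2).

Lemma rkernE z : rkern z = u z.1 * u z.2 * expR (- (rcost z / eps)).
Proof. by rewrite /rkern /kern /= -!upotE. Qed.

Lemma bmeas_rkern : bmeas rkern.
Proof. by apply: bmeas_retract2; apply: smooth_continuous; exact: smooth_kern. Qed.

Lemma rkern_lower : exists2 del, 0 < del & forall z, del <= rkern z.
Proof.
have [M M0 cM] := bmeas_bound bmeas_rcost.
exists (um * um * expR (- (M / eps))); first by rewrite !mulr_gt0// expR_gt0.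
move=> z; rewrite rkernE; apply: ler_pM.
- by rewrite mulr_ge0// ltW.
- exact: expR_ge0.
- by apply: ler_pM => //; exact: ltW.
rewrite ler_expR lerN2 ler_pM2r ?invr_gt0//.
by apply: le_trans (cM z); exact: ler_norm.
Qed.

Lemma rkern_sym x y : rkern (x, y) = rkern (y, x).
Proof. by rewrite !rkernE /rcost /= csym; ring. Qed.

Lemma rkern_mass x : Ex mu (fun y => rkern (x, y)) = 1.
Proof.
rewrite -[RHS](u_eq x) -ExZ; last first.
  have bg := bmeas_retract2 a r (smooth_continuous smooth_gibbs).
  by apply: bmeasM => //; exact: (bmeas_sec1 x bg).
by congr Ex; apply/funext => y; rewrite rkernE /gibbs /rcost /=; ring.
Qed.

Implicit Types (l : R) (nu : probability (Rd R d) R).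

(** The failure of [kern] to have marginal density [1] with respect to [nu],
    scaled by [l]: the linear data of the system for the potentials. *)
Definition defect l nu x := gap a r mu l nu (fun y => kern (x, y)).
Definition rdefect l nu x := defect l nu (p x).

Lemma rdefectE l nu x : rdefect l nu x = l * (Ex nu (fun y => rkern (x, y)) - 1).
Proof. by rewrite -(rkern_mass x). Qed.

Lemma bmeas_rdefect l nu : bmeas (rdefect l nu).
Proof.
rewrite (_ : rdefect l nu = fun x => l * (Ex nu (fun y => rkern (x, y)) - 1)).
  apply: bmeasZ; apply: bmeasB; last exact: bmeas_cst.
  by apply: bmeas_Ex1; exact: bmeas_rkern.
by apply/funext => x; rewrite rdefectE.
Qed.

Lemma rdefect_mean l nu : Ex mu (rdefect l nu) = 0.
Proof.
have bk := bmeas_rkern.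
rewrite (_ : rdefect l nu = fun x => l * (Ex nu (fun y => rkern (x, y)) - 1)); last first.
  by apply/funext => x; rewrite rdefectE.
have b1 := bmeas_Ex1 nu bk; have bc := bmeas_cst (Rd R d) (1 : R).
rewrite (ExZ _ _ (bmeasB b1 bc)) (ExB _ b1 bc) Ex_cst Ex_swap//.
rewrite (_ : (fun y => Ex mu _) = fun=> 1) ?Ex_cst ?subrr ?mulr0//.
by apply/funext => y; under [X in Ex mu X]funext do rewrite rkern_sym; exact: rkern_mass.
Qed.

(** A solution exists by [linsys_exists] and is unique by
    [potentials_bound]. *)
Definition potentials l1 nu1 l2 nu2 : (Rd R d -> R) * (Rd R d -> R) :=
  xget (cst 0, cst 0)
    [set z | linsys mu rkern (rdefect l1 nu1) (rdefect l2 nu2) z.1 z.2].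

Lemma potentialsP l1 nu1 l2 nu2 : let z := potentials l1 nu1 l2 nu2 in
  linsys mu rkern (rdefect l1 nu1) (rdefect l2 nu2) z.1 z.2.
Proof.
have [del del0 k_ge] := rkern_lower.
have d2 : 0 < Num.min del 2^-1 by rewrite lt_min del0/= invr_gt0.
have d1 : Num.min del 2^-1 < 1.
  have h : Num.min del 2^-1 <= 2^-1 by rewrite ge_min lexx orbT.
  by apply: le_lt_trans h _; lra.
have kd z : Num.min del 2^-1 <= rkern z by rewrite ge_min k_ge.
have [phi [psi sol]] := linsys_exists bmeas_rkern d2 d1 kd rkern_sym rkern_mass
  (bmeas_rdefect l1 nu1) (bmeas_rdefect l2 nu2) (rdefect_mean l1 nu1) (rdefect_mean l2 nu2).
by rewrite /potentials; case: xgetP => [z _ //|/(_ (phi, psi))].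
Qed.

Lemma potentials_bound : exists2 Cl : R, 1 <= Cl & forall A1 A2 phi psi (b : R),
  bmeas A1 -> bmeas A2 -> linsys mu rkern A1 A2 phi psi ->
  (forall x, `|A1 x| <= b) -> (forall x, `|A2 x| <= b) ->
  forall x, `|phi x| <= Cl * b /\ `|psi x| <= Cl * b.
Proof.
have [del del0 k_ge] := rkern_lower.
have d2 : 0 < Num.min del 2^-1 by rewrite lt_min del0/= invr_gt0.
have d1 : Num.min del 2^-1 < 1.
  have h : Num.min del 2^-1 <= 2^-1 by rewrite ge_min lexx orbT.
  by apply: le_lt_trans h _; lra.
have kd z : Num.min del 2^-1 <= rkern z by rewrite ge_min k_ge.
exists (linsys_const (Num.min del 2^-1)); first exact: linsys_const_ge1.
move=> A1 A2 phi psi b b1 b2 sol A1b A2b x.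
exact: (linsys_bound bmeas_rkern d2 d1 kd rkern_mass b1 b2 sol A1b A2b x).
Qed.

(** Quadratic in the tangent vectors [l1 (nu1 - mu)] and [l2 (nu2 - mu)], but
    written with the measures themselves, since the defects and potentials are
    functions of these. *)
Definition second_order l1 nu1 l2 nu2 : R :=
  - (l1 * Ex nu1 (rdefect l2 nu2)) +
  (- Ex mu (fun x => (potentials l1 nu1 l2 nu2).1 x * rdefect l2 nu2 x)
   - Ex mu (fun x => (potentials l1 nu1 l2 nu2).2 x * rdefect l1 nu1 x)) / 2.

(** The defects are images of the kernel under small functionals. *)
Lemma defect_bnd : exists2 C1 : R, 0 <= C1 & forall J (b : R),
  bfunctional X J -> ndual a r s b J ->
  smooth (fun x => J (fun y => kern (x, y))) /\
  bnd X s (C1 * b) (fun x => J (fun y => kern (x, y))).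
Proof.
have [C1 C10 HC] := bnd_functional_sec (@eball_compact R d a r) s s smooth_kern.
exists C1 => // J b bJ nJ; split; last exact: (HC J b bJ (ndual1 nJ)).
exact: (smooth_functional_sec (@eball_compact R d a r) bJ smooth_kern).
Qed.

Local Notation S := (s.+1%:R : R).
Local Notation tv := (tvec a r s mu).

(** The defects have mean zero under [mu], by the symmetry and the mass of the
    kernel. *)
Lemma gap_defect l1 nu1 l2 nu2 :
  gap a r mu l1 nu1 (defect l2 nu2) = l1 * Ex nu1 (rdefect l2 nu2).
Proof.
by rewrite /gap -[X in _ - X]/(Ex mu (rdefect l2 nu2)) rdefect_mean subr0.
Qed.

(** Each term is bilinear, in the tangent vectors or in a potential and a
    defect, and both factors are Lipschitz: the defects by [defect_bnd], the
    potentials because the linear system is solved with a bound. *)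
Lemma second_order_lip : exists2 CT : R, 0 <= CT &
  forall l1 nu1 l2 nu2 l1' nu1' l2' nu2' (N e : R),
  prob_on X nu1 -> prob_on X nu2 -> prob_on X nu1' -> prob_on X nu2' ->
  `|tv l1 nu1| <= N -> `|tv l2 nu2| <= N -> `|tv l1' nu1'| <= N ->
  `|tv l2' nu2'| <= N ->
  `|tv l1 nu1 - tv l1' nu1'| <= e -> `|tv l2 nu2 - tv l2' nu2'| <= e ->
  `|second_order l1 nu1 l2 nu2 - second_order l1' nu1' l2' nu2'| <= CT * (N * e).
Proof.
have [C1 C10 HC1] := defect_bnd; have [Cl Cl1 HCl] := potentials_bound.
have Cl0 : 0 <= Cl by exact: le_trans ler01 Cl1.
exists ((2 * C1 + 2 * Cl * C1 ^+ 2) * S ^+ 2).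
  by rewrite mulr_ge0 ?exprn_ge0// addr_ge0// !mulr_ge0// exprn_ge0.
move=> l1 nu1 l2 nu2 l1' nu1' l2' nu2' N e X1 X2 X1' X2' n1 n2 n1' n2' d1 d2.
have N0 : 0 <= N by exact: le_trans n1.
have e0 : 0 <= e by exact: le_trans d1.
pose b := S * N; pose f := S * e.
have b0 : 0 <= b by exact: mulr_ge0.
have f0 : 0 <= f by exact: mulr_ge0.
have nd l nu : prob_on X nu -> `|tv l nu| <= N -> ndual a r s b (gap a r mu l nu).
  by move=> nX n; apply: ndual_le (ndual_gap _ muX nX); rewrite ler_wpM2l.
have ndB l nu l' nu' : prob_on X nu -> prob_on X nu' -> `|tv l nu - tv l' nu'| <= e ->
    ndual a r s f (fun F => gap a r mu l nu F - gap a r mu l' nu' F).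
  by move=> nX nX' n; apply: ndual_le (ndual_gapB _ _ muX nX nX'); rewrite ler_wpM2l.
have bf l nu := bfunctional_gap a r mu l nu.
have bfB l nu l' nu' : bfunctional X (fun F => gap a r mu l nu F - gap a r mu l' nu' F).
  have := bfunctional_lin (-1) (bf l' nu') (bf l nu).
  by congr bfunctional; apply/funext => F; rewrite mulN1r addrC.
have dS l nu (nX : prob_on X nu) (n : `|tv l nu| <= N) := HC1 _ _ (bf l nu) (nd l nu nX n).
have dSB l nu l' nu' (nX : prob_on X nu) (nX' : prob_on X nu')
  (n : `|tv l nu - tv l' nu'| <= e) := HC1 _ _ (bfB l nu l' nu') (ndB l nu l' nu' nX nX' n).
have dA l nu : prob_on X nu -> `|tv l nu| <= N -> forall x, `|rdefect l nu x| <= C1 * b.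
  by move=> nX n x; apply: (bnd_sup (proj2 (dS l nu nX n))); exact: retract_in.
have dAB l nu l' nu' : prob_on X nu -> prob_on X nu' -> `|tv l nu - tv l' nu'| <= e ->
    forall x, `|rdefect l nu x - rdefect l' nu' x| <= C1 * f.
  move=> nX nX' n x; apply: (bnd_sup (proj2 (dSB l nu l' nu' nX nX' n))).
  exact: retract_in.
have hB : `|l1 * Ex nu1 (rdefect l2 nu2) - l1' * Ex nu1' (rdefect l2' nu2')| <=
    2 * (C1 * b * f).
  have [S2 B2] := dS l2 nu2 X2 n2; have [S2' B2'] := dS l2' nu2' X2' n2'.
  have [SB BB] := dSB l2 nu2 l2' nu2' X2 X2' d2.
  rewrite -!gap_defect.
  have t1 := ndB l1 nu1 l1' nu1' X1 X1' d1 _ _ S2 (mulr_ge0 C10 b0) B2.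
  have t2 := nd l1' nu1' X1' n1' _ _ SB (mulr_ge0 C10 f0) BB.
  rewrite (bfunctionalB (bf l1' nu1') (smooth_continuous S2) (smooth_continuous S2')) in t2.
  rewrite -/(defect l2 nu2) in t1 t2; rewrite -/(defect l2' nu2') in t2.
  rewrite (_ : gap a r mu l1 nu1 (defect l2 nu2) - gap a r mu l1' nu1' (defect l2' nu2') =
    (gap a r mu l1 nu1 (defect l2 nu2) - gap a r mu l1' nu1' (defect l2 nu2)) +
    (gap a r mu l1' nu1' (defect l2 nu2) - gap a r mu l1' nu1' (defect l2' nu2'))); last by ring.
  apply: le_trans (ler_normD _ _) _; apply: le_trans (lerD t1 t2) _.
  by rewrite (_ : f * (C1 * b) + b * (C1 * f) = 2 * (C1 * b * f))//; ring.
have sol := potentialsP l1 nu1 l2 nu2; have sol' := potentialsP l1' nu1' l2' nu2'.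
move: sol sol'; rewrite /second_order.
move: (potentials l1 nu1 l2 nu2) (potentials l1' nu1' l2' nu2') => [phi psi] [phi' psi'] /=.
move=> sol sol'.
have bA l nu : bmeas (rdefect l nu) by exact: bmeas_rdefect.
have bAZ (f1 f2 : Rd R d -> R) : bmeas f1 -> bmeas f2 ->
    bmeas (fun x => f1 x - 1 * f2 x).
  by move=> b1 b2; apply: bmeasB => //; exact: bmeasZ.
have sb' := HCl _ _ _ _ _ (bA _ _) (bA _ _) sol' (dA _ _ X1' n1') (dA _ _ X2' n2').
have sd := HCl _ _ _ _ (C1 * f) (bAZ _ _ (bA l1 nu1) (bA l1' nu1'))
  (bAZ _ _ (bA l2 nu2) (bA l2' nu2'))
  (linsys_lin bmeas_rkern 1 sol sol').
have {}sd x : `|phi x - phi' x| <= Cl * (C1 * f) /\ `|psi x - psi' x| <= Cl * (C1 * f).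
  have := sd _ _ x; rewrite !mul1r; apply.
    by move=> y; rewrite mul1r; exact: dAB d1 y.
  by move=> y; rewrite mul1r; exact: dAB d2 y.
have [bphi bpsi _ _ _] := sol; have [bphi' bpsi' _ _ _] := sol'.
have hq (g g' A A' : Rd R d -> R) : bmeas g -> bmeas g' -> bmeas A -> bmeas A' ->
    (forall x, `|g x - g' x| <= Cl * (C1 * f)) -> (forall x, `|g' x| <= Cl * (C1 * b)) ->
    (forall x, `|A x - A' x| <= C1 * f) -> (forall x, `|A x| <= C1 * b) ->
    `|Ex mu (fun x => g x * A x) - Ex mu (fun x => g' x * A' x)| <=
      2 * (Cl * C1 ^+ 2 * b * f).
  move=> bg bg' bA0 bA' h1 h2 h3 h4.
  have [m1 m2] := (bmeasM bg bA0, bmeasM bg' bA').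
  rewrite -(ExB _ m1 m2); apply: Ex_norm_le; first exact: bmeasB.
  move=> x; have -> : g x * A x - g' x * A' x =
    (g x - g' x) * A x + g' x * (A x - A' x) by ring.
  apply: le_trans (ler_normD _ _) _; rewrite !normrM.
  have := lerD (ler_pM (normr_ge0 _) (normr_ge0 _) (h1 x) (h4 x))
               (ler_pM (normr_ge0 _) (normr_ge0 _) (h2 x) (h3 x)).
  move=> /le_trans; apply; rewrite le_eqVlt; apply/orP; left; apply/eqP; ring.
have q1 := hq _ _ _ _ bphi bphi' (bA l2 nu2) (bA l2' nu2') (fun x => proj1 (sd x))
  (fun x => proj1 (sb' x)) (dAB _ _ _ _ X2 X2' d2) (dA _ _ X2 n2).
have q2 := hq _ _ _ _ bpsi bpsi' (bA l1 nu1) (bA l1' nu1') (fun x => proj2 (sd x))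
  (fun x => proj2 (sb' x)) (dAB _ _ _ _ X1 X1' d1) (dA _ _ X1 n1).
rewrite (_ : (2 * C1 + 2 * Cl * C1 ^+ 2) * S ^+ 2 * (N * e) =
  2 * (C1 * b * f) + 2 * (Cl * C1 ^+ 2 * b * f)); last by rewrite /b /f; ring.
exact: half_sum_dist hB q1 q2.
Qed.

(** Multiplying the data of the linear system multiplies its solution, by
    uniqueness. *)
Lemma second_order_homog t l1 nu1 l2 nu2 :
  second_order (t * l1) nu1 (t * l2) nu2 = t ^+ 2 * second_order l1 nu1 l2 nu2.
Proof.
have [Cl Cl1 HCl] := potentials_bound.
have AZ l nu x : rdefect (t * l) nu x = t * rdefect l nu x.
  by rewrite !rdefectE mulrA.
have sol := potentialsP l1 nu1 l2 nu2; have sol' := potentialsP (t * l1) nu1 (t * l2) nu2.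
move: sol sol'; rewrite /second_order.
move: (potentials l1 nu1 l2 nu2) (potentials (t * l1) nu1 (t * l2) nu2).
move=> [phi psi] [phi' psi'] /= sol sol'.
have bA l nu : bmeas (rdefect l nu) by exact: bmeas_rdefect.
have bAZ (f1 f2 : Rd R d -> R) : bmeas f1 -> bmeas f2 ->
    bmeas (fun x => f1 x - t * f2 x).
  by move=> b1 b2; apply: bmeasB => //; exact: bmeasZ.
have := HCl _ _ _ _ 0 (bAZ _ _ (bA (t * l1) nu1) (bA l1 nu1))
  (bAZ _ _ (bA (t * l2) nu2) (bA l2 nu2)) (linsys_lin bmeas_rkern t sol' sol).
move=> h0; have {}h0 x : phi' x = t * phi x /\ psi' x = t * psi x.
  have := h0 _ _ x; rewrite mulr0 !normr_le0 !subr_eq0 => h.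
  have [||/eqP ? /eqP ?//] := h.
    by move=> y; rewrite AZ subrr normr0.
  by move=> y; rewrite AZ subrr normr0.
have [bphi bpsi _ _ _] := sol.
have -> : Ex nu1 (rdefect (t * l2) nu2) = t * Ex nu1 (rdefect l2 nu2).
  by rewrite -ExZ//; congr Ex; apply/funext => x; exact: AZ.
have -> : Ex mu (fun x => phi' x * rdefect (t * l2) nu2 x) =
    t ^+ 2 * Ex mu (fun x => phi x * rdefect l2 nu2 x).
  rewrite -ExZ; last exact: bmeasM.
  by congr Ex; apply/funext => x; rewrite AZ (proj1 (h0 x)); ring.
have -> : Ex mu (fun x => psi' x * rdefect (t * l1) nu1 x) =
    t ^+ 2 * Ex mu (fun x => psi x * rdefect l1 nu1 x).
  rewrite -ExZ; last exact: bmeasM.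
  by congr Ex; apply/funext => x; rewrite AZ (proj2 (h0 x)); ring.
by ring.
Qed.

Local Notation F0 := (lpot eps u).

(** In [phi = - A2 - K psi] the right-hand side is the image of the kernel
    under the functional [- l2 (nu2 - mu) - psi mu], whose dual norm is of the
    order of the data once [psi] is bounded.  The same holds for [psi]. *)
Lemma potentials_smooth : exists2 C2 : R, 0 <= C2 &
  forall l1 nu1 l2 nu2 (b : R), prob_on X nu1 -> prob_on X nu2 ->
  S * `|tv l1 nu1| <= b -> S * `|tv l2 nu2| <= b ->
  let z := potentials l1 nu1 l2 nu2 in
  exists phi psi : Rd R d -> R, [/\ smooth phi /\ bnd X s (C2 * b) phi,
    smooth psi /\ bnd X s (C2 * b) psi,
    forall x, z.1 x = phi (p x), forall x, z.2 x = psi (p x) &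
    forall x, `|z.1 x| <= C2 * b /\ `|z.2 x| <= C2 * b].
Proof.
have [C1 C10 HC1] := defect_bnd; have [Cl Cl1 HCl] := potentials_bound.
have Cl0 : 0 <= Cl by exact: le_trans ler01 Cl1.
exists (C1 * (1 + Cl * C1)); first by rewrite mulr_ge0// addr_ge0// mulr_ge0.
move=> l1 nu1 l2 nu2 b X1 X2 n1 n2 z.
have b0 : 0 <= b by apply: le_trans n1; exact: mulr_ge0.
have nd1 := ndual_le n1 (ndual_gap l1 muX X1).
have nd2 := ndual_le n2 (ndual_gap l2 muX X2).
have [bf1 bf2] := (bfunctional_gap a r mu l1 nu1, bfunctional_gap a r mu l2 nu2).
have dA1 x : `|rdefect l1 nu1 x| <= C1 * b.
  by apply: (bnd_sup (proj2 (HC1 _ _ bf1 nd1))); exact: retract_in.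
have dA2 x : `|rdefect l2 nu2 x| <= C1 * b.
  by apply: (bnd_sup (proj2 (HC1 _ _ bf2 nd2))); exact: retract_in.
have sol := potentialsP l1 nu1 l2 nu2.
have sb := HCl _ _ _ _ _ (bmeas_rdefect l1 nu1) (bmeas_rdefect l2 nu2) sol dA1 dA2.
move: sol sb; rewrite -/z; case: z => phi psi /= sol sb.
have [bphi bpsi _ e1 e2] := sol.
(* each potential is the image of the kernel under a functional whose norm is
   controlled by the data *)
have gen l nu (w v : Rd R d -> R) : bmeas w -> (forall x, `|w x| <= Cl * (C1 * b)) ->
    bfunctional X (gap a r mu l nu) -> ndual a r s b (gap a r mu l nu) ->
    (forall x, v x + kop mu rkern w x = - rdefect l nu x) ->
    exists V, [/\ smooth V, bnd X s (C1 * (1 + Cl * C1) * b) V &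
      forall x, v x = V (p x)].
  move=> bw wb bf nd e.
  pose J F := (-1) * gap a r mu l nu F + (-1) * Ex mu (fun y => F (p y) * w y).
  have bJ : bfunctional X J.
    have bz : bfunctional X (fun _ => 0).
      split=> [k f g _ _|]; first by rewrite mulr0 addr0.
      by exists 0 => // f b' _ _; rewrite normr0 mul0r.
    have := bfunctional_lin (-1) bf
      (bfunctional_lin (-1) (bfunctional_int a r mu bw) bz).
    by congr bfunctional; apply/funext => F; rewrite addr0.
  have nJ : ndual a r s (b + Cl * (C1 * b)) J.
    move=> F e' SF e'0 Fe; apply: le_trans (ler_normD _ _) _.
    rewrite !mulN1r !normrN mulrDl; apply: lerD; first exact: nd.
    exact: (@ndual_int _ _ a r s mu w _ bw wb F e' SF e'0 Fe).
  have [SV BV] := HC1 J _ bJ nJ.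
  exists (fun x => J (fun y => kern (x, y))); split=> //.
    by move: BV; congr (bnd _ _ _ _); ring.
  move=> x; rewrite /J -/(defect l nu (p x)) -/(rdefect l nu x).
  have -> : Ex mu (fun y => kern (p x, p y) * w y) = kop mu rkern w x by rewrite kopE.
  by have := e x; rewrite !mulN1r => <-; rewrite addrK.
have [Phi [SPhi BPhi PhiE]] := gen l2 nu2 psi phi bpsi (fun x => proj2 (sb x)) bf2 nd2 e1.
have [Psi [SPsi BPsi PsiE]] := gen l1 nu1 phi psi bphi (fun x => proj1 (sb x)) bf1 nd1 e2.
exists Phi, Psi; split=> // x; rewrite PhiE PsiE.
by split; [apply: (bnd_sup BPhi)|apply: (bnd_sup BPsi)]; exact: retract_in.
Qed.

(** With [beta] a large multiple of [N], all quantities that [eot_lower] and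
    [eot_upper] ask to be small are bounded by powers of [beta]: the functions
    themselves by [defect_bnd] and [potentials_smooth], the differences between
    integrals against [nu_i] and [mu] by the dual norm of [nu_i - mu] times a
    [C^s] bound on the product that is integrated. *)
Lemma eot_expansion : exists C0 : R, exists2 N0 : R, 0 < N0 & 0 <= C0 /\
  forall nu1 nu2 (N : R), prob_on X nu1 -> prob_on X nu2 ->
  `|tv 1 nu1| <= N -> `|tv 1 nu2| <= N -> N <= N0 ->
  exists2 v : R, eot c eps nu1 nu2 = v%:E &
  `|v - (Ex nu1 F0 + Ex nu2 F0 + eps * second_order 1 nu1 1 nu2)| <= C0 * N ^+ 3.
Proof.
have [C1 C10 HC1] := defect_bnd; have [C2 C20 HC2] := potentials_smooth.
have [Ck Ck0 HCk] := bnd_sec2 (@eball_compact R d a r) s smooth_kern.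
have [del del0 k_ge] := rkern_lower.
have [K K0 kK] := bmeas_bound bmeas_rkern.
have k_le z : rkern z <= K by apply: le_trans (kK z); exact: ler_norm.
have S0 : 0 <= S by [].
pose c3 := 2 ^+ s * Ck * C2 * S ^+ 2; pose c4 := 2 ^+ s * C2 * C1 * S ^+ 3.
have c30 : 0 <= c3 by rewrite /c3 !mulr_ge0// exprn_ge0.
have c40 : 0 <= c4 by rewrite /c4 !mulr_ge0// exprn_ge0.
pose Cb := 1 + C1 * S + C2 * S + c3 + c4.
have C1S : 0 <= C1 * S by exact: mulr_ge0.
have C2S : 0 <= C2 * S by exact: mulr_ge0.
have Cb1 : 1 <= Cb by rewrite /Cb; lra.
have Cb0 : 0 < Cb by exact: lt_le_trans Cb1.
have sl0 : 0 <= slope del by rewrite /slope addr_ge0// divr_ge0// ltW.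
have den0 : 0 < Cb * (4 + 2 * slope del).
  by rewrite mulr_gt0// ltr_pwDl// mulr_ge0.
pose uc := upper_const del K.
pose C0 := eps * (16 * K + 9 + (`|uc| + 3)) * Cb ^+ 3.
exists C0, (Cb * (4 + 2 * slope del))^-1; first by rewrite invr_gt0.
split.
  apply: mulr_ge0; last by rewrite exprn_ge0// ltW.
  apply: mulr_ge0; first exact: ltW.
  by have := normr_ge0 uc; move: K0; move: (`|uc|) => w; lra.
move=> nu1 nu2 N X1 X2 n1 n2 NN0.
have N0 : 0 <= N by exact: le_trans n1.
pose b := S * N; pose beta := Cb * N.
have b0 : 0 <= b by exact: mulr_ge0.
have beta0 : 0 <= beta by rewrite mulr_ge0// ltW.
have small : beta * (4 + 2 * slope del) <= 1.
  rewrite /beta mulrAC -ler_pdivlMl// mulr1.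
  exact: NN0.
have sN1 : S * `|tv 1 nu1| <= b by rewrite ler_wpM2l.
have sN2 : S * `|tv 1 nu2| <= b by rewrite ler_wpM2l.
have nd1 := ndual_le sN1 (ndual_gap 1 muX X1).
have nd2 := ndual_le sN2 (ndual_gap 1 muX X2).
have [bf1 bf2] := (bfunctional_gap a r mu 1 nu1, bfunctional_gap a r mu 1 nu2).
have [SD1 BD1] := HC1 _ _ bf1 nd1; have [SD2 BD2] := HC1 _ _ bf2 nd2.
have sol := potentialsP 1 nu1 1 nu2.
have [Phi [Psi [[SPhi BPhi] [SPsi BPsi] PhiE PsiE pb]]] := HC2 1 nu1 1 nu2 b X1 X2 sN1 sN2.
have pbeta t : 0 <= t -> t <= Cb -> t * N <= beta by move=> *; rewrite ler_wpM2r.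
have le1 : C1 * b <= beta.
  by rewrite /b mulrA; apply: pbeta => //; rewrite /Cb; lra.
have le2 : C2 * b <= beta.
  by rewrite /b mulrA; apply: pbeta => //; rewrite /Cb; lra.
have A1b x : `|rdefect 1 nu1 x| <= beta.
  by apply: le_trans le1; apply: (bnd_sup BD1); exact: retract_in.
have A2b x : `|rdefect 1 nu2 x| <= beta.
  by apply: le_trans le1; apply: (bnd_sup BD2); exact: retract_in.
have powle (t : R) n : 0 <= t -> t <= Cb -> t * N ^+ n.+1 <= beta ^+ n.+1.
  move=> t0 tC; rewrite /beta exprMn ler_wpM2r ?exprn_ge0//.
  apply: le_trans tC _; rewrite exprS ler_peMr ?exprn_ege1//.
  exact: ltW.
have R_le nu (V v : Rd R d -> R) : prob_on X nu -> bfunctional X (gap a r mu 1 nu) ->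
    ndual a r s b (gap a r mu 1 nu) -> smooth V -> bnd X s (C2 * b) V -> bmeas v ->
    (forall x, v x = V (p x)) ->
    forall x, `|kop nu rkern v x - kop mu rkern v x| <= beta ^+ 2.
  move=> nX bf nd SV BV bv vE x.
  have Xpx : X (p x) by exact: retract_in.
  have Sk := smooth_sec2 (p x) smooth_kern.
  have := nd _ _ (smoothM Sk SV) _ (bndM Sk SV (HCk _ Xpx) BV).
  rewrite /gap mul1r !kopE.
  have -> : (fun y => kern (p x, p y) * V (p y)) = (fun y => rkern (x, y) * v y).
    by apply/funext => y; rewrite vE.
  move=> h; apply: le_trans (h _) _; first by rewrite !mulr_ge0// exprn_ge0.
  have := powle c3 1%N c30; rewrite /c3.
  have -> : b * (2 ^+ s * Ck * (C2 * b)) = 2 ^+ s * Ck * C2 * S ^+ 2 * N ^+ 2.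
    by rewrite /b; ring.
  by apply; rewrite -/c3 /Cb; lra.
have P_le nu (V v D : Rd R d -> R) : prob_on X nu -> bfunctional X (gap a r mu 1 nu) ->
    ndual a r s b (gap a r mu 1 nu) -> smooth V -> bnd X s (C2 * b) V ->
    smooth D -> bnd X s (C1 * b) D -> (forall x, v x = V (p x)) ->
    `|Ex nu (fun x => v x * D (p x)) - Ex mu (fun x => v x * D (p x))| <= beta ^+ 3.
  move=> nX bf nd SV BV SD BD vE.
  have := nd _ _ (smoothM SV SD) _ (bndM SV SD BV BD).
  rewrite /gap mul1r.
  have -> : (fun y => V (p y) * D (p y)) = (fun y => v y * D (p y)).
    by apply/funext => y; rewrite vE.
  move=> h; apply: le_trans (h _) _; first by rewrite !mulr_ge0// exprn_ge0.
  have := powle c4 2%N c40; rewrite /c4.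
  have -> : b * (2 ^+ s * (C2 * b) * (C1 * b)) = 2 ^+ s * C2 * C1 * S ^+ 3 * N ^+ 3.
    by rewrite /b; ring.
  by apply; rewrite -/c4 /Cb; lra.
have A1E x : rdefect 1 nu1 x = Ex nu1 (fun y => rkern (x, y)) - 1.
  by rewrite rdefectE mul1r.
have A2E x : rdefect 1 nu2 x = Ex nu2 (fun y => rkern (x, y)) - 1.
  by rewrite rdefectE mul1r.
have [bphi bpsi _ _ _] := sol.
have R2b := R_le nu2 _ _ X2 bf2 nd2 SPsi BPsi bpsi PsiE.
have R1b := R_le nu1 _ _ X1 bf1 nd1 SPhi BPhi bphi PhiE.
have P1b := P_le nu1 _ _ _ X1 bf1 nd1 SPhi BPhi SD2 BD2 PhiE.
have P2b := P_le nu2 _ _ _ X2 bf2 nd2 SPsi BPsi SD1 BD1 PsiE.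
have phib x : `|(potentials 1 nu1 1 nu2).1 x| <= beta.
  by apply: le_trans le2; case: (pb x).
have psib x : `|(potentials 1 nu1 1 nu2).2 x| <= beta.
  by apply: le_trans le2; case: (pb x).
have mc : measurable_fun setT c.
  by apply: measurable_continuous_prod; exact: smooth_continuous.
have cC x y : X x -> X y -> c (x, y) = rcost (x, y).
  by move=> Xx Xy; rewrite /rcost /= !retract_id.
have sb0 : 0 <= slope del * beta by exact: mulr_ge0.
have [small4 b1 sl1] := small_bounds beta0 sb0 small.
have lo := eot_lower (eball_measurable a r) eps0 mc bmeas_rcost cC bu um0 u_ge
  rkernE bmeas_rkern del0 k_ge k_le rkern_sym A1E A2E sol beta0 A1b A2b phib psib
  R2b R1b P1b P2b X1 X2 small4.
have up := eot_upper (eball_measurable a r) eps0 mc bmeas_rcost cC bu um0 u_ge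
  rkernE bmeas_rkern del0 k_ge k_le rkern_sym A1E A2E sol beta0 A1b A2b phib psib
  R2b R1b P1b P2b X1 X2.
have {}up := up b1 sl1.
have fin : eot c eps nu1 nu2 \is a fin_num.
  by rewrite fin_numElt (lt_le_trans (ltNyr _) lo) (le_lt_trans up (ltry _)).
exists (fine (eot c eps nu1 nu2)); first by rewrite fineK.
move: lo up; rewrite -[eot _ _ _ _]fineK// !lee_fin /= => lo up.
rewrite /second_order mul1r /C0.
rewrite (_ : _ * Cb ^+ 3 * N ^+ 3 = eps * (16 * K + 9 + (`|uc| + 3)) * beta ^+ 3); last first.
  by rewrite /beta exprMn -[in LHS]mulrA.
apply: two_sided_error lo up; [exact: ltW| |exact: exprn_ge0].
by rewrite addr_ge0// mulr_ge0.
Qed.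

(** The second-order term of the Sinkhorn divergence, times [2]. *)
Definition hadamard2 l1 nu1 l2 nu2 : R :=
  2 * eps * (second_order l1 nu1 l2 nu2
    - (second_order l1 nu1 l1 nu1 + second_order l2 nu2 l2 nu2) / 2).

Lemma hadamard2_homog t l1 nu1 l2 nu2 :
  hadamard2 (t * l1) nu1 (t * l2) nu2 = t ^+ 2 * hadamard2 l1 nu1 l2 nu2.
Proof.
rewrite /hadamard2 !second_order_homog.
move: (second_order _ _ _ _) (second_order _ _ _ _) (second_order _ _ _ _) => s12 s11 s22.
by ring.
Qed.

Lemma hadamard2_lip : exists2 C : R, 0 <= C &
  forall l1 nu1 l2 nu2 l1' nu1' l2' nu2' (N e : R),
  prob_on X nu1 -> prob_on X nu2 -> prob_on X nu1' -> prob_on X nu2' ->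
  `|tv l1 nu1| <= N -> `|tv l2 nu2| <= N -> `|tv l1' nu1'| <= N ->
  `|tv l2' nu2'| <= N ->
  `|tv l1 nu1 - tv l1' nu1'| <= e -> `|tv l2 nu2 - tv l2' nu2'| <= e ->
  `|hadamard2 l1 nu1 l2 nu2 - hadamard2 l1' nu1' l2' nu2'| <= C * (N * e).
Proof.
have [CT CT0 HT] := second_order_lip.
exists (4 * eps * CT); first by rewrite !mulr_ge0// ltW.
move=> l1 nu1 l2 nu2 l1' nu1' l2' nu2' N e X1 X2 X1' X2' n1 n2 n1' n2' d1 d2.
have h12 := HT _ _ _ _ _ _ _ _ N e X1 X2 X1' X2' n1 n2 n1' n2' d1 d2.
have h11 := HT _ _ _ _ _ _ _ _ N e X1 X1 X1' X1' n1 n1 n1' n1' d1 d1.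
have h22 := HT _ _ _ _ _ _ _ _ N e X2 X2 X2' X2' n2 n2 n2' n2' d2 d2.
have -> : 4 * eps * CT * (N * e) = 2 * eps * (2 * (CT * (N * e))) by ring.
have e2 : 0 < 2 * eps by exact: mulr_gt0.
rewrite /hadamard2 -mulrBr normrM (gtr0_norm e2) ler_pM2l//.
exact: debias_dist h12 h11 h22.
Qed.

(** The three transport costs in the divergence are expanded at
    [nu_i = mu + t (t^-1 (nu_i - mu))]; the terms linear in [lpot] cancel and
    the cubic remainder is divided by [t ^+ 2]. *)
Lemma sinkhorn_div_expansion : exists C : R, exists2 N0 : R, 0 < N0 & 0 <= C /\
  forall nu1 nu2 (t G : R), prob_on X nu1 -> prob_on X nu2 -> 0 < t ->
  `|tv t^-1 nu1| <= G -> `|tv t^-1 nu2| <= G -> t * G <= N0 ->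
  exists2 v : R, (sinkhorn_div c eps nu1 nu2 * ((t ^+ 2 / 2)^-1)%:E)%E = v%:E &
  `|v - hadamard2 t^-1 nu1 t^-1 nu2| <= C * G ^+ 3 * t.
Proof.
have [C0 [N0 N00 [C00 H]]] := eot_expansion.
exists (4 * C0); exists N0 => //; split; first exact: mulr_ge0.
move=> nu1 nu2 t G X1 X2 t0 g1 g2 tG.
have tvt nu : `|tv t^-1 nu| <= G -> `|tv 1 nu| <= t * G.
  by move=> g; rewrite -[1](mulfV (lt0r_neq0 t0)) tvecZ normrZ gtr0_norm// ler_pM2l.
have {}g1 := tvt _ g1; have {}g2 := tvt _ g2.
have [v12 e12 h12] := H _ _ _ X1 X2 g1 g2 tG.
have [v11 e11 h11] := H _ _ _ X1 X1 g1 g1 tG.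
have [v22 e22 h22] := H _ _ _ X2 X2 g2 g2 tG.
exists ((v12 - 2^-1 * (v11 + v22)) * (t ^+ 2 / 2)^-1).
  by rewrite /sinkhorn_div e12 e11 e22.
have hom : hadamard2 t^-1 nu1 t^-1 nu2 = t^-1 ^+ 2 * hadamard2 1 nu1 1 nu2.
  by rewrite -hadamard2_homog !mulr1.
rewrite hom.
have t2 : 0 < t ^+ 2 / 2 by rewrite divr_gt0// exprn_gt0.
have -> : (v12 - 2^-1 * (v11 + v22)) * (t ^+ 2 / 2)^-1
    - t^-1 ^+ 2 * hadamard2 1 nu1 1 nu2 =
  (v12 - 2^-1 * (v11 + v22) - hadamard2 1 nu1 1 nu2 / 2) * (t ^+ 2 / 2)^-1.
  by field; rewrite gt_eqF.
have t2V : 0 < (t ^+ 2 / 2)^-1 by rewrite invr_gt0.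
rewrite normrM (gtr0_norm t2V) ler_pdivrMr//.
have -> : 4 * C0 * G ^+ 3 * t * (t ^+ 2 / 2) = 2 * (C0 * (t * G) ^+ 3) by field.
move: h12 h11 h22; rewrite /hadamard2.
exact: debias_error.
Qed.

End sinkhorn_kernel.

(** * Extension of a locally Lipschitz function to a closure *)

Section quadratic_extension.
Context {R : realType} {V : normedModType R} (I : Type) (A : set I).
Context (h : I -> V) (D : I -> R) (C : R).
Hypotheses (C0 : 0 <= C) (A0 : A !=set0).
Hypothesis (D_lip : forall i j, A i -> A j ->
  `|D i - D j| <= C * ((`|h i| + `|h j|) * `|h i - h j|)).
Implicit Types (g : V) (i j : I).

(** Chosen so that the Lipschitz estimate between two indices splits into one
    penalty for each of them, through [g]. *)
Definition penalty g i := C * (2 * ((`|g| + `|g - h i|) * `|g - h i|)).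

(** McShane's formula, with a penalty that grows quadratically. *)
Definition quad_ext g := sup [set D i - penalty g i | i in A].

Lemma penalty_triangle g i j : A i -> A j -> D i - penalty g i <= D j + penalty g j.
Proof.
move=> Ai Aj; rewrite lerBlDr -addrA -lerBlDl.
apply: le_trans (ler_norm _) _; apply: le_trans (D_lip Ai Aj) _.
rewrite /penalty -mulrDr; apply: ler_wpM2l => //.
have hle k : `|h k| <= `|g| + `|g - h k|.
  by rewrite -[h k in leLHS](subKr g); exact: ler_normB.
have hij : `|h i - h j| <= `|g - h i| + `|g - h j|.
  have -> : h i - h j = (g - h j) - (g - h i) by rewrite opprB [RHS]addrC subrKA.
  by rewrite [leRHS]addrC; exact: ler_normB.
apply: le_trans (ler_pM _ _ (lerD (hle i) (hle j)) hij) _; rewrite ?addr_ge0//.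
move: (`|g|) (`|g - h i|) (`|g - h j|) => x y z.
rewrite -subr_ge0 (_ : _ - _ = (y - z) ^+ 2) ?sqr_ge0//.
by ring.
Qed.

(** All lower bounds [D i - penalty g i] lie below all upper bounds
    [D j + penalty g j]. *)
Lemma quad_ext_close g i : A i -> `|quad_ext g - D i| <= penalty g i.
Proof.
move=> Ai; rewrite ler_distl; apply/andP; split.
  apply: ub_le_sup; last by exists i.
  by exists (D i + penalty g i) => _ [j Aj <-]; exact: penalty_triangle.
apply: ge_sup; first by case: A0 => j Aj; exists (D j - penalty g j), j.
by move=> _ [j Aj <-]; exact: penalty_triangle.
Qed.

Lemma quad_ext_cvg (T : Type) (F : set_system T) {FF : Filter F} (f : T -> I) g :
  (\forall t \near F, A (f t)) -> h (f t) @[t --> F] --> g ->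
  D (f t) @[t --> F] --> quad_ext g.
Proof.
move=> fA hg.
have pen0 : penalty g (f t) @[t --> F] --> 0.
  have n0 : `|g - h (f t)| @[t --> F] --> 0.
    rewrite -(normr0 V) -(subrr g); apply: cvg_norm.
    by apply: cvgB => //; exact: cvg_cst.
  have -> : 0 = C * (2 * ((`|g| + 0) * 0)) by rewrite !mulr0.
  apply: cvgMl_tmp; apply: cvgMl_tmp; apply: cvgM => //.
  by apply: cvgD => //; exact: cvg_cst.
apply/cvgrPdist_le => e e0.
move/cvgrPdist_le: pen0 => /(_ e e0) pen0.
near=> t.
have At : A (f t) by near: t.
apply: le_trans (quad_ext_close g At) _.
have : `|0 - penalty g (f t)| <= e by near: t.
by rewrite sub0r normrN; apply: le_trans; exact: ler_norm.
Unshelve. all: by end_near. Qed.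

Lemma quad_ext_continuous g : (forall e, 0 < e -> exists2 i, A i & `|g - h i| <= e) ->
  {for g, continuous quad_ext}.
Proof.
move=> dense_g; apply/cvgrPdist_le => e e0.
(* an index within dl of g has penalties at most C (2 |g| + 2 dl) dl at g and
   C (2 |g| + 6 dl) (2 dl) at a point within dl of g *)
pose B := C * (6 * `|g| + 14).
have B0 : 0 <= B by rewrite mulr_ge0// addr_ge0// mulr_ge0.
pose dl := Num.min 1 (e / (B + 1)).
have dl0 : 0 < dl by rewrite lt_min ltr01 divr_gt0// ltr_wpDl.
have dl1 : dl <= 1 by rewrite ge_min lexx.
have dle : B * dl <= e.
  apply: (@le_trans _ _ ((B + 1) * dl)); first by rewrite ler_wpM2r ?lerDl// ltW.
  by rewrite mulrC -ler_pdivlMr ?ge_min ?lexx ?orbT// ltr_wpDl.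
have [i Ai gi] := dense_g _ dl0.
near=> g'.
have gg : `|g - g'| <= dl by near: g'; apply: cvgr_dist_le.
have gi' : `|g' - h i| <= 2 * dl.
  rewrite -(subrKA g); apply: le_trans (ler_normD _ _) _.
  by rewrite distrC mulr_natl mulr2n lerD.
have ng : `|g'| <= `|g| + dl.
  rewrite -[g' in leLHS](subrK g) addrC; apply: le_trans (ler_normD _ _) _.
  by rewrite distrC lerD2l.
apply: le_trans dle.
rewrite -(subrKA (D i)); apply: le_trans (ler_normD _ _) _.
rewrite [`|D i - _|]distrC.
apply: le_trans (lerD (quad_ext_close _ Ai) (quad_ext_close _ Ai)) _.
rewrite /penalty /B -mulrDr -[leRHS]mulrA ler_wpM2l//.
have p1 : (`|g| + `|g - h i|) * `|g - h i| <= (`|g| + dl) * dl.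
  by apply: ler_pM => //; rewrite ?addr_ge0// lerD2l.
have p2 : (`|g'| + `|g' - h i|) * `|g' - h i| <= (`|g| + dl + 2 * dl) * (2 * dl).
  by apply: ler_pM => //; rewrite ?addr_ge0// lerD.
apply: le_trans (lerD (ler_wpM2l _ p1) (ler_wpM2l _ p2)) _ => //.
rewrite (_ : _ * _ + _ * _ = (6 * `|g| + 14 * dl) * dl); last by ring.
by rewrite ler_wpM2r ?lerD2l ?(ltW dl0)// -[leRHS]mulr1 ler_wpM2l.
Unshelve. all: by end_near. Qed.

(** Both sides are close to the value at a multiple of an index near [g]. *)
Lemma quad_ext_homog t g : 0 < t ->
  (forall i, A i -> exists2 j, A j & h j = t *: h i /\ D j = t ^+ 2 * D i) ->
  (forall e, 0 < e -> exists2 i, A i & `|g - h i| <= e) ->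
  quad_ext (t *: g) = t ^+ 2 * quad_ext g.
Proof.
move=> t0 Ah dense_g; apply/eqP; rewrite -subr_eq0 -normr_le0.
apply/ler_addgt0Pr => e e0; rewrite add0r.
pose B := 2 * t ^+ 2 * (C * (2 * (`|g| + 1))).
have t2 : 0 <= t ^+ 2 by exact: sqr_ge0.
have B0 : 0 <= B by rewrite mulr_ge0//; [exact: mulr_ge0|rewrite !mulr_ge0// addr_ge0].
pose dl := Num.min 1 (e / (B + 1)).
have dl0 : 0 < dl by rewrite lt_min ltr01 divr_gt0// ltr_wpDl.
have dl1 : dl <= 1 by rewrite ge_min lexx.
have dle : B * dl <= e.
  apply: (@le_trans _ _ ((B + 1) * dl)); first by rewrite ler_wpM2r ?lerDl// ltW.
  by rewrite mulrC -ler_pdivlMr ?ge_min ?lexx ?orbT// ltr_wpDl.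
have [i Ai gi] := dense_g _ dl0.
have [j Aj [hj Dj]] := Ah i Ai.
have c1 := quad_ext_close (t *: g) Aj.
have pj : penalty (t *: g) j = t ^+ 2 * penalty g i.
  by rewrite /penalty hj -scalerBr !normrZ gtr0_norm//; ring.
have pi : penalty g i <= C * (2 * (`|g| + 1)) * dl.
  rewrite /penalty -!mulrA ler_wpM2l// ler_wpM2l// ler_pM// ?addr_ge0//.
  by rewrite lerD2l; exact: le_trans dl1.
rewrite -(subrKA (D j)); apply: le_trans (ler_normD _ _) _.
apply: le_trans dle.
rewrite {2}Dj -mulrBr normrM (ger0_norm t2) [`|D i - _|]distrC.
rewrite pj in c1.
apply: le_trans (lerD c1 (ler_wpM2l t2 (quad_ext_close g Ai))) _.
rewrite -mulr2n -mulr_natl mulrA /B -[leRHS]mulrA ler_wpM2l// mulr_ge0//.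
Qed.

End quadratic_extension.

(** * Second-order differentiability of the Sinkhorn divergence *)

Lemma gibbs_scaling (R : realType) (d : nat) (eps : R) (c : Rd R d * Rd R d -> R)
    (a : Rd R d) (r : {posnum R}) (mu : probability (Rd R d) R) :
  0 < eps -> smooth c -> (forall z, 0 <= c z) ->
  exists2 u : Rd R d -> R, bmeas u &
  (exists2 m : R, 0 < m & forall x, m <= u x) /\
  forall x, u x * Ex mu (fun y => gibbs eps c (retract a r x, retract a r y) * u y) = 1.
Proof.
move=> eps0 Sc c0.
have bg := bmeas_retract2 a r (smooth_continuous (smooth_gibbs eps Sc)).
have [M M0 cM] := bmeas_bound (bmeas_rcost a r Sc).
apply: (exists_schroedinger_potential mu bg (expR_gt0 (- (M / eps))) _ _ a) => z.
  rewrite ler_expR lerN2 ler_pM2r ?invr_gt0//.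
  by apply: le_trans (cM z); exact: ler_norm.
by rewrite -expR0 ler_expR oppr_le0 divr_ge0// ltW.
Qed.

Lemma closure_dense (R : realType) (V : normedModType R) (A : set V) g (e : R) :
  closure A g -> 0 < e -> exists2 h, A h & `|g - h| <= e.
Proof.
move=> Ag e0; have [h [Ah]] := Ag _ (nbhsx_ballx g e e0).
by rewrite -ball_normE /= => /ltW gh; exists h.
Qed.

Theorem theorem5 (R : realType) (d : nat) (eps : R)
    (c : Rd R d * Rd R d -> R) (a : Rd R d) (r : {posnum R}) :
  0 < eps ->
  smooth c -> (forall z, 0 <= c z) -> (forall x y, c (x, y) = c (y, x)) ->
  forall (s : nat) (mu : probability (Rd R d) R),
  prob_on (closed_eball a r%:num) mu ->
  let M := closure (tangent a r s mu) in
  exists Delta : linf R (Cs_ball (closed_eball a r%:num) s) *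
                 linf R (Cs_ball (closed_eball a r%:num) s) -> R,
  [/\ {within M `*` M, continuous Delta},
      forall (mu1 mu2 : R -> probability (Rd R d) R)
             (g1 g2 : linf R (Cs_ball (closed_eball a r%:num) s)),
        (forall t, 0 < t ->
           prob_spt_on (closed_eball a r%:num) mu (mu1 t) /\
           prob_spt_on (closed_eball a r%:num) mu (mu2 t)) ->
        t^-1 *: (linf_of_prob a r s (mu1 t) - linf_of_prob a r s mu)
          @[t --> 0^'+] --> g1 ->
        t^-1 *: (linf_of_prob a r s (mu2 t) - linf_of_prob a r s mu)
          @[t --> 0^'+] --> g2 ->
        (sinkhorn_div c eps (mu1 t) (mu2 t) * ((t ^+ 2 / 2)^-1)%:E)%E
          @[t --> 0^'+] --> (Delta (g1, g2))%:E &
      forall (t : R) g, 0 < t -> (M `*` M) g ->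
        Delta (t *: g) = t ^+ 2 * Delta g].
Proof.
move=> eps0 Sc c0 csym s mu muX M.
have [u bu [[um um0 u_ge] u_eq]] := gibbs_scaling a r mu eps0 Sc c0.
(* an index is a pair of positive multiples of differences nu - mu *)
pose I := ((R * probability (Rd R d) R) * (R * probability (Rd R d) R))%type.
pose A : set I := [set i |
  (0 < i.1.1 /\ prob_spt_on (closed_eball a r%:num) mu i.1.2) /\
  (0 < i.2.1 /\ prob_spt_on (closed_eball a r%:num) mu i.2.2)].
pose h (i : I) := (tvec a r s mu i.1.1 i.1.2, tvec a r s mu i.2.1 i.2.2).
pose D (i : I) := hadamard2 eps c a r mu u i.1.1 i.1.2 i.2.1 i.2.2.
have [C C0 D_lip] := hadamard2_lip s eps0 Sc csym muX bu um0 u_ge u_eq.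
have A0 : A !=set0.
  have XA : prob_spt_on (closed_eball a r%:num) mu mu by split=> //; exact: subset_refl.
  by exists ((1, mu), (1, mu)); split; split => //=; exact: ltr01.
have {}D_lip i j : A i -> A j ->
    `|D i - D j| <= C * ((`|h i| + `|h j|) * `|h i - h j|).
  move=> [[_ [i1 _]] [_ [i2 _]]] [[_ [j1 _]] [_ [j2 _]]].
  have fst_le (z : linf R (Cs_ball (closed_eball a r%:num) s) *
      linf R (Cs_ball (closed_eball a r%:num) s)) : `|z.1| <= `|z| /\ `|z.2| <= `|z|.
    by rewrite prod_normE; split; rewrite le_max lexx// orbT.
  have [hi1 hi2] := fst_le (h i); have [hj1 hj2] := fst_le (h j).
  have [hd1 hd2] := fst_le (h i - h j).
  apply: (D_lip _ _ _ _ _ _ _ _ _ _ i1 i2 j1 j2 _ _ _ _ hd1 hd2).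
  - by apply: le_trans hi1 _; rewrite lerDl.
  - by apply: le_trans hi2 _; rewrite lerDl.
  - by apply: le_trans hj1 _; rewrite lerDr.
  - by apply: le_trans hj2 _; rewrite lerDr.
have dense g : (M `*` M) g -> forall e, 0 < e -> exists2 i, A i & `|g - h i| <= e.
  case: g => g1 g2 [/= M1 M2] e e0.
  have [_ [nu1 [l1 [X1 l10 ->]]] n1] := closure_dense M1 e0.
  have [_ [nu2 [l2 [X2 l20 ->]]] n2] := closure_dense M2 e0.
  by exists ((l1, nu1), (l2, nu2)) => //; rewrite prod_normE /= ge_max n1 n2.
exists (quad_ext A h D C); split.
- apply: continuous_in_subspaceT => g /set_mem Mg.
  exact: quad_ext_continuous C0 A0 D_lip _ (dense g Mg).
- move=> mu1 mu2 g1 g2 mu12 G1 G2.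
  pose f t : I := ((t^-1, mu1 t), (t^-1, mu2 t)).
  have lim_D : D (f t) @[t --> 0^'+] --> quad_ext A h D C (g1, g2).
    apply: (quad_ext_cvg C0 A0 D_lip); last exact: (cvg_pair G1 G2).
    near=> t; have t0 : 0 < t by near: t; exact: nbhs_right_gt.
    by have [X1 X2] := mu12 t t0; split; split; rewrite //= invr_gt0.
  have [B [N0 N00 [B0 HB]]] := sinkhorn_div_expansion s eps0 Sc csym muX bu um0 u_ge u_eq.
  pose G := Num.max `|g1| `|g2| + 1.
  have G0 : 0 < G by rewrite ltr_wpDl// le_max normr_ge0.
  have near_bound (nu : R -> probability (Rd R d) R) g : `|g| + 1 <= G ->
      t^-1 *: (linf_of_prob a r s (nu t) - linf_of_prob a r s mu) @[t --> 0^'+] --> g ->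
      \forall t \near 0^'+, `|tvec a r s mu t^-1 (nu t)| <= G.
    move=> gG /cvgrPdist_le/(_ 1 ltr01); apply: filterS => t h1.
    apply: le_trans gG; rewrite -lerBlDl.
    by apply: le_trans h1; rewrite distrC; exact: lerB_dist.
  have nb1 : \forall t \near 0^'+, `|tvec a r s mu t^-1 (mu1 t)| <= G.
    by apply: near_bound G1; rewrite lerD2r le_max lexx.
  have nb2 : \forall t \near 0^'+, `|tvec a r s mu t^-1 (mu2 t)| <= G.
    by apply: near_bound G2; rewrite lerD2r le_max lexx orbT.
  pose v t := fine (sinkhorn_div c eps (mu1 t) (mu2 t) * ((t ^+ 2 / 2)^-1)%:E).
  have near_v : \forall t \near 0^'+,
      (sinkhorn_div c eps (mu1 t) (mu2 t) * ((t ^+ 2 / 2)^-1)%:E)%E = (v t)%:E /\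
      `|v t - D (f t)| <= B * G ^+ 3 * t.
    near=> t; have t0 : 0 < t by near: t; exact: nbhs_right_gt.
    have [[X1 _] [X2 _]] := mu12 t t0.
    have tG : t * G <= N0.
      by rewrite -ler_pdivlMr//; near: t; apply: nbhs_right_le; exact: divr_gt0.
    have [w ew hw] : exists2 w : R, (sinkhorn_div c eps (mu1 t) (mu2 t) *
        ((t ^+ 2 / 2)^-1)%:E)%E = w%:E & `|w - D (f t)| <= B * G ^+ 3 * t.
      by apply: (HB _ _ _ _ X1 X2 t0 _ _ tG); near: t; [exact: nb1|exact: nb2].
    by rewrite /v ew.
  have lim_v : v t @[t --> 0^'+] --> quad_ext A h D C (g1, g2).
    have err0 : v t - D (f t) @[t --> 0^'+] --> 0.
      apply/cvgr0Pnorm_le => e e0.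
      have BG : 0 < B * G ^+ 3 + 1 by rewrite ltr_wpDl// mulr_ge0// exprn_ge0// ltW.
      near=> t.
      have [_ h1] : (sinkhorn_div c eps (mu1 t) (mu2 t) * ((t ^+ 2 / 2)^-1)%:E)%E
          = (v t)%:E /\ `|v t - D (f t)| <= B * G ^+ 3 * t by near: t.
      apply: le_trans h1 _.
      have t0 : 0 < t by near: t; exact: nbhs_right_gt.
      apply: (@le_trans _ _ ((B * G ^+ 3 + 1) * t)).
        by rewrite ler_wpM2r ?lerDl// ltW.
      rewrite mulrC -ler_pdivlMr//; near: t; apply: nbhs_right_le.
      exact: divr_gt0.
    rewrite -(add0r (quad_ext _ _ _ _ _)).
    have -> : v = (fun t => v t - D (f t)) \+ (fun t => D (f t)).
      by apply/funext => t /=; rewrite subrK.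
    exact: cvgD err0 lim_D.
  by apply: cvg_EFin lim_v; apply: filterS near_v => t [-> _].
- move=> t g t0 Mg.
  apply: (quad_ext_homog C0 A0 D_lip t0 _ (dense g Mg)) => -[[l1 nu1] [l2 nu2]].
  move=> [[/= l10 X1] [l20 X2]]; exists ((t * l1, nu1), (t * l2, nu2)).
    by split; split; rewrite //= mulr_gt0.
  split; first by rewrite /h /= !tvecZ.
  exact: (hadamard2_homog eps0 Sc csym bu um0 u_ge u_eq).
Unshelve. all: by end_near.
Qed.
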